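(* The map $$(\psi_1,\dots,\psi_k,\Omega)\mapsto M(\psi_1,\dots,\psi_k,\Omega):=dd^\#\psi_1\wedge\dots\wedge dd^\#\psi_k\wedge\Omega,$$ defined when the $\psi_j$ are smooth convex functions on $\mathbb R^n$ and $\Omega$ is a closed, weakly positive and strong $(p,p)$-current on $\mathbb R^n$, has an extension to all ($\mathbb R$-valued) convex functions $\psi_j$ on $\mathbb R^n$ and all $(p,p)$-currents $\Omega$ that are closed, weakly positive and strong, which is continuous in the following sense: if $\psi_j^i$ converges to $\psi_j$ uniformly for $j=1,\dots,k$ and $\Omega^i$ converges to $\Omega$ weak* as $i\to\infty$, then $M(\psi_1^i,\dots,\psi_k^i,\Omega^i)$ converges weak* to $M(\psi_1,\dots,\psi_k,\Omega)$. Moreover $M(\psi_1,\dots,\psi_k,\Omega)$ is again closed, weakly positive and strong.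
   Context: A superform of bidegree $(p,q)$ on $\mathbb R^n$ is a form $\alpha=\sum_{|I|=p,|K|=q}\alpha_{IK}(x)\,dx_I\wedge d\xi_K$ on $\mathbb R^n_x\times\mathbb R^n_\xi$ whose coefficients depend only on $x$; $d$ is the exterior derivative. For a function $\psi$, $d^\#\psi=\sum_j\frac{\partial\psi}{\partial x_j}d\xi_j$, so $dd^\#\psi=\sum_{j,k}\frac{\partial^2\psi}{\partial x_j\partial x_k}dx_j\wedge d\xi_k$. For a $(1,0)$-form $a=\sum a_jdx_j$, $a^\#=\sum a_jd\xi_j$. The superintegral is normalized by $\int f\,dx_1\wedge d\xi_1\wedge\dots\wedge dx_n\wedge d\xi_n=\int_{\mathbb R^n}f\,dx$. A current of bidegree $(p,q)$ is a continuous linear functional on smooth compactly supported superforms of bidegree $(n-p,n-q)$, written $\sum\Omega_{IK}dx_I\wedge d\xi_K$, with action written $\int\Omega\wedge\alpha$; currents are assumed to have measure coefficients. A $(p,p)$-form or current is symmetric if $\Omega_{IK}=\Omega_{KI}$ for increasing multiindices $I,K$. An elementary $(q,q)$-form is a constant-coefficient form $a_1\wedge a_1^\#\wedge\dots\wedge a_q\wedge a_q^\#$ with $a_j$ of bidegree $(1,0)$. Strongly positive $(q,q)$-forms (at a point) are finite nonnegative combinations of elementary ones. A symmetric $(q,q)$-form at a point is weakly positive if its wedge product with every elementary $(n-q,n-q)$-form is $\ge0$, and weakly null if both it and its negative are weakly positive. It is strong if it is a difference of two strongly positive forms. A form with continuous coefficients has one of these properties if it has it at each point. A symmetric $(p,p)$-current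 $\Omega$ is weakly positive if $\int\Omega\wedge\Omega'\ge0$ for every smooth compactly supported strongly positive $(n-p,n-p)$-form $\Omega'$; it is strong if $\int\Omega\wedge\Omega'=0$ for every smooth compactly supported weakly null $(n-p,n-p)$-form $\Omega'$ (for continuous forms this agrees with the pointwise definition). *)

(* Defs.v *)
From HB Require Import structures.
From mathcomp Require Import all_boot all_order all_algebra.
From mathcomp Require Import all_classical all_reals all_analysis.

Set Implicit Arguments.
Unset Strict Implicit.
Unset Printing Implicit Defensive.

Import Order.TTheory GRing.Theory Num.Theory.
Import numFieldNormedType.Exports.

Local Open Scope ring_scope.

Section ConstantForms.
Variables (R : realType) (n : nat).

(* [a (I, K)] is the coefficient of dx_I /\ dxi_K, for increasing multiindices
   I and K, which are encoded as sets. *)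
Definition sform := {ffun {set 'I_n} * {set 'I_n} -> R^o}.

Definition bidegree (q r : nat) (a : sform) : Prop :=
  forall I K, a (I, K) != 0 -> #|I| = q /\ #|K| = r.

Definition dxdxi (I K : {set 'I_n}) : sform := [ffun u => (u == (I, K))%:R].
Definition dx (j : 'I_n) : sform := dxdxi [set j] finset.set0.
Definition dxi (j : 'I_n) : sform := dxdxi finset.set0 [set j].
Definition sform1 : sform := dxdxi finset.set0 finset.set0.

(* dx_I /\ dx_J = shuffle_sign I J dx_(I :|: J) *)
Definition shuffle_sign (I J : {set 'I_n}) : R :=
  if [disjoint I & J]
  then (-1) ^+ #|[set ij : 'I_n * 'I_n | [&& ij.1 \in I, ij.2 \in J
                                           & (ij.2 < ij.1)%N]]|
  else 0.

(* The factor (-1) ^+ (#|K| * #|I'|) moves dx_I' to the left of dxi_K. *)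
Definition wedge_sign (u v : {set 'I_n} * {set 'I_n}) : R :=
  (-1) ^+ (#|u.2| * #|v.1|)%N * shuffle_sign u.1 v.1 * shuffle_sign u.2 v.2.

Definition swedge (a b : sform) : sform :=
  \sum_(u : {set 'I_n} * {set 'I_n}) \sum_(v : {set 'I_n} * {set 'I_n})
    (a u * b v * wedge_sign u v) *: dxdxi (u.1 :|: v.1) (u.2 :|: v.2).

Definition vol : sform := \big[swedge/sform1]_(j < n) swedge (dx j) (dxi j).

(* The number c such that the (n, n)-part of a is c *: vol; the coefficient of
   the full index sets in vol is 1 or -1. *)
Definition top_coef (a : sform) : R := a ([set: 'I_n], [set: 'I_n]) / vol ([set: 'I_n], [set: 'I_n]).

(* A (1, 0)-form is given by its row of coefficients. *)
Definition form10 (a : 'rV[R]_n) : sform := \sum_(j < n) a 0 j *: dx j.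
Definition form10_sharp (a : 'rV[R]_n) : sform := \sum_(j < n) a 0 j *: dxi j.

Definition elementary (q : nat) (a : 'I_q -> 'rV[R]_n) : sform :=
  \big[swedge/sform1]_(i < q) swedge (form10 (a i)) (form10_sharp (a i)).

Definition strongly_positive (q : nat) (a : sform) : Prop :=
  exists (m : nat) (c : 'I_m -> R) (e : 'I_m -> 'I_q -> 'rV[R]_n),
    (forall i, 0 <= c i) /\ a = \sum_(i < m) c i *: elementary (e i).

Definition symmetric_form (q : nat) (a : sform) : Prop :=
  bidegree q q a /\ forall I K, a (I, K) = a (K, I).

Definition weakly_positive (q : nat) (a : sform) : Prop :=
  symmetric_form q a /\
  forall r : nat, (q + r)%N = n -> forall e : 'I_r -> 'rV[R]_n,
    0 <= top_coef (swedge a (elementary e)).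

Definition weakly_null (q : nat) (a : sform) : Prop :=
  weakly_positive q a /\ weakly_positive q (- a).

End ConstantForms.

Local Open Scope classical_set_scope.

Section Superforms.
Variables (R : realType) (n : nat).

Definition partial (j : 'I_n) (f : 'rV[R]_n -> R) : 'rV[R]_n -> R :=
  fun x => 'D_(delta_mx 0 j) f x.

(* C^infinity: every iterated partial derivative exists and is continuous. *)
Definition smooth (f : 'rV[R]_n -> R) : Prop :=
  forall s : seq 'I_n, let g := foldr partial f s in
    continuous g /\ forall (j : 'I_n) x, derivable g x (delta_mx 0 j).

Definition test_function (f : 'rV[R]_n -> R) : Prop :=
  smooth f /\ compact (closure [set x | f x != 0]).

Definition superform := 'rV[R]_n -> sform R n.

Definition coef (alpha : superform) (u : {set 'I_n} * {set 'I_n}) :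
  'rV[R]_n -> R := fun x => alpha x u.

Definition test_form (q r : nat) (alpha : superform) : Prop :=
  (forall x, bidegree q r (alpha x)) /\
  (forall u, test_function (coef alpha u)).

Definition ext_d (alpha : superform) : superform := fun x =>
  \sum_(j < n) swedge (dx R j) [ffun u => partial j (coef alpha u) x].

Definition d_sharp (psi : 'rV[R]_n -> R) : superform := fun x =>
  \sum_(j < n) partial j psi x *: dxi R j.

Definition dd_sharp (psi : 'rV[R]_n -> R) : superform := ext_d (d_sharp psi).

Definition dd_sharp_wedge (k : nat) (psi : 'I_k -> 'rV[R]_n -> R) : superform :=
  fun x => \big[@swedge R n/sform1 R n]_(j < k) dd_sharp (psi j) x.

End Superforms.

Section Currents.
Variables (R : realType) (n : nat).

(* [T alpha] stands for the integral of T /\ alpha; only the values of a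
   (p, q)-current on test forms of bidegree (n - p, n - q) are meaningful. The
   complementary bidegree is written (p', q') with p + p' = n and q + q' = n, so
   nothing is required of T when p > n or q > n. *)
Definition functional := superform R n -> R.

(* The constant form b of bidegree (n - #|I|, n - #|K|), proportional to
   dx_(~: I) /\ dxi_(~: K), for which dx_I /\ dxi_K /\ b = vol. *)
Definition dual_form (I K : {set 'I_n}) : sform R n :=
  let b := dxdxi R (~: I)%SET (~: K)%SET in
  (top_coef (swedge (dxdxi R I K) b))^-1 *: b.

(* The distribution Omega_IK in Omega = \sum Omega_IK dx_I /\ dxi_K. *)
Definition current_coef (T : functional) (I K : {set 'I_n})
    (f : 'rV[R]_n -> R) : R :=
  T (fun x => f x *: dual_form I K).

Definition borel_space := g_sigma_algebraType (@open 'rV[R]_n).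

Definition locally_finite (mu : {measure set borel_space -> \bar R}) : Prop :=
  forall A : set 'rV[R]_n, compact A -> (mu A < +oo)%E.

(* A real Radon measure on R^n need not be a finite signed measure, so it is
   given as a difference of two positive ones. *)
Definition is_measure (L : ('rV[R]_n -> R) -> R) : Prop :=
  exists mu nu : {measure set borel_space -> \bar R},
    [/\ locally_finite mu, locally_finite nu &
        forall f, test_function f ->
          L f = (\int[mu]_x f x)%R - (\int[nu]_x f x)%R].

(* Continuity on test forms follows from the measure coefficients. *)
Definition current (p q : nat) (T : functional) : Prop :=
  (forall p' q', (p + p')%N = n -> (q + q')%N = n ->
     forall (c : R) (alpha beta : superform R n),
       test_form p' q' alpha -> test_form p' q' beta ->
       T (fun x => c *: alpha x + beta x) = c * T alpha + T beta) /\
  (forall I K : {set 'I_n}, #|I| = p -> #|K| = q ->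
     is_measure (current_coef T I K)).

(* dT = 0, since (dT)(alpha) is T (d alpha) up to sign. For p = n there is no
   test form of bidegree (n - p - 1, n - q), and every current is closed. *)
Definition closed_current (p q : nat) (T : functional) : Prop :=
  forall p' q', (p + p').+1 = n -> (q + q')%N = n ->
    forall alpha : superform R n, test_form p' q' alpha ->
      T (ext_d alpha) = 0.

Definition symmetric_current (p : nat) (T : functional) : Prop :=
  forall I K : {set 'I_n}, #|I| = p -> #|K| = p ->
    forall f, test_function f -> current_coef T I K f = current_coef T K I f.

Definition weakly_positive_current (p : nat) (T : functional) : Prop :=
  symmetric_current p T /\
  forall q, (p + q)%N = n ->
    forall alpha : superform R n, test_form q q alpha ->
      (forall x, strongly_positive q (alpha x)) -> 0 <= T alpha.

Definition strong_current (p : nat) (T : functional) : Prop :=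
  symmetric_current p T /\
  forall q, (p + q)%N = n ->
    forall alpha : superform R n, test_form q q alpha ->
      (forall x, weakly_null q (alpha x)) -> T alpha = 0.

Definition closed_positive_strong (p : nat) (T : functional) : Prop :=
  [/\ current p p T, closed_current p p T, weakly_positive_current p T
    & strong_current p T].

Definition weak_star_cvg (p q : nat) (T_ : nat -> functional) (T : functional) :
    Prop :=
  forall p' q', (p + p')%N = n -> (q + q')%N = n ->
    forall alpha : superform R n, test_form p' q' alpha ->
      T_ i alpha @[i --> \oo] --> T alpha.

Definition eq_current (p q : nat) (S T : functional) : Prop :=
  forall p' q', (p + p')%N = n -> (q + q')%N = n ->
    forall alpha : superform R n, test_form p' q' alpha -> S alpha = T alpha.

(* beta /\ T for a smooth form beta of even total degree, for which
   beta /\ T /\ alpha = T /\ beta /\ alpha. *)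
Definition wedge_current (beta : superform R n) (T : functional) : functional :=
  fun alpha => T (fun x => swedge (beta x) (alpha x)).

Definition convex (psi : 'rV[R]_n -> R) : Prop :=
  convex_function (E := 'rV[R]_n) setT psi.

End Currents.

(* Main.v *)
(** The case of [k] functions reduces to a single convex [psi]. For [psi] smooth,
    closedness of [T] allows two integrations by parts, giving
    [T (dd^# psi /\ al) = T (psi dd^# al)] for every test form [al].
    The right-hand side extends to continuous [psi], because a weakly positive
    strong current is of order zero, uniformly in the current: there are finitely
    many elementary forms [E_l] and linear functionals [lam_l] for which
    [al - \sum_l lam_l(al) E_l] is always weakly null, so that
    [T al = \sum_l T (lam_l(al) E_l)], and then [|T (g al)| <= sup |g| * T ga]
    with [ga] a sum of cutoff functions times the [E_l], depending on [al] only.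
    This estimate gives both the extension and its joint continuity in [psi] and
    [T]. Positivity and strongness survive because [psi] is locally uniformly
    approximated by smooth convex functions (log-sum-exp of tangents), whose
    Hessians are sums of squares [a /\ a#]; the measure coefficients come from the
    Riesz theorem applied to the positive functionals [f |-> T (f E_l)]. *)

(* Weak* convergence only tests smooth forms, while [psi dd^# al] has merely continuous
   coefficients. Joint continuity therefore needs a majorant [ga] chosen before the current:
   [T_i ga] then converges, hence stays bounded, and one smooth [f] close to [psi] on the support of
   [al] serves all the currents at once. The algebraic obstacle is that orthogonality to the
   elementary (q,q)-forms, a linear condition suited to projections, must imply weak nullity, a
   condition on wedge products with elementary forms of complementary degree. The bridge:
   contracting an elementary form by a covector in both its dx and dxi slots gives a multiple of an
   elementary form of one degree less, because the factors can be sheared until at most one of them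
   is not orthogonal to that covector. The hypotheses give d-closedness, while the integrations by
   parts involve d and d^#; the automorphism swapping dx and dxi, under which symmetric currents are
   invariant up to sign, supplies the second. Products are limits along fixed smooth convex
   approximants, so closedness, positivity and strongness are read off before the limit. *)
Require Import Defs.
From HB Require Import structures.
From mathcomp Require Import all_boot all_order all_algebra.
From mathcomp Require Import all_classical all_reals all_analysis.
From mathcomp Require Import measurable_realfun.
From mathcomp Require Import ring lra zify.
Set Implicit Arguments.
Unset Strict Implicit.
Unset Printing Implicit Defensive.
Import Order.TTheory GRing.Theory Num.Theory.
Import numFieldNormedType.Exports.
Local Open Scope ring_scope.

(** * Exterior algebra *)

Section ShuffleSign.
Variables (R : realType) (n : nat).
Implicit Types I J K : {set 'I_n}.

Definition inversions I J : {set 'I_n * 'I_n} :=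
  [set ij | [&& ij.1 \in I, ij.2 \in J & (ij.2 < ij.1)%N]].

Lemma shuffle_signE I J : [disjoint I & J] ->
  shuffle_sign R I J = (-1) ^+ #|inversions I J|.
Proof. by rewrite /shuffle_sign => ->. Qed.

Lemma shuffle_sign0 I J : ~~ [disjoint I & J] -> shuffle_sign R I J = 0.
Proof. by rewrite /shuffle_sign => /negbTE ->. Qed.

Lemma disjointUl I J K :
  [disjoint I :|: J & K] = [disjoint I & K] && [disjoint J & K].
Proof. by rewrite -!finset.setI_eq0 finset.setIUl finset.setU_eq0. Qed.

Lemma disjointUr I J K :
  [disjoint K & I :|: J] = [disjoint K & I] && [disjoint K & J].
Proof. by rewrite -!finset.setI_eq0 finset.setIUr finset.setU_eq0. Qed.

Lemma cardsU_disjoint (T : finType) (A B : {set T}) :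
  [disjoint A & B] -> #|A :|: B| = (#|A| + #|B|)%N.
Proof. by rewrite -finset.setI_eq0 => /eqP AB; rewrite cardsU AB cards0 subn0. Qed.

Lemma shuffle_signUl I J K : [disjoint I & J] ->
  shuffle_sign R (I :|: J) K = shuffle_sign R I K * shuffle_sign R J K.
Proof.
move=> IJ; case: (boolP [disjoint I & K]) => IK; last first.
  by rewrite (shuffle_sign0 IK) shuffle_sign0 ?mul0r// disjointUl (negbTE IK).
case: (boolP [disjoint J & K]) => JK; last first.
  by rewrite (shuffle_sign0 JK) shuffle_sign0 ?mulr0// disjointUl (negbTE JK) andbF.
rewrite !shuffle_signE ?disjointUl ?IK// -exprD; congr (_ ^+ _).
rewrite -cardsU_disjoint.
  by apply: eq_card => -[i j]; rewrite !inE/= andb_orl.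
rewrite -finset.setI_eq0; apply/eqP/setP => -[i j]; rewrite !inE/=.
apply/negP => /andP[/and3P[iI _ _] /and3P[iJ _ _]].
by move: IJ; rewrite disjoint_subset => /fintype.subsetP/(_ i iI); rewrite inE iJ.
Qed.

Lemma shuffle_signUr I J K : [disjoint I & J] ->
  shuffle_sign R K (I :|: J) = shuffle_sign R K I * shuffle_sign R K J.
Proof.
move=> IJ; case: (boolP [disjoint K & I]) => IK; last first.
  by rewrite (shuffle_sign0 IK) shuffle_sign0 ?mul0r// disjointUr (negbTE IK).
case: (boolP [disjoint K & J]) => JK; last first.
  by rewrite (shuffle_sign0 JK) shuffle_sign0 ?mulr0// disjointUr (negbTE JK) andbF.
rewrite !shuffle_signE ?disjointUr ?IK// -exprD; congr (_ ^+ _).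
rewrite -cardsU_disjoint.
  apply: eq_card => -[i j]; rewrite !inE/=.
  by case: (i \in K); case: (j \in I); case: (j \in J); case: (j < i)%N.
rewrite -finset.setI_eq0; apply/eqP/setP => -[i j]; rewrite !inE/=.
apply/negP => /andP[/and3P[_ iI _] /and3P[_ iJ _]].
by move: IJ; rewrite disjoint_subset => /fintype.subsetP/(_ j iI); rewrite inE iJ.
Qed.

(** If I, J, K are pairwise disjoint, both sides count the inversions between the three pairs;
    otherwise both vanish. *)
Lemma shuffle_signA I J K :
  shuffle_sign R I J * shuffle_sign R (I :|: J) K =
  shuffle_sign R I (J :|: K) * shuffle_sign R J K.
Proof.
case: (boolP [disjoint I & J]) => IJ; last first.
  by rewrite (shuffle_sign0 IJ) (@shuffle_sign0 I (J :|: K)) ?mul0r// disjointUr (negbTE IJ).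
case: (boolP [disjoint J & K]) => JK; last first.
  rewrite (shuffle_sign0 JK) (@shuffle_sign0 (I :|: J)) ?mulr0//.
  by rewrite disjointUl (negbTE JK) andbF.
by rewrite shuffle_signUl// shuffle_signUr// mulrA.
Qed.

(** A pair in I x J is an inversion for exactly one of the two orders, since disjointness excludes i
    = j. The two inversion counts therefore add up to [#|I| * #|J|]. *)
Lemma shuffle_signC I J :
  shuffle_sign R I J = (-1) ^+ (#|I| * #|J|) * shuffle_sign R J I.
Proof.
case: (boolP [disjoint I & J]) => IJ; last first.
  by rewrite !shuffle_sign0 ?mulr0// disjoint_sym.
rewrite !shuffle_signE// 1?disjoint_sym//.
have -> : (#|I| * #|J| = #|inversions I J| + #|inversions J I|)%N.
  rewrite -cardsX.
  have -> : #|inversions J I| = #|[set ij : 'I_n * 'I_n |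
      [&& ij.1 \in I, ij.2 \in J & (ij.1 < ij.2)%N]]|.
    have swap_inj : injective (fun ij : 'I_n * 'I_n => (ij.2, ij.1)).
      by move=> [i j] [i' j'] [-> ->].
    transitivity #|[set (ij.2, ij.1) | ij in inversions J I]%SET|.
      by rewrite card_imset.
    apply: eq_card => -[i j]; rewrite [RHS]inE/=.
    apply/finset.imsetP/idP => [[[a b]]|/and3P[iI jJ ij]].
      by rewrite inE/= => /and3P[aJ bI ba] [-> ->]; rewrite bI aJ ba.
    by exists (j, i) => //; rewrite inE/= jJ iI ij.
  rewrite -cardsU_disjoint.
    apply: eq_card => -[i j]; rewrite !inE/=.
    case: (boolP (i \in I)) => //= iI; case: (boolP (j \in J)) => //= jJ.
    case: ltngtP => // /val_inj ij; move: IJ; rewrite disjoint_subset.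
    by move=> /fintype.subsetP/(_ i iI); rewrite inE -ij jJ.
  rewrite -finset.setI_eq0; apply/eqP/setP => -[i j]; rewrite !inE/=.
  by apply/negP => /andP[/and3P[_ _ ij] /and3P[_ _ ji]]; case: ltngtP ij ji.
by rewrite exprD -mulrA -exprD addnn -mul2n exprM sqrrN !expr1n mulr1.
Qed.

Lemma shuffle_sign0l I : shuffle_sign R finset.set0 I = 1.
Proof.
rewrite shuffle_signE; last by rewrite -finset.setI_eq0 finset.set0I.
rewrite (_ : inversions _ _ = finset.set0) ?cards0//.
by apply/setP => -[i j]; rewrite !inE.
Qed.

Lemma shuffle_sign0r I : shuffle_sign R I finset.set0 = 1.
Proof. by rewrite shuffle_signC cards0 muln0 mul1r shuffle_sign0l. Qed.

End ShuffleSign.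

(* [swedge] is a double sum: kept transparent, it makes unification diverge. *)
Fact wedge_key : unit. Proof. exact: tt. Qed.
Definition wedge (R : realType) (n : nat) : sform R n -> sform R n -> sform R n :=
  locked_with wedge_key (@swedge R n).
Lemma wedge_unlock (R : realType) (n : nat) : @wedge R n = @swedge R n.
Proof. exact: locked_withE. Qed.

(** * Wedge product: bilinearity, associativity, graded commutativity *)

Section Wedge.
Variables (R : realType) (n : nat).
Notation form := (sform R n).
Notation idx := ({set 'I_n} * {set 'I_n})%type.
Implicit Types (a b c : form) (u v w : idx).

Definition joini u v : idx := (u.1 :|: v.1, u.2 :|: v.2).
Definition ebase u : form := dxdxi R u.1 u.2.

Lemma ebaseE u v : ebase u v = (v == u)%:R.
Proof. by rewrite ffunE -surjective_pairing. Qed.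

Lemma sform_sum (I : Type) (r : seq I) (P : pred I) (F : I -> form) u :
  (\sum_(i <- r | P i) F i) u = \sum_(i <- r | P i) F i u.
Proof. by rewrite sum_ffunE. Qed.

Lemma sformZE (x : R) a u : (x *: a) u = x * a u.
Proof. by rewrite ffunE. Qed.

Lemma sform_basis a : a = \sum_u a u *: ebase u.
Proof.
apply/ffunP => v; rewrite sform_sum (bigD1 v)//= big1 ?addr0.
  by rewrite sformZE ebaseE eqxx mulr1.
by move=> u uv; rewrite sformZE ebaseE eq_sym (negbTE uv) mulr0.
Qed.

Lemma swedgeE a b w : wedge a b w =
  \sum_u \sum_v a u * b v * wedge_sign R u v * (w == joini u v)%:R.
Proof.
rewrite wedge_unlock sform_sum; apply: eq_bigr => u _; rewrite sform_sum.
by apply: eq_bigr => v _; rewrite sformZE -[dxdxi _ _ _]/(ebase (joini u v)) ebaseE.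
Qed.

Lemma swedgeC_tr a b w : wedge a b w =
  \sum_v \sum_u a u * b v * wedge_sign R u v * (w == joini u v)%:R.
Proof. by rewrite swedgeE exchange_big. Qed.

Lemma swedgeDl a a' b : wedge (a + a') b = wedge a b + wedge a' b.
Proof.
apply/ffunP => w; rewrite ffunE !swedgeE -big_split; apply: eq_bigr => u _.
by rewrite -big_split; apply: eq_bigr => v _; rewrite ffunE /= !mulrDl.
Qed.

Lemma swedgeDr a b b' : wedge a (b + b') = wedge a b + wedge a b'.
Proof.
apply/ffunP => w; rewrite ffunE !swedgeE -big_split; apply: eq_bigr => u _.
by rewrite -big_split; apply: eq_bigr => v _; rewrite ffunE /= mulrDr !mulrDl.
Qed.

Lemma swedgeZl (x : R) a b : wedge (x *: a) b = x *: wedge a b.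
Proof.
apply/ffunP => w; rewrite sformZE !swedgeE mulr_sumr; apply: eq_bigr => u _.
by rewrite mulr_sumr; apply: eq_bigr => v _; rewrite sformZE !mulrA.
Qed.

Lemma swedgeZr (x : R) a b : wedge a (x *: b) = x *: wedge a b.
Proof.
apply/ffunP => w; rewrite sformZE !swedgeE mulr_sumr; apply: eq_bigr => u _.
rewrite mulr_sumr; apply: eq_bigr => v _; rewrite sformZE.
by rewrite (mulrCA (a u)) !mulrA.
Qed.

Lemma swedge0l b : wedge 0 b = 0.
Proof. by have := swedgeZl 0 0 b; rewrite !scale0r. Qed.

Lemma swedge0r a : wedge a 0 = 0.
Proof. by have := swedgeZr 0 a 0; rewrite !scale0r. Qed.

Lemma swedgeNl a b : wedge (- a) b = - wedge a b.
Proof. by rewrite -scaleN1r (swedgeZl (-1)); rewrite scaleN1r. Qed.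

Lemma swedgeNr a b : wedge a (- b) = - wedge a b.
Proof. by rewrite -scaleN1r swedgeZr scaleN1r. Qed.

Lemma swedge_ebase u v :
  wedge (ebase u) (ebase v) = wedge_sign R u v *: ebase (joini u v).
Proof.
rewrite wedge_unlock /swedge (bigD1 u)//= [X in _ + X]big1 ?addr0; last first.
  move=> u' uu'; rewrite big1// => v' _.
  by rewrite ebaseE (negbTE uu') !mul0r scale0r.
rewrite (bigD1 v)//= [X in _ + X]big1 ?addr0; last first.
  by move=> v' vv'; rewrite (ebaseE v) (negbTE vv') mulr0 mul0r scale0r.
by rewrite !ebaseE !eqxx !mul1r.
Qed.


Definition lin (f : form -> form) := forall x a b, f (x *: a + b) = x *: f a + f b.

Lemma linZE f x a : lin f -> f (x *: a) = x *: f a.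
Proof.
move=> lf; have f0 : f 0 = 0.
  by have := lf (-1) 0 0; rewrite scaler0 addr0 scaleN1r addNr.
by have := lf x a 0; rewrite !addr0 f0 addr0.
Qed.

Lemma lin0E f : lin f -> f 0 = 0.
Proof. by move=> lf; have := linZE 0 0 lf; rewrite !scale0r. Qed.

Lemma linDE f a b : lin f -> f (a + b) = f a + f b.
Proof. by move=> lf; have := lf 1 a b; rewrite !scale1r. Qed.

Lemma lin_sumE f (I : Type) (r : seq I) (P : pred I) (F : I -> form) : lin f ->
  f (\sum_(i <- r | P i) F i) = \sum_(i <- r | P i) f (F i).
Proof.
move=> lf; elim: r => [|i r IH]; first by rewrite !big_nil lin0E.
by rewrite !big_cons; case: (P i); rewrite ?linDE// IH.
Qed.

Lemma lin_ebase (f g : form -> form) : lin f -> lin g ->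
  (forall u, f (ebase u) = g (ebase u)) -> f =1 g.
Proof.
move=> lf lg fg a; rewrite [a]sform_basis.
rewrite !lin_sumE//; apply: eq_bigr => u _; by rewrite !linZE// fg.
Qed.

Lemma lin_swedgel b : lin (fun a => wedge a b).
Proof. by move=> x a a'; rewrite swedgeDl swedgeZl. Qed.

Lemma lin_swedger a : lin (wedge a).
Proof. by move=> x b b'; rewrite swedgeDr swedgeZr. Qed.

Lemma lin_comp f g : lin f -> lin g -> lin (f \o g).
Proof. by move=> lf lg x a b /=; rewrite lg lf. Qed.

Lemma swedge_suml (I : Type) (r : seq I) (P : pred I) (F : I -> form) b :
  wedge (\sum_(i <- r | P i) F i) b = \sum_(i <- r | P i) wedge (F i) b.
Proof. exact: (lin_sumE r P F (lin_swedgel b)). Qed.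

Lemma swedge_sumr (I : Type) (r : seq I) (P : pred I) (F : I -> form) a :
  wedge a (\sum_(i <- r | P i) F i) = \sum_(i <- r | P i) wedge a (F i).
Proof. exact: (lin_sumE r P F (lin_swedger a)). Qed.

Lemma joiniA u v w : joini (joini u v) w = joini u (joini v w).
Proof. by rewrite /joini/= !finset.setUA. Qed.

(** The cocycle identity behind associativity. The powers of -1 agree only when cardinals of unions
    add up; when [u.2] meets [v.2], or [v.1] meets [w.1], both sides contain a vanishing shuffle
    sign. *)
Lemma wedge_signA u v w :
  wedge_sign R u v * wedge_sign R (joini u v) w =
  wedge_sign R u (joini v w) * wedge_sign R v w.
Proof.
rewrite /wedge_sign/=.
have A1 := shuffle_signA R u.1 v.1 w.1; have A2 := shuffle_signA R u.2 v.2 w.2.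
set s1 := shuffle_sign R u.1 v.1 in A1 *; set t1 := shuffle_sign R (_ :|: _) w.1 in A1 *.
set s2 := shuffle_sign R u.2 v.2 in A2 *; set t2 := shuffle_sign R (_ :|: _) w.2 in A2 *.
set s1' := shuffle_sign R u.1 _ in A1 *; set t1' := shuffle_sign R v.1 w.1 in A1 *.
set s2' := shuffle_sign R u.2 _ in A2 *; set t2' := shuffle_sign R v.2 w.2 in A2 *.
set e1 := (-1) ^+ _; set e2 := (-1) ^+ _; set e3 := (-1) ^+ _; set e4 := (-1) ^+ _.
have -> : e1 * s1 * s2 * (e2 * t1 * t2) = e1 * e2 * (s1 * t1) * (s2 * t2) by ring.
have -> : e3 * s1' * s2' * (e4 * t1' * t2') = e3 * e4 * (s1' * t1') * (s2' * t2').
  by ring.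
rewrite A1 A2.
case: (boolP [disjoint u.2 & v.2]) => D2; last first.
  by rewrite -A2 /s2 (shuffle_sign0 R D2) mul0r !mulr0.
case: (boolP [disjoint v.1 & w.1]) => D1; last first.
  by rewrite /t1' (shuffle_sign0 R D1) mulr0 !(mulr0, mul0r).
congr (_ * _ * _); rewrite /e1 /e2 /e3 /e4 -!exprD !cardsU_disjoint//.
by congr (_ ^+ _); rewrite mulnDl mulnDr addnA.
Qed.

Lemma swedgeA a b c : wedge (wedge a b) c = wedge a (wedge b c).
Proof.
pose A1 c b a := wedge (wedge a b) c; pose A2 c b a := wedge a (wedge b c).
suff: A1 c b =1 A2 c b by apply.
apply: lin_ebase; [exact: (lin_comp (lin_swedgel _) (lin_swedgel _))|
  exact: lin_swedgel|move=> u].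
suff: A1 c ^~ (ebase u) =1 A2 c ^~ (ebase u) by apply.
apply: lin_ebase; [exact: (lin_comp (lin_swedgel _) (lin_swedger _))|
  exact: (lin_comp (lin_swedger _) (lin_swedgel _))|move=> v].
suff: (fun c => A1 c (ebase v) (ebase u)) =1 (fun c => A2 c (ebase v) (ebase u)) by apply.
apply: lin_ebase; [exact: lin_swedger|
  exact: (lin_comp (lin_swedger _) (lin_swedger _))|move=> w].
rewrite /A1 /A2.
by rewrite !swedge_ebase !(swedgeZl, swedgeZr) !swedge_ebase !scalerA wedge_signA
  joiniA mulrC.
Qed.

Lemma sform1E : sform1 R n = ebase (finset.set0, finset.set0).
Proof. by []. Qed.

Lemma swedge1l a : wedge (sform1 R n) a = a.
Proof.
suff: wedge (sform1 R n) =1 id by apply.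
apply: lin_ebase => [|//|[I K]]; first exact: lin_swedger.
rewrite sform1E swedge_ebase /joini /wedge_sign/= !finset.set0U cards0.
by rewrite mul0n !shuffle_sign0l !mulr1 scale1r.
Qed.

Lemma swedge1r a : wedge a (sform1 R n) = a.
Proof.
suff: (fun a => wedge a (sform1 R n)) =1 id by apply.
apply: lin_ebase => [|//|[I K]]; first exact: lin_swedgel.
rewrite sform1E swedge_ebase /joini /wedge_sign/= !finset.setU0 cards0.
by rewrite muln0 !shuffle_sign0r !mulr1 scale1r.
Qed.

Lemma wedge_signC u v : wedge_sign R u v =
  (-1) ^+ ((#|u.1| + #|u.2|) * (#|v.1| + #|v.2|)) * wedge_sign R v u.
Proof.
rewrite /wedge_sign (shuffle_signC R u.1) (shuffle_signC R u.2).
rewrite (mulnC #|v.2| #|u.1|).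
have -> : ((#|u.1| + #|u.2|) * (#|v.1| + #|v.2|) =
  #|u.1| * #|v.1| + #|u.2| * #|v.2| + #|u.2| * #|v.1| + #|u.1| * #|v.2|)%N by nia.
(* The exponent of the claimed sign and that of [wedge_sign R v u] both contain [#|u.1| * #|v.2|];
   this factor occurs twice and cancels. *)
rewrite !exprD; set x := (-1) ^+ (#|u.1| * #|v.2|).
have x2 : x * x = 1 by rewrite -expr2 sqrr_sign.
set s := (-1) ^+ _; set t := (-1) ^+ _; set r := (-1) ^+ _.
rewrite [RHS](_ : _ = (x * x) * (s * t * r * shuffle_sign R v.1 u.1 * shuffle_sign R v.2 u.2)).
  by rewrite x2; ring.
by ring.
Qed.

Lemma wedge_sign_neq0 u v : wedge_sign R u v != 0 ->
  [disjoint u.1 & v.1] && [disjoint u.2 & v.2].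
Proof.
apply: contraNT; rewrite negb_and => /orP[] D.
  by rewrite /wedge_sign (shuffle_sign0 R D) mulr0 mul0r.
by rewrite /wedge_sign (shuffle_sign0 R D) mulr0.
Qed.

Lemma bidegree0 q r : bidegree q r (0 : form).
Proof. by move=> I K; rewrite ffunE eqxx. Qed.

Lemma bidegreeD q r a b : bidegree q r a -> bidegree q r b -> bidegree q r (a + b).
Proof.
move=> Ha Hb I K; rewrite ffunE => ab0.
have [a0|a0] := eqVneq (a (I, K)) 0; last exact: Ha.
by apply: Hb; apply: contraNN ab0 => /eqP b0; rewrite a0 b0 addr0.
Qed.

Lemma bidegreeZ q r (x : R) a : bidegree q r a -> bidegree q r (x *: a).
Proof. by move=> Ha I K; rewrite sformZE mulf_eq0 negb_or => /andP[_ /Ha]. Qed.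

Lemma bidegree_sum q r (I : Type) (s : seq I) (P : pred I) (F : I -> form) :
  (forall i, P i -> bidegree q r (F i)) -> bidegree q r (\sum_(i <- s | P i) F i).
Proof. by move=> H; apply: big_ind => //; [exact: bidegree0|exact: bidegreeD]. Qed.

Lemma bidegree_ebase u : bidegree #|u.1| #|u.2| (ebase u).
Proof.
move=> I K; rewrite ebaseE; have [<-//|] := eqVneq (I, K) u.
by rewrite eqxx.
Qed.

Lemma bidegree_dx j : bidegree 1 0 (dx R j : form).
Proof. by have := @bidegree_ebase ([set j], finset.set0); rewrite /= cards1 cards0. Qed.

Lemma bidegree_dxi j : bidegree 0 1 (dxi R j : form).
Proof. by have := @bidegree_ebase (finset.set0, [set j]); rewrite /= cards1 cards0. Qed.

Lemma bidegree1 : bidegree 0 0 (sform1 R n).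
Proof. by have := @bidegree_ebase (finset.set0, finset.set0); rewrite /= cards0. Qed.

Lemma bidegreeP q r a : bidegree q r a <->
  (forall u, ~~ ((#|u.1| == q) && (#|u.2| == r)) -> a u = 0).
Proof.
split=> [H [I K]/= N|H I K N].
  by apply/eqP; apply: contraNT N => /H[-> ->]; rewrite !eqxx.
have [/andP[/eqP-> /eqP->]//|N'] := boolP ((#|I| == q) && (#|K| == r)).
by move: N; rewrite (H (I, K) N') eqxx.
Qed.

Lemma bidegree_swedge q r q' r' a b : bidegree q r a -> bidegree q' r' b ->
  bidegree (q + q') (r + r') (wedge a b).
Proof.
move=> Ha Hb; rewrite wedge_unlock; apply: bidegree_sum => u _; apply: bidegree_sum => v _.
have [a0|a0] := eqVneq (a u) 0.
  by rewrite a0 !mul0r scale0r; exact: bidegree0.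
have [b0|b0] := eqVneq (b v) 0.
  by rewrite b0 mulr0 mul0r scale0r; exact: bidegree0.
have [s0|/wedge_sign_neq0/andP[D1 D2]] := eqVneq (wedge_sign R u v) 0.
  by rewrite s0 mulr0 scale0r; exact: bidegree0.
case: u v a0 b0 D1 D2 => [I K] [I' K']/= /Ha[<- <-] /Hb[<- <-] D1 D2.
apply: bidegreeZ; have := @bidegree_ebase (I :|: I', K :|: K').
by rewrite /= !cardsU_disjoint.
Qed.

Lemma swedge_sgnC q r q' r' a b : bidegree q r a -> bidegree q' r' b ->
  wedge a b = (-1) ^+ ((q + r) * (q' + r')) *: wedge b a.
Proof.
move=> Ha Hb; apply/ffunP => w; rewrite sformZE swedgeE swedgeC_tr mulr_sumr.
apply: eq_bigr => v _; rewrite mulr_sumr; apply: eq_bigr => u _.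
have [a0|a0] := eqVneq (a u) 0; first by rewrite a0 !(mulr0, mul0r).
have [b0|b0] := eqVneq (b v) 0; first by rewrite b0 !(mulr0, mul0r).
case: u v a0 b0 => [I K] [I' K']/= a0 b0.
have [<- <-] := Ha _ _ a0; have [<- <-] := Hb _ _ b0.
rewrite (wedge_signC (I, K))/= /joini/= (finset.setUC I) (finset.setUC K).
by ring.
Qed.

(** A (1,1)-form has even total degree, hence is central. *)
Lemma swedge11C a b : bidegree 1 1 a -> wedge a b = wedge b a.
Proof.
move=> Ha; suff: wedge a =1 (fun b => wedge b a) by apply.
apply: lin_ebase => [||v]; [exact: lin_swedger|exact: lin_swedgel|].
rewrite (swedge_sgnC Ha (@bidegree_ebase v)).
by rewrite mulnDl exprD -expr2 sqrr_sign scale1r.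
Qed.

End Wedge.

(** * Contractions and elementary forms *)

Section Contraction.
Variables (R : realType) (n : nat).
Notation form := (sform R n).
Notation idx := ({set 'I_n} * {set 'I_n})%type.
Implicit Types (a c : form) (u v w : idx) (g h : bool * 'I_n).

(** The x and xi directions are treated alike, as 2n odd generators: [(true, j)] is dx_j and
    [(false, j)] is dxi_j. The same convention governs [gin], [gadd], [grem] and the order [glt], in
    which every dx precedes every dxi. *)
Definition gen g : form := if g.1 then dx R g.2 else dxi R g.2.
Definition gin g u := if g.1 then g.2 \in u.1 else g.2 \in u.2.
Definition gadd g u : idx :=
  if g.1 then (g.2 |: u.1, u.2) else (u.1, g.2 |: u.2).
Definition grem g u : idx :=
  if g.1 then (u.1 :\ g.2, u.2) else (u.1, u.2 :\ g.2).
Definition glt h g :=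
  if h.1 then ~~ g.1 || (h.2 < g.2)%N else ~~ g.1 && (h.2 < g.2)%N.
Definition below (I : {set 'I_n}) (j : 'I_n) : nat := #|[set i in I | (i < j)%N]|.
(** The number of generators preceding [g] in dx_I /\ dxi_K, that is, the transpositions needed to
    put [g] in place. *)
Definition gpos g u : nat :=
  if g.1 then below u.1 g.2 else (#|u.1| + below u.2 g.2)%N.
Definition gsgn g u : R := (-1) ^+ gpos g u.

Lemma shuffle_sign_set1 (j : 'I_n) (I : {set 'I_n}) :
  shuffle_sign R [set j] I = if j \in I then 0 else (-1) ^+ below I j.
Proof.
have D : [disjoint [set j] & I] = (j \notin I) by rewrite disjoints1.
case: ifPn => jI; first by rewrite shuffle_sign0// D jI.
rewrite shuffle_signE ?D//; congr (_ ^+ _).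
rewrite /below -(card_imset _ (_ : injective (fun i : 'I_n => (j, i)))); last first.
  by move=> x y [].
apply: eq_card => -[i k]; rewrite inE/= inE; apply/idP/finset.imsetP.
  by move=> /and3P[/eqP-> kI kj]; exists k => //; rewrite inE kI kj.
by move=> [x]; rewrite inE => /andP[xI xj] [-> ->]; rewrite eqxx xI xj.
Qed.

Lemma gen_ebase g u : wedge (gen g) (ebase R u) =
  if gin g u then 0 else gsgn g u *: ebase R (gadd g u).
Proof.
case: g u => [[] j] [I K]; rewrite /gen /gin /gsgn /gpos /gadd/=.
  rewrite (swedge_ebase R ([set j], finset.set0) (I, K)) /wedge_sign /joini/=.
  rewrite cards0 mul0n mul1r shuffle_sign0l mulr1 finset.set0U shuffle_sign_set1.
  by case: ifP => // _; rewrite scale0r.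
rewrite (swedge_ebase R (finset.set0, [set j]) (I, K)) /wedge_sign /joini/=.
rewrite cards1 mul1n shuffle_sign0l mulr1 finset.set0U shuffle_sign_set1 exprD.
by case: ifP => // _; rewrite mulr0 scale0r.
Qed.

(** Contraction by the generator [g]: the adjoint of left multiplication by [gen g] when the forms
    [ebase u] are orthonormal ([inner_gen]), and an antiderivation ([iota_gen]). *)
Definition iota g c : form :=
  [ffun u => if gin g u then 0 else gsgn g u * c (gadd g u)].

Lemma lin_iota g : lin (iota g).
Proof.
move=> x a b; apply/ffunP => u; rewrite !ffunE; case: ifP => _.
  by rewrite scaler0 addr0.
by rewrite mulrDr; congr (_ + _); rewrite mulrCA.
Qed.

Lemma graddK g u : ~~ gin g u -> grem g (gadd g u) = u.
Proof.
case: g u => [[] j] [I K]; rewrite /gin /gadd /grem/= => jI; congr (_, _);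
  apply/setP => i; rewrite !inE; by have [->|] := eqVneq i j; rewrite ?(negbTE jI).
Qed.

Lemma gremK g u : gin g u -> gadd g (grem g u) = u.
Proof.
by case: g u => [[] j] [I K]; rewrite /gin /gadd /grem/= => jI; rewrite finset.setD1K.
Qed.

Lemma gin_grem g u : ~~ gin g (grem g u).
Proof. by case: g u => [[] j] [I K]; rewrite /gin /grem/= !inE eqxx. Qed.

Lemma gin_gadd g h u : gin g (gadd h u) = (g == h) || gin g u.
Proof.
by case: g u h => [[] j] [I K] [[] k]; rewrite /gin /gadd/= ?inE // xpair_eqE.
Qed.

Lemma gaddC g h u : gadd g (gadd h u) = gadd h (gadd g u).
Proof.
by case: g u h => [[] j] [I K] [[] k]; rewrite /gadd/= // finset.setUCA.
Qed.

Lemma below_add (I : {set 'I_n}) (i j : 'I_n) : i \notin I ->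
  below (i |: I) j = ((i < j) + below I j)%N.
Proof.
move=> iI; rewrite /below; have [ij|ij] := ltnP i j.
  rewrite (_ : finset _ = i |: [set i in I | (i < j)%N]) ?cardsU1 ?inE ?(negbTE iI)//.
  by apply/setP => k; rewrite !inE; have [->|] := eqVneq k i; rewrite ?ij.
rewrite add0n; apply: eq_card => k; rewrite !inE.
by have [->|//] := eqVneq k i; rewrite ltnNge ij (negbTE iI).
Qed.

Lemma gsgn_gadd g h u : ~~ gin h u ->
  gsgn g (gadd h u) = (-1) ^+ glt h g * gsgn g u.
Proof.
rewrite /gsgn -exprD => hu; congr (_ ^+ _).
case: g u h hu => [[] j] [I K] [[] k]; rewrite /gin /gadd /gpos /glt/= => hu //.
- by rewrite below_add.
- by rewrite cardsU1 hu addnA.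
- by rewrite below_add// addnCA.
Qed.

Lemma gltC g h : g != h -> glt g h = ~~ glt h g.
Proof.
case: g h => [[] j] [[] k]; rewrite /glt //= xpair_eqE/= -val_eqE/= => jk;
  by case: ltngtP jk.
Qed.

Lemma gsgn2 g u : gsgn g u * gsgn g u = 1.
Proof. by rewrite -expr2 sqrr_sign. Qed.

Lemma iota_ebase g v : iota g (ebase R v) =
  if gin g v then gsgn g (grem g v) *: ebase R (grem g v) else 0.
Proof.
apply/ffunP => u; rewrite ffunE ebaseE; case: ifPn => gu.
  case: ifP => gv; last by rewrite ffunE.
  rewrite sformZE ebaseE; have [uv|] := eqVneq u (grem g v); last by rewrite mulr0.
  by move: gu; rewrite uv (negbTE (gin_grem _ _)).
case: ifPn => gv.
  rewrite sformZE ebaseE.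
  have -> : (gadd g u == v) = (u == grem g v).
    by apply/eqP/eqP => [<-|->]; rewrite ?graddK ?gremK.
  by have [->|] := eqVneq u (grem g v); rewrite ?mulr0.
rewrite ffunE; have [uv|] := eqVneq (gadd g u) v; last by rewrite mulr0.
by move: gv; rewrite -uv gin_gadd eqxx.
Qed.

(** The canonical anticommutation relation. For g != h the minus sign appears because exactly one of
    [glt g h] and [glt h g] holds, so adding [h] and removing [g] in the two orders changes the
    position count by one. *)
Lemma iota_gen g h c :
  iota g (wedge (gen h) c) = (g == h)%:R *: c - wedge (gen h) (iota g c).
Proof.
suff: (iota g \o wedge (gen h)) =1
    (fun c => (g == h)%:R *: c - wedge (gen h) (iota g c)) by apply.
apply: lin_ebase.
- exact: (lin_comp (lin_iota _) (lin_swedger _)).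
- move=> x a b; rewrite lin_iota lin_swedger scalerBr !scalerDr !scalerA.
  by rewrite mulrC opprD addrACA.
move=> v; rewrite /= gen_ebase iota_ebase.
have [<-{h}|gh] := eqVneq g h.
  rewrite scale1r; case: ifPn => gv.
    rewrite (lin0E (lin_iota g)) swedgeZr gen_ebase (negbTE (gin_grem _ _)).
    by rewrite scalerA gsgn2 scale1r gremK// subrr.
  rewrite swedge0r subr0 (linZE _ _ (lin_iota g)) iota_ebase gin_gadd eqxx/=.
  by rewrite graddK// scalerA gsgn2 scale1r.
rewrite scale0r sub0r; case: ifPn => hv.
  rewrite (lin0E (lin_iota g)); case: ifPn => gv; last by rewrite swedge0r oppr0.
  rewrite swedgeZr gen_ebase.
  have -> : gin h (grem g v).
    by move: hv; rewrite -{1}(gremK gv) gin_gadd eq_sym (negbTE gh).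
  by rewrite scaler0 oppr0.
rewrite (linZE _ _ (lin_iota g)) iota_ebase gin_gadd (negbTE gh)/=.
case: ifPn => gv; last by rewrite scaler0 swedge0r oppr0.
set w := grem g v; have vE : v = gadd g w by rewrite gremK.
have gw : ~~ gin g w := gin_grem g v.
have hw : ~~ gin h w.
  by apply: contraNN hv; rewrite vE gin_gadd => ->; rewrite orbT.
rewrite swedgeZr gen_ebase (negbTE hw) !scalerA.
have -> : grem g (gadd h v) = gadd h w by rewrite vE gaddC graddK// gin_gadd (negbTE gh).
rewrite (congr1 (gsgn h) vE) !gsgn_gadd// (gltC gh) -scaleNr; congr (_ *: _).
by case: (glt h g); rewrite /= ?expr0 ?expr1; ring.
Qed.

Definition inner a c : R := \sum_u a u * c u.

Lemma innerDl a a' c : inner (a + a') c = inner a c + inner a' c.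
Proof. by rewrite -big_split; apply: eq_bigr => u _; rewrite ffunE mulrDl. Qed.

Lemma innerZl (x : R) a c : inner (x *: a) c = x * inner a c.
Proof. by rewrite mulr_sumr; apply: eq_bigr => u _; rewrite ffunE -mulrA. Qed.

Lemma innerC a c : inner a c = inner c a.
Proof. by apply: eq_bigr => u _; rewrite mulrC. Qed.

Lemma innerZr (x : R) a c : inner a (x *: c) = x * inner a c.
Proof. by rewrite innerC innerZl (innerC a). Qed.

Lemma inner0l c : inner 0 c = 0.
Proof. by have := innerZl 0 0 c; rewrite scale0r mul0r. Qed.

Lemma inner0r c : inner c 0 = 0.
Proof. by rewrite innerC inner0l. Qed.

Lemma inner_suml (I : Type) (r : seq I) (P : pred I) (F : I -> form) c :
  inner (\sum_(i <- r | P i) F i) c = \sum_(i <- r | P i) inner (F i) c.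
Proof.
elim: r => [|i r IH]; first by rewrite !big_nil inner0l.
by rewrite !big_cons; case: (P i); rewrite ?innerDl IH.
Qed.

Lemma inner_sumr (I : Type) (r : seq I) (P : pred I) (F : I -> form) c :
  inner c (\sum_(i <- r | P i) F i) = \sum_(i <- r | P i) inner c (F i).
Proof. by rewrite innerC inner_suml; apply: eq_bigr => i _; rewrite innerC. Qed.

Lemma inner_ebase u c : inner (ebase R u) c = c u.
Proof.
rewrite /inner (bigD1 u)//= ebaseE eqxx mul1r big1 ?addr0// => v vu.
by rewrite ebaseE (negbTE vu) mul0r.
Qed.

Lemma inner_eq0 a : inner a a = 0 -> a = 0.
Proof.
move=> a0; apply/ffunP => u; rewrite ffunE; apply/eqP; rewrite -sqrf_eq0 expr2.
apply/eqP; apply: (psumr_eq0P _ a0) => // v _; exact: sqr_ge0.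
Qed.

Lemma inner_gen g a c : inner (wedge (gen g) a) c = inner a (iota g c).
Proof.
rewrite [a]sform_basis swedge_sumr !inner_suml; apply: eq_bigr => u _.
rewrite swedgeZr !innerZl gen_ebase inner_ebase ffunE; congr (_ * _).
by case: ifP; rewrite ?inner0l// innerZl inner_ebase.
Qed.

Implicit Types (p z : bool * 'I_n -> R).

Definition gvec p : form := \sum_g p g *: gen g.
Definition iotav p c : form := \sum_g p g *: iota g c.

Lemma lin_iotav p : lin (iotav p).
Proof.
move=> x a b; rewrite /iotav scaler_sumr -big_split; apply: eq_bigr => g _ /=.
by rewrite lin_iota scalerDr !scalerA mulrC.
Qed.

Lemma inner_gvec p a c : inner (wedge (gvec p) a) c = inner a (iotav p c).
Proof.
rewrite swedge_suml inner_suml inner_sumr; apply: eq_bigr => g _.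
by rewrite swedgeZl innerZl innerZr inner_gen.
Qed.

Lemma iotav_gvec p z c : iotav p (wedge (gvec z) c) =
  (\sum_g p g * z g) *: c - wedge (gvec z) (iotav p c).
Proof.
rewrite /iotav [X in _ = _ - X]swedge_sumr scaler_suml -sumrB; apply: eq_bigr => g _.
rewrite swedge_suml (lin_sumE _ _ _ (lin_iota g)) swedgeZr.
under eq_bigr do rewrite (swedgeZl _ (gen _) c) (linZE _ _ (lin_iota g)) iota_gen scalerBr.
rewrite sumrB scalerBr; congr (_ - _ *: _).
  rewrite (bigD1 g)//= eqxx scale1r big1 ?addr0 ?scalerA// => h hg.
  by rewrite eq_sym (negbTE hg) scale0r scaler0.
by rewrite swedge_suml; apply: eq_bigr => h _; rewrite swedgeZl.
Qed.

Definition xcov (b : 'rV[R]_n) g : R := if g.1 then b 0 g.2 else 0.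
Definition xicov (b : 'rV[R]_n) g : R := if g.1 then 0 else b 0 g.2.
Definition dotr (b b' : 'rV[R]_n) : R := \sum_j b 0 j * b' 0 j.

Lemma big_gen (V : nmodType) (F : bool * 'I_n -> V) :
  \sum_g F g = \sum_j F (true, j) + \sum_j F (false, j).
Proof.
rewrite (eq_bigr (fun g => F (g.1, g.2))); last by case.
by rewrite -(pair_bigA _ (fun e j => F (e, j)))/= big_bool.
Qed.

Lemma gvec_xcov b : gvec (xcov b) = form10 b.
Proof.
by rewrite /gvec big_gen /xcov/= [X in _ + X]big1 ?addr0// => j _; rewrite scale0r.
Qed.

Lemma gvec_xicov b : gvec (xicov b) = form10_sharp b.
Proof.
by rewrite /gvec big_gen /xicov/= [X in X + _]big1 ?add0r// => j _; rewrite scale0r.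
Qed.

Lemma xcov_dot b b' : \sum_g xcov b g * xcov b' g = dotr b b'.
Proof. by rewrite big_gen /xcov/= [X in _ + X]big1 ?addr0// => j _; rewrite mul0r. Qed.

Lemma xicov_dot b b' : \sum_g xicov b g * xicov b' g = dotr b b'.
Proof. by rewrite big_gen /xicov/= [X in X + _]big1 ?add0r// => j _; rewrite mul0r. Qed.

Lemma xcov_xicov b b' : \sum_g xcov b g * xicov b' g = 0.
Proof. by rewrite big_gen /xcov /xicov/= !big1 ?addr0// => j _; rewrite ?mulr0 ?mul0r. Qed.

Lemma xicov_xcov b b' : \sum_g xicov b g * xcov b' g = 0.
Proof. by rewrite big_gen /xcov /xicov/= !big1 ?addr0// => j _; rewrite ?mulr0 ?mul0r. Qed.

Definition sq (b : 'rV[R]_n) : form := wedge (form10 b) (form10_sharp b).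
(** [elementary] on sequences: recursion on the factors opens shears and contractions to
    induction. *)
Definition elem (s : seq 'rV[R]_n) : form := foldr (fun b => wedge (sq b)) (sform1 R n) s.

Lemma elem_cons b s : elem (b :: s) = wedge (form10 b) (wedge (form10_sharp b) (elem s)).
Proof. by rewrite /= swedgeA. Qed.

Lemma iotav1 p : iotav p (sform1 R n) = 0.
Proof.
rewrite /iotav big1// => g _; rewrite sform1E iota_ebase.
by rewrite /gin/= !inE if_same scaler0.
Qed.

Lemma iotax_elem0 b s : (forall b', b' \in s -> dotr b b' = 0) ->
  iotav (xcov b) (elem s) = 0 /\ iotav (xicov b) (elem s) = 0.
Proof.
elim: s => [|b' s IH] H; first by rewrite !iotav1.
have [|H1 H2] := IH; first by move=> x xs; apply: H; rewrite inE xs orbT.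
have d0 : dotr b b' = 0 by apply: H; rewrite inE eqxx.
rewrite elem_cons -gvec_xcov -gvec_xicov !iotav_gvec H1 H2.
by rewrite xcov_dot xicov_dot xcov_xicov xicov_xcov d0 !scale0r !swedge0r !(subr0, swedge0r).
Qed.

(** By the antiderivation rule only the first factor survives; its dx slot contributes one
    [dotr b b0] and its dxi slot the other. *)
Lemma iotaxx_elem b b0 s : (forall b', b' \in s -> dotr b b' = 0) ->
  iotav (xicov b) (iotav (xcov b) (elem (b0 :: s))) = dotr b b0 ^+ 2 *: elem s.
Proof.
move=> /iotax_elem0[H1 H2].
rewrite elem_cons -gvec_xcov -gvec_xicov !iotav_gvec H1 xcov_dot xcov_xicov.
rewrite scale0r swedge0r subr0 swedge0r subr0 (linZE _ _ (lin_iotav _)) iotav_gvec.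
by rewrite H2 swedge0r subr0 xicov_dot scalerA expr2.
Qed.

Lemma form10_lin (x : R) b b' : form10 (b + x *: b') = form10 b + x *: form10 b' :> form.
Proof.
rewrite /form10 scaler_sumr -big_split; apply: eq_bigr => j _ /=.
by rewrite !mxE scalerDl scalerA.
Qed.

Lemma form10_sharp_lin (x : R) b b' :
  form10_sharp (b + x *: b') = form10_sharp b + x *: form10_sharp b' :> form.
Proof.
rewrite /form10_sharp scaler_sumr -big_split; apply: eq_bigr => j _ /=.
by rewrite !mxE scalerDl scalerA.
Qed.

Lemma bidegree_form10 b : bidegree 1 0 (form10 b : form).
Proof. by apply: bidegree_sum => j _; apply: bidegreeZ; exact: bidegree_dx. Qed.

Lemma bidegree_form10_sharp b : bidegree 0 1 (form10_sharp b : form).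
Proof. by apply: bidegree_sum => j _; apply: bidegreeZ; exact: bidegree_dxi. Qed.

Lemma bidegree_sq b : bidegree 1 1 (sq b).
Proof.
exact: (bidegree_swedge (@bidegree_form10 b) (@bidegree_form10_sharp b)).
Qed.

Lemma bidegree_elem s : bidegree (size s) (size s) (elem s).
Proof.
elim: s => [|b s IH]; first exact: bidegree1.
exact: (bidegree_swedge (@bidegree_sq b) IH).
Qed.

Lemma form10_sqr b c : wedge (form10 b) (wedge (form10 b) c) = 0.
Proof.
have e : wedge (form10 b) (form10 b) = 0 :> form.
  have := swedge_sgnC (@bidegree_form10 b) (@bidegree_form10 b).
  rewrite expr1 scaleN1r => /eqP; rewrite -addr_eq0 -mulr2n -scaler_nat scaler_eq0.
  by rewrite pnatr_eq0 => /eqP.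
by rewrite -swedgeA e swedge0l.
Qed.

Lemma form10_sharp_sqr b c : wedge (form10_sharp b) (wedge (form10_sharp b) c) = 0.
Proof.
have e : wedge (form10_sharp b) (form10_sharp b) = 0 :> form.
  have := swedge_sgnC (@bidegree_form10_sharp b) (@bidegree_form10_sharp b).
  rewrite expr1 scaleN1r => /eqP; rewrite -addr_eq0 -mulr2n -scaler_nat scaler_eq0.
  by rewrite pnatr_eq0 => /eqP.
by rewrite -swedgeA e swedge0l.
Qed.

Lemma form10_sharpC b b' c : wedge (form10_sharp b) (wedge (form10 b') c) =
  - wedge (form10 b') (wedge (form10_sharp b) c).
Proof.
have := swedge_sgnC (@bidegree_form10_sharp b) (@bidegree_form10 b').
rewrite expr1 scaleN1r; move: (form10_sharp b) (form10 b') => Y X YX.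
by rewrite -[LHS]swedgeA YX swedgeNl swedgeA.
Qed.

(** Every extra term contains the dx-form or the dxi-form of [b0] twice, hence vanishes. *)
Lemma sq_shear b b0 (x : R) c :
  wedge (sq b0) (wedge (sq (b + x *: b0)) c) = wedge (sq b0) (wedge (sq b) c).
Proof.
rewrite /sq !swedgeA form10_lin form10_sharp_lin.
move: (form10_sqr b0) (form10_sharp_sqr b0) (form10_sharpC b0 b) (form10_sharpC b0 b0).
move: (form10 b0) (form10_sharp b0) (form10 b) (form10_sharp b).
move=> X0 Y0 X Y X0X0 Y0Y0 Y0X Y0X0.
have -> : wedge Y0 (wedge (X + x *: X0) (wedge (Y + x *: Y0) c)) =
    wedge Y0 (wedge X (wedge Y c)) + x *: wedge Y0 (wedge X0 (wedge (Y + x *: Y0) c)).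
  rewrite (swedgeDl X) (swedgeZl x X0) (swedgeDl Y) (swedgeZl x Y0) (swedgeDr X).
  by rewrite !(swedgeDr Y0) !(swedgeZr _ Y0) (swedgeZr x X) (swedgeZr x Y0)
    (Y0X (wedge Y0 c)) Y0Y0
    swedge0r oppr0 scaler0 addr0.
by rewrite (swedgeDr X0) (swedgeZr x X0) Y0X0 (swedgeNr X0) X0X0 oppr0 scaler0 addr0.
Qed.

(** A form of Gram-Schmidt: once a factor [b0] is not orthogonal to [b], shears by multiples of [b0]
    make all the others orthogonal without changing the product, and evenness of the squares lets
    [b0] be kept in front. *)
Lemma elem_orth b s : (forall b', b' \in s -> dotr b b' = 0) \/
  exists b0 s', [/\ size s = (size s').+1, elem s = elem (b0 :: s'),
    dotr b b0 != 0 & forall b', b' \in s' -> dotr b b' = 0].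
Proof.
elim: s => [|x s IH]; first by left.
case: IH => [H|[b0 [s' [ss es b0b H]]]].
  have [xb|xb] := eqVneq (dotr b x) 0; last by right; exists x, s.
  by left => b'; rewrite inE => /orP[/eqP->|/H].
right; exists b0, (x + (- (dotr b x / dotr b b0)) *: b0 :: s'); split => //=.
- by rewrite ss.
- rewrite sq_shear es /= -[LHS]swedgeA (swedge11C _ (@bidegree_sq x)) swedgeA. reflexivity.
- move=> b'; rewrite inE => /orP[/eqP->|/H//].
  have -> : forall t : R, dotr b (x + t *: b0) = dotr b x + t * dotr b b0.
    move=> t; rewrite /dotr mulr_sumr -big_split; apply: eq_bigr => j _.
    by rewrite !mxE mulrDr mulrCA.
  by rewrite mulNr divfK// subrr.
Qed.

(** Orthogonality in the coefficient inner product, not in the wedge pairing. It is the condition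
    that an orthogonal projection delivers, and for symmetric forms it implies weak nullity
    ([elem_null_weakly_null]). *)
Definition elem_null (q : nat) (a : form) :=
  forall s : seq 'rV[R]_n, size s = q -> inner a (elem s) = 0.

(** Moving both slots of [sq b] across the inner product contracts the elementary form twice by [b].
    After shearing, the result is 0 or a multiple of an elementary form with one factor fewer, to
    which the hypothesis applies. *)
Lemma elem_null_sq q a b : elem_null q a -> elem_null q.+1 (wedge (sq b) a).
Proof.
move=> aq s sq1; rewrite /sq swedgeA -gvec_xcov -gvec_xicov !inner_gvec.
have [/iotax_elem0[-> _]|[b0 [s' [ss -> _ /iotaxx_elem->]]]] := elem_orth b s.
  by rewrite (lin0E (lin_iotav _)) inner0r.
by rewrite innerZr aq ?mulr0//; move: ss; rewrite sq1 => -[].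
Qed.

Lemma elem_null_elem q a s : elem_null q a -> elem_null (q + size s) (wedge a (elem s)).
Proof.
elim: s => [|b s IH] in q a *; first by rewrite addn0 swedge1r.
move=> /(@elem_null_sq _ _ b)/IH; rewrite addSnnS.
by rewrite (swedge11C _ (@bidegree_sq b)) swedgeA.
Qed.

Lemma big_dxdxi (s : seq 'I_n) : uniq s -> exists e : R, e != 0 /\
  \big[@wedge R n/sform1 R n]_(j <- s) wedge (dx R j) (dxi R j) =
  e *: ebase R ([set j in s], [set j in s]).
Proof.
elim: s => [|j s IH]/=.
  move=> _; exists 1; split; first exact: oner_neq0.
  by rewrite big_nil scale1r sform1E; congr (ebase R (_, _)); apply/setP => i; rewrite !inE.
move=> /andP[js /IH[e [e0 E]]] {IH}.
rewrite big_cons E {E} swedgeA !swedgeZr -[dxi R j]/(gen (false, j)) -[dx R j]/(gen (true, j)).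
set u := ([set _ in s]%SET, _).
rewrite gen_ebase {1}/gin/= inE (negbTE js) swedgeZr gen_ebase {1}/gin/= inE (negbTE js).
exists (e * (gsgn (false, j) u * gsgn (true, j) (gadd (false, j) u))); split.
  by rewrite !mulf_neq0// signr_eq0.
by rewrite !scalerA /gadd/= !mulrA; congr (_ *: ebase R (_, _));
  apply/setP => i; rewrite !inE.
Qed.

Lemma volE : exists e : R, e != 0 /\ vol R n = e *: ebase R ([set: 'I_n]%SET, [set: 'I_n]%SET).
Proof.
have [e [e0 E]] := big_dxdxi (index_enum_uniq 'I_n); exists e; split => //.
by rewrite /vol -wedge_unlock E; congr (_ *: ebase R (_, _)); apply/setP => i; rewrite !inE mem_index_enum.
Qed.

Lemma form10_delta j : form10 (delta_mx 0 j) = dx R j :> form.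
Proof.
rewrite /form10 (bigD1 j)//= big1 ?addr0 ?mxE ?eqxx ?scale1r// => i ij.
by rewrite mxE eqxx (negbTE ij) scale0r.
Qed.

Lemma form10_sharp_delta j : form10_sharp (delta_mx 0 j) = dxi R j :> form.
Proof.
rewrite /form10_sharp (bigD1 j)//= big1 ?addr0 ?mxE ?eqxx ?scale1r// => i ij.
by rewrite mxE eqxx (negbTE ij) scale0r.
Qed.

Lemma elemE s : elem s = \big[@wedge R n/sform1 R n]_(b <- s) sq b.
Proof. by rewrite unlock; elim: s => //= b s ->. Qed.

Lemma elementaryE q (e : 'I_q -> 'rV[R]_n) :
  elementary e = elem [seq e i | i <- enum 'I_q].
Proof. by rewrite elemE big_map enumT /elementary -wedge_unlock. Qed.

Lemma elem_elementary s :
  elem s = elementary (fun i : 'I_(size s) => nth 0 s i).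
Proof. by rewrite elemE (big_nth 0) big_mkord /elementary -wedge_unlock. Qed.

Lemma elem_elementaryP q s : size s = q ->
  elem s = elementary (fun i : 'I_q => nth 0 s i).
Proof. by move=> <-; exact: elem_elementary. Qed.

(** The volume form is itself the elementary form of the standard basis, so orthogonality to it
    kills the full coefficient. *)
Lemma top_coef_null a : elem_null n a -> top_coef a = 0.
Proof.
move=> /(_ [seq delta_mx 0 j | j <- enum 'I_n]).
rewrite size_map size_enum_ord => /(_ erefl).
have -> : elem [seq delta_mx 0 j | j <- enum 'I_n] = vol R n.
  rewrite elemE big_map /vol enumT -wedge_unlock; apply: eq_bigr => j _.
  by rewrite /sq form10_delta form10_sharp_delta.
have [e [e0 vE]] := volE; rewrite vE innerZr innerC inner_ebase => /eqP.
by rewrite mulf_eq0 (negbTE e0) /top_coef => /eqP->; rewrite mul0r.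
Qed.

Lemma top_coef_null_elem q r a s : elem_null q a -> (q + r)%N = n -> size s = r ->
  top_coef (wedge a (elem s)) = 0.
Proof.
move=> aq qr sr; apply: top_coef_null => t st.
by have /(_ t) := @elem_null_elem _ _ s aq; rewrite st sr qr; apply.
Qed.

(* The algebra automorphism exchanging [dx_j] and [dxi_j]. *)
Definition swapx a : form := [ffun u : idx => (-1) ^+ (#|u.1| * #|u.2|) * a (u.2, u.1)].

Lemma lin_swapx : lin swapx.
Proof.
move=> x a c; apply/ffunP => u; rewrite !ffunE mulrDr; congr (_ + _).
by rewrite mulrCA.
Qed.

Lemma swapx_ebase u : swapx (ebase R u) = (-1) ^+ (#|u.1| * #|u.2|) *: ebase R (u.2, u.1).
Proof.
apply/ffunP => -[I K]; rewrite ffunE sformZE !ebaseE/=; case: u => [I' K']/=.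
rewrite !xpair_eqE andbC; have [->|] := eqVneq I K'; last by rewrite !mulr0.
by have [->|] := eqVneq K I'; rewrite ?mulr0// mulnC.
Qed.

Lemma swapx_swedge a c : swapx (wedge a c) = wedge (swapx a) (swapx c).
Proof.
suff: (fun a => swapx (wedge a c)) =1 (fun a => wedge (swapx a) (swapx c)) by apply.
apply: lin_ebase; [exact: (lin_comp lin_swapx (lin_swedgel _))|
  exact: (lin_comp (lin_swedgel _) lin_swapx)|move=> u].
suff: (fun c => swapx (wedge (ebase R u) c)) =1
  (fun c => wedge (swapx (ebase R u)) (swapx c)) by apply.
apply: lin_ebase; [exact: (lin_comp lin_swapx (lin_swedger _))|
  exact: (lin_comp (lin_swedger _) lin_swapx)|move=> v].
rewrite swedge_ebase (linZE _ _ lin_swapx) !swapx_ebase swedgeZl swedgeZr.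
rewrite swedge_ebase !scalerA {1}/joini/= -/(joini (u.2, u.1) (v.2, v.1)).
congr (_ *: _).
have [s0|/wedge_sign_neq0/andP[D1 D2]] := eqVneq (wedge_sign R u v) 0.
  rewrite s0 mul0r; move: s0; rewrite /wedge_sign/= => /eqP.
  rewrite -mulrA mulf_eq0 signr_eq0/= mulf_eq0 => /orP[]/eqP->.
    by rewrite !mulr0.
  by rewrite mulr0 mul0r mulr0.
rewrite /wedge_sign/= !cardsU_disjoint// mulnDl !mulnDr !exprD.
rewrite (mulnC #|v.1| #|u.2|).
set x := (-1) ^+ (#|u.2| * #|v.1|).
have x2 : x * x = 1 by rewrite -expr2 sqrr_sign.
set A := (-1) ^+ (#|u.1| * #|u.2|); set B := (-1) ^+ (#|v.1| * #|v.2|).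
set C := (-1) ^+ (#|u.1| * #|v.2|); set s1 := shuffle_sign _ _ _; set s2 := shuffle_sign _ _ _.
transitivity ((x * x) * (A * B * C * s1 * s2)); first by ring.
by rewrite x2; ring.
Qed.

Lemma swapx_dx j : swapx (dx R j) = dxi R j.
Proof.
by rewrite -[dx R j]/(ebase R ([set j], finset.set0)) swapx_ebase/= cards0 muln0 scale1r.
Qed.

Lemma swapx_dxi j : swapx (dxi R j) = dx R j.
Proof.
by rewrite -[dxi R j]/(ebase R (finset.set0, [set j])) swapx_ebase/= cards0 mul0n scale1r.
Qed.

Lemma swapx1 : swapx (sform1 R n) = sform1 R n.
Proof. by rewrite sform1E swapx_ebase/= cards0 mul0n scale1r. Qed.

Lemma swapx_form10 b : swapx (form10 b) = form10_sharp b.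
Proof.
rewrite [LHS](lin_sumE _ _ _ lin_swapx); apply: eq_bigr => j _.
by rewrite (linZE _ _ lin_swapx) swapx_dx.
Qed.

Lemma swapx_form10_sharp b : swapx (form10_sharp b) = form10 b.
Proof.
rewrite [LHS](lin_sumE _ _ _ lin_swapx); apply: eq_bigr => j _.
by rewrite (linZE _ _ lin_swapx) swapx_dxi.
Qed.

Lemma swapx_sq b : swapx (sq b) = - sq b.
Proof.
rewrite swapx_swedge swapx_form10 swapx_form10_sharp.
rewrite (swedge_sgnC (@bidegree_form10_sharp b) (@bidegree_form10 b)).
by rewrite expr1 scaleN1r.
Qed.

Lemma swapx_elem s : swapx (elem s) = (-1) ^+ size s *: elem s.
Proof.
elim: s => [|b s IH]; first by rewrite swapx1 scale1r.
by rewrite /= swapx_swedge IH swapx_sq swedgeNl swedgeZr exprS mulN1r scaleNr.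
Qed.

Lemma swapxK a : swapx (swapx a) = a.
Proof.
apply/ffunP => -[I K]; rewrite !ffunE/= mulrA (mulnC #|K|) -expr2 sqrr_sign.
by rewrite mul1r.
Qed.

Lemma bidegree_swapx q r a : bidegree q r a -> bidegree r q (swapx a).
Proof.
by move=> Ha I K; rewrite ffunE mulf_eq0 signr_eq0/= => /Ha[-> ->].
Qed.

Lemma sqr_sign (q : nat) : (-1) ^+ (q * q) = (-1) ^+ q :> R.
Proof. by rewrite -signr_odd oddM andbb signr_odd. Qed.

(** Symmetry of coefficients becomes an eigenvalue equation for an algebra automorphism, which makes
    its behaviour under wedge products immediate. The sign is (-1)^(q q) = (-1)^q, the cost of
    reordering dxi_I /\ dx_K. *)
Lemma symmetric_formP (q : nat) a : Defs.symmetric_form q a <->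
  bidegree q q a /\ swapx a = (-1) ^+ q *: a.
Proof.
split=> -[Ha H]; split => //.
  apply/ffunP => -[I K]; rewrite ffunE sformZE/= (H K I).
  have [->|/Ha[-> ->]] := eqVneq (a (I, K)) 0; first by rewrite !mulr0.
  by rewrite sqr_sign.
move=> I K.
have [/eqP aK|/Ha[cK cI]] := boolP (a (K, I) == 0).
  have [//|/Ha[cI cK]] := eqVneq (a (I, K)) 0; first by rewrite aK.
  move/ffunP/(_ (I, K)): H; rewrite ffunE sformZE/= aK mulr0 => /eqP.
  by rewrite eq_sym mulf_eq0 signr_eq0/= => /eqP->.
move/ffunP/(_ (I, K)): H; rewrite ffunE sformZE/= cI cK sqr_sign => /eqP.
by rewrite -subr_eq0 -mulrBr mulf_eq0 signr_eq0/= subr_eq0 => /eqP.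
Qed.

Lemma symmetric_elem q s : size s = q -> Defs.symmetric_form q (elem s).
Proof.
move=> sq'; apply/symmetric_formP; rewrite swapx_elem sq'; split => //.
by rewrite -sq'; exact: bidegree_elem.
Qed.

Lemma symmetric_sq q a b : Defs.symmetric_form q a -> Defs.symmetric_form q.+1 (wedge (sq b) a).
Proof.
move=> /symmetric_formP[Ha H]; apply/symmetric_formP; split.
  exact: (bidegree_swedge (@bidegree_sq b) Ha).
by rewrite swapx_swedge H swapx_sq swedgeNl swedgeZr exprS mulN1r scaleNr.
Qed.

Lemma symmetricD q a c : Defs.symmetric_form q a -> Defs.symmetric_form q c -> Defs.symmetric_form q (a + c).
Proof.
by move=> [Ha sa] [Hc sc]; split=> [|I K]; [exact: bidegreeD|rewrite !ffunE sa sc].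
Qed.

Lemma symmetricZ q x a : Defs.symmetric_form q a -> Defs.symmetric_form q (x *: a).
Proof.
by move=> [Ha sa]; split=> [|I K]; [exact: bidegreeZ|rewrite !sformZE sa].
Qed.

Lemma symmetric_sum q (I : Type) (r : seq I) (P : pred I) (F : I -> form) :
  (forall i, P i -> Defs.symmetric_form q (F i)) -> Defs.symmetric_form q (\sum_(i <- r | P i) F i).
Proof.
move=> H; apply: big_ind => //; last exact: symmetricD.
by split=> [|J K]; [exact: bidegree0|rewrite !ffunE].
Qed.

Lemma top_coefD a c : top_coef (a + c) = top_coef a + top_coef c.
Proof. by rewrite /top_coef ffunE mulrDl. Qed.

Lemma top_coefZ x a : top_coef (x *: a) = x * top_coef a.
Proof. by rewrite /top_coef sformZE mulrA. Qed.

Lemma weakly_nullP q a : weakly_null q a <-> Defs.symmetric_form q a /\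
  forall r s, (q + r)%N = n -> size s = r -> top_coef (wedge a (elem s)) = 0.
Proof.
rewrite /weakly_null /weakly_positive -wedge_unlock; split=> [[[sa pa] [_ na]]|[sa H]].
  split => // r s qr sr; have := na r qr (fun i => nth 0 s i).
  have := pa r qr (fun i => nth 0 s i); rewrite -elem_elementaryP//.
  rewrite swedgeNl -scaleN1r top_coefZ mulN1r oppr_ge0 => p0 n0.
  by apply/eqP; rewrite eq_le p0 n0.
split; split => //.
- by move=> r qr e; rewrite elementaryE (H r)// size_map size_enum_ord.
- by rewrite -scaleN1r; exact: symmetricZ.
- move=> r qr e; rewrite elementaryE swedgeNl -scaleN1r top_coefZ (H r) ?mulr0//.
  by rewrite size_map size_enum_ord.
Qed.

Lemma elem_null_weakly_null q a : Defs.symmetric_form q a -> elem_null q a -> weakly_null q a.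
Proof.
by move=> sa na; apply/weakly_nullP; split => // r s qr; exact: (top_coef_null_elem na).
Qed.

(** [sq b] is central, so it can be carried over to the elementary factor, where it is one more
    square. *)
Lemma weakly_null_sq q a b : weakly_null q a -> weakly_null q.+1 (wedge (sq b) a).
Proof.
move=> /weakly_nullP[sa H]; apply/weakly_nullP; split; first exact: symmetric_sq.
move=> r s qr sr; rewrite (swedge11C _ (@bidegree_sq b)) swedgeA.
by rewrite (H r.+1 (b :: s))//= ?sr// -addSnnS.
Qed.

Lemma weakly_nullD q a c : weakly_null q a -> weakly_null q c -> weakly_null q (a + c).
Proof.
move=> /weakly_nullP[sa Ha] /weakly_nullP[sc Hc]; apply/weakly_nullP.
split=> [|r s qr sr]; first exact: symmetricD.
by rewrite swedgeDl top_coefD (Ha r)// (Hc r)// addr0.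
Qed.

Lemma weakly_null0 q : weakly_null q (0 : form).
Proof.
apply/weakly_nullP; split=> [|r s qr sr]; last first.
  by rewrite swedge0l /top_coef ffunE mul0r.
by split=> [|J K]; [exact: bidegree0|rewrite !ffunE].
Qed.

Lemma sp_elem q s : size s = q -> strongly_positive q (elem s).
Proof.
move=> sq'; exists 1%N, (fun=> 1), (fun _ i => nth 0 s i); split=> [_|]; first exact: ler01.
rewrite big_ord1 scale1r; exact: elem_elementaryP.
Qed.

Lemma sp0 q : strongly_positive q (0 : form).
Proof.
exists 0%N, (fun=> 0), (fun _ _ => 0); split=> [i|]; first exact: lexx.
by rewrite big_ord0.
Qed.

Lemma spD q a c : strongly_positive q a -> strongly_positive q c ->
  strongly_positive q (a + c).
Proof.
move=> [m [x [e [x0 ->]]]] [m' [x' [e' [x0' ->]]]].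
exists (m + m')%N, (fun i => match fintype.split i with inl j => x j | inr j => x' j end),
  (fun i => match fintype.split i with inl j => e j | inr j => e' j end); split.
  by move=> i; case: fintype.split.
rewrite big_split_ord/=; congr (_ + _); apply: eq_bigr => i _.
  by rewrite (unsplitK (inl i)).
by rewrite (unsplitK (inr i)).
Qed.

Lemma spZ q (x : R) a : 0 <= x -> strongly_positive q a -> strongly_positive q (x *: a).
Proof.
move=> x0 [m [y [e [y0 ->]]]]; exists m, (fun i => x * y i), e; split=> [i|].
  exact: mulr_ge0.
by rewrite scaler_sumr; apply: eq_bigr => i _; rewrite scalerA.
Qed.

Lemma sp_sum q (I : Type) (r : seq I) (P : pred I) (F : I -> form) :
  (forall i, P i -> strongly_positive q (F i)) ->
  strongly_positive q (\sum_(i <- r | P i) F i).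
Proof. by move=> H; apply: big_ind => //; [exact: sp0|exact: spD]. Qed.

Lemma sp_sq q a b : strongly_positive q a -> strongly_positive q.+1 (wedge (sq b) a).
Proof.
move=> [m [y [e [y0 ->]]]]; rewrite swedge_sumr; apply: sp_sum => i _.
rewrite swedgeZr; apply: spZ => //; rewrite elementaryE.
by apply: (@sp_elem _ (b :: _)); rewrite /= size_map size_enum_ord.
Qed.

End Contraction.

(** * Positive semidefinite matrices and the span of elementary forms *)

Section PSD.
Variables (R : realType) (n : nat).
Implicit Types (H : 'M[R]_n) (u v w : 'rV[R]_n).

Definition bform H u v : R := (u *m H *m v^T) 0 0.

Lemma bformDl H u u' v : bform H (u + u') v = bform H u v + bform H u' v.
Proof. by rewrite /bform !mulmxDl mxE. Qed.

Lemma bformZl H x u v : bform H (x *: u) v = x * bform H u v.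
Proof. by rewrite /bform -!scalemxAl mxE. Qed.

Lemma bformC H u v : H^T = H -> bform H u v = bform H v u.
Proof.
move=> sH; rewrite /bform -[in RHS]sH -[in RHS](trmxK v) -!trmx_mul mulmxA.
by rewrite [RHS]mxE.
Qed.

Lemma bform_delta H i j : bform H (delta_mx 0 i) (delta_mx 0 j) = H i j.
Proof. by rewrite /bform -rowE trmx_delta -colE !mxE. Qed.

Lemma bformE H u v : bform H u v = \sum_i \sum_j H i j * u 0 i * v 0 j.
Proof.
rewrite /bform mxE exchange_big/=; apply: eq_bigr => j _; rewrite !mxE mulr_suml.
by apply: eq_bigr => i _; rewrite (mulrC (u 0 i)).
Qed.

Definition psd H := H^T = H /\ forall v, 0 <= bform H v v.

Lemma bform_shift H u v x : psd H ->
  bform H (v + x *: u) (v + x *: u) = bform H v v + 2 * x * bform H u v + x ^+ 2 * bform H u u.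
Proof.
move=> [sH _]; rewrite bformDl bformZl !(bformC _ (v + _))// !bformDl !bformZl.
by rewrite (bformC v u sH); ring.
Qed.

Lemma psd_diag0 H i j : psd H -> H i i = 0 -> H i j = 0.
Proof.
move=> pH Hi; apply/eqP/negPn/negP => Hij.
(* As [H i i = 0], the quadratic form at e_j + x e_i is affine in x, namely H_jj + 2 x H_ij; this x
   gives it the value -1. *)
have := pH.2 (delta_mx 0 j + (- (H j j + 1) / (2 * H i j)) *: delta_mx 0 i).
rewrite bform_shift// !bform_delta Hi mulr0 addr0.
have -> : 2 * (- (H j j + 1) / (2 * H i j)) * H i j = - (H j j + 1) by field.
by rewrite opprD addrA subrr add0r oppr_ge0 ler10.
Qed.

(** The Schur complement: its value at [v] is that of [H] at [v + t e_i], where [t] minimizes along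
    this line. *)
Lemma psd_pivot H i : psd H -> H i i != 0 ->
  psd (H - (H i i)^-1 *: ((row i H)^T *m row i H)).
Proof.
move=> pH Hi; have [sH H0] := pH; split.
  by rewrite linearB/= sH linearZ/= trmx_mul trmxK.
move=> v; set t := - (bform H (delta_mx 0 i) v / H i i).
have -> : bform (H - (H i i)^-1 *: ((row i H)^T *m row i H)) v v =
    bform H (v + t *: delta_mx 0 i) (v + t *: delta_mx 0 i).
  rewrite bform_shift// bform_delta.
  set B := bform H (delta_mx 0 i) v.
  have BE : (row i H *m v^T) 0 0 = B by rewrite /B /bform -rowE.
  have BE' : (v *m (row i H)^T) 0 0 = B.
    by rewrite -BE -[in RHS](trmxK (row i H)) -trmx_mul [RHS]mxE.
  have E : (v *m ((row i H)^T *m row i H) *m v^T) 0 0 = B * B.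
    by rewrite mulmxA -mulmxA mxE big_ord1 BE BE'.
  rewrite {1}/bform mulmxBr mulmxBl -scalemxAr -scalemxAl mxE -/(bform H v v).
  by rewrite mxE [in X in _ + X]mxE E /t -/B; field.
exact: H0.
Qed.

(** Symmetric Gaussian elimination, by induction on the number of nonzero diagonal entries. A pivot
    clears entry i; a zero diagonal entry forces its whole row to vanish, so no cleared entry comes
    back. *)
Lemma psd_sum_sqr H : psd H ->
  exists s : seq 'rV[R]_n, forall i j, H i j = \sum_(a <- s) a 0 i * a 0 j.
Proof.
have [m] := ubnP #|[set i | H i i != 0]%SET|; elim: m H => // m IH H Hm pH.
have [/existsP[i Hi]|] := boolP [exists i, H i i != 0]; last first.
  rewrite negb_exists => /forallP H0; exists [::] => i j; rewrite big_nil.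
  by apply: psd_diag0 => //; apply/eqP/negPn/H0.
have Hi0 : 0 < H i i.
  by rewrite lt_neqAle eq_sym Hi/= -bform_delta; apply: pH.2.
have := psd_pivot pH Hi; set H' := H - _ => pH'.
have H'E j k : H' j k = H j k - (H i i)^-1 * (H i j * H i k).
  by rewrite /H' !mxE big_ord1 !mxE.
have /IH/(_ pH')[s sE] : (#|[set j | H' j j != 0%R]%SET| < m)%N.
  rewrite -ltnS; apply: leq_trans Hm; rewrite ltnS; apply: proper_card.
  apply/properP; split; last first.
    by exists i; rewrite inE// H'E mulKf// subrr eqxx.
  apply/fintype.subsetP => j; rewrite !inE; apply: contraNN => /eqP Hj.
  rewrite H'E Hj; have -> : H i j = 0.
    by rewrite -pH.1 mxE; exact: psd_diag0.
  by rewrite mul0r mulr0 subrr.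
exists ((Num.sqrt (H i i))^-1 *: row i H :: s) => j k; rewrite big_cons -sE H'E.
rewrite !mxE mulrACA -invfM -expr2 sqr_sqrtr ?ltW//; ring.
Qed.

End PSD.

(** * Finite spanning families of elementary forms and orthogonal projection *)

Section Spanning.
Variables (R : realType) (n : nat).
Notation form := (sform R n).
Implicit Types (a c : form).

Lemma innerBl a a' c : inner (a - a') c = inner a c - inner a' c.
Proof. by rewrite innerDl -scaleN1r innerZl mulN1r. Qed.

(** Among finite families of elementary forms, one whose span has maximal dimension is chosen;
    adjoining any further elementary form cannot enlarge the span. *)
Lemma elem_span q : exists t : seq (seq 'rV[R]_n), (forall s, s \in t -> size s = q) /\
  forall s, size s = q -> (elem s \in <<[seq elem s | s <- t]>>)%VS.
Proof.
pose P d := `[< exists t : seq (seq 'rV[R]_n), (forall s, s \in t -> size s = q) /\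
  \dim <<[seq elem s | s <- t]>>%VS = d >].
have P0 : exists d, P d.
  by exists (\dim <<[seq elem s | s <- [::] : seq (seq 'rV[R]_n)]>>%VS); apply/asboolP; exists [::].
have Pub d : P d -> (d <= \dim {:form})%N.
  by move=> /asboolP[t [_ <-]]; exact/dimvS/subvf.
case: (ex_maxnP P0 Pub) => d /asboolP[t [tq td]] dmax.
exists t; split => // s sq'.
have /dmax : P (\dim <<[seq elem s | s <- s :: t]>>%VS).
  apply/asboolP; exists (s :: t); split => // s'.
  by rewrite inE => /orP[/eqP->|/tq].
rewrite -td /= span_cons => dle.
have sub : (<<[seq elem s | s <- t]>> <= <[elem s]> + <<[seq elem s | s <- t]>>)%VS.
  exact: addvSr.
have := dimv_leqif_eq sub; rewrite /= => -[_ E].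
have : (<<[seq elem s | s <- t]>> == <[elem s]> + <<[seq elem s | s <- t]>>)%VS.
  by rewrite -E eqn_leq dle dimvS.
by move=> /eqP->; apply: (subvP (addvSl _ _)); exact: memv_line.
Qed.

Lemma orth_proj (t : seq form) a : exists c : 'I_(size t) -> R,
  forall x, x \in t -> inner (a - \sum_i c i *: t`_i) x = 0.
Proof.
elim: t => [|y t IH] in a *; first by exists (fun=> 0).
have [cy Hy] := IH y; have [ca Ha] := IH a.
set y' := y - _ in Hy; set a' := a - _ in Ha.
(* If [y] lies in the span of [t], then [y'] is 0 and so is the quotient; linearly dependent
   families are thus covered. *)
pose x := inner a' y' / inner y' y'.
exists (fun i => if unlift ord0 i is Some j then ca j - x * cy j else x).
rewrite big_ord_recl unlift_none /=.
have -> : a - (x *: y + \sum_(i < size t) (if unlift ord0 (lift ord0 i) is Some j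
    then ca j - x * cy j else x) *: t`_i) = a' - x *: y'.
  under eq_bigr do rewrite liftK scalerBl -scalerA.
  rewrite sumrB -scaler_sumr /a' /y' scalerBr !opprD !opprK !addrA.
  by rewrite [a - _ - _]addrAC.
have Hz z : z \in t -> inner (a' - x *: y') z = 0.
  by move=> zt; rewrite innerBl innerZl Ha// Hy// mulr0 subrr.
move=> z; rewrite inE => /orP[/eqP->|/Hz//].
have -> : inner (a' - x *: y') y = inner (a' - x *: y') y'.
  rewrite [RHS]innerC [in RHS]/y'; set X := a' - _ in Hz *.
  rewrite [RHS]innerBl inner_suml big1 ?subr0 1?innerC// => i _.
  by rewrite innerZl innerC Hz ?mulr0// mem_nth.
rewrite innerBl innerZl /x; have [/[dup] y0 /inner_eq0 y'0|y0] := eqVneq (inner y' y') 0.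
  by rewrite y0 mulr0 y'0 inner0r subrr.
by rewrite divfK// subrr.
Qed.

(* Every form splits into a combination of finitely many fixed elementary forms
   and a form orthogonal to all elementary ones. *)
Lemma elem_decomposition q : exists (m : nat) (E : 'I_m -> seq 'rV[R]_n)
    (l : 'I_m -> {set 'I_n} * {set 'I_n} -> R),
  (forall i, size (E i) = q) /\ forall a : form,
    elem_null q (a - \sum_i (\sum_u a u * l i u) *: elem (E i)).
Proof.
have [t [tq tspan]] := elem_span q.
pose T := [seq elem s | s <- t].
have sT : size T = size t by rewrite size_map.
have /choice[l Hl] := fun u => orth_proj T (ebase R u).
have EE (i : 'I_(size T)) : T`_i = elem (nth [::] t i).
  by rewrite (nth_map [::]) // -sT.
exists (size T), (fun i => nth [::] t i), (fun i u => l u i); split.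
  by move=> i; apply: tq; rewrite mem_nth// -sT.
move=> a s /tspan sT'; rewrite (@coord_span _ _ _ (in_tuple T) (elem s) sT').
rewrite inner_sumr big1// => k _; rewrite innerZr.
rewrite [X in inner (X - _) _](sform_basis a).
have -> : \sum_(i < size T) (\sum_u a u * l u i) *: elem (nth [::] t i) =
    \sum_u a u *: \sum_(i < size T) l u i *: T`_i.
  under eq_bigr do rewrite scaler_suml.
  rewrite exchange_big/=; apply: eq_bigr => u _; rewrite scaler_sumr.
  by apply: eq_bigr => i _; rewrite scalerA EE.
rewrite -sumrB inner_suml big1 ?mulr0// => u _.
rewrite -scalerBr innerZl Hl ?mulr0// (_ : (in_tuple T)`_k = T`_k)//.
exact: mem_nth.
Qed.

End Spanning.

Local Open Scope classical_set_scope.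

(** * Partial derivatives *)

Section LineDerivative.
Variables (R : realType) (V : normedModType R).
Implicit Types (f : V -> R) (x v : V).

Lemma is_derive_line f x v (t : R) : derivable f (x + t *: v) v ->
  is_derive t (1 : R) (fun s : R => f (x + s *: v)) ('D_v f (x + t *: v)).
Proof.
set y := x + t *: v => df.
have E : (fun h : R => h^-1 *: (((fun s : R => f (x + s *: v)) \o shift t) (h *: (1 : R)) -
    f (x + t *: v))) = (fun h => h^-1 *: ((f \o shift y) (h *: v) - f y)).
  apply/funext => h /=; congr (_ *: (f _ - _)).
  by rewrite /y [h *: 1]mulr1 scalerDl addrCA.
by apply: DeriveDef; [rewrite /derivable E|rewrite /derive E].
Qed.

Lemma is_derive_of_line f x v df :
  is_derive (0 : R) (1 : R) (fun s : R => f (x + s *: v)) df -> is_derive x v f df.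
Proof.
move=> [df1 df2].
have E : (fun h : R => h^-1 *: (((fun s : R => f (x + s *: v)) \o shift 0) (h *: (1 : R)) -
    f (x + 0 *: v))) = (fun h => h^-1 *: ((f \o shift x) (h *: v) - f x)).
  apply/funext => h /=; rewrite scale0r !addr0; congr (_ *: (f _ - _)).
  by rewrite [h *: 1]mulr1 addrC.
by apply: DeriveDef; [rewrite /derivable -E|rewrite /derive -E].
Qed.

Lemma is_derive_comp1 (h : R -> R) f x v dh df :
  is_derive x v f df -> is_derive (f x) (1 : R) h dh ->
  is_derive x v (h \o f) (dh * df).
Proof.
move=> [df1 df2] dh1; apply: is_derive_of_line.
have -> : (fun s : R => (h \o f) (x + s *: v)) = h \o (fun s : R => f (x + s *: v)) by [].
have xE : x + 0 *: v = x by rewrite scale0r addr0.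
apply: is_derive1_comp; first by rewrite xE.
by have := @is_derive_line f x v 0; rewrite xE df2; apply.
Qed.

Lemma MVT_line f v : (forall y, derivable f y v) -> forall x (t : R),
  exists2 s : R, `|s| <= `|t| & f (x + t *: v) - f x = t * 'D_v f (x + s *: v).
Proof.
move=> df x t; have dg s := is_derive_line (df (x + s *: v)).
have cg : continuous (fun s : R => f (x + s *: v)).
  move=> s; apply: differentiable_continuous; apply/derivable1_diffP.
  exact: ex_derive.
have [t0|t0] := leP 0 t.
  have [c] := MVT_segment t0 (fun s _ => dg s) (continuous_subspaceT cg).
  rewrite in_itv/= scale0r addr0 subr0 => /andP[c0 ct] ->; exists c; last by rewrite mulrC.
  by rewrite !ger0_norm.
have [c] := MVT_segment (ltW t0) (fun s _ => dg s) (continuous_subspaceT cg).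
rewrite in_itv/= scale0r addr0 sub0r => /andP[c0 ct] E; exists c.
  by rewrite !ler0_norm ?lerN2// ltW.
by rewrite -opprB E mulrN opprK mulrC.
Qed.

End LineDerivative.

Section Partial.
Variables (R : realType) (n : nat).
Notation V := 'rV[R]_n.
Implicit Types (f g : V -> R) (x v : V).

Lemma norm_coord_le x j : `|x 0 j| <= `|x|.
Proof.
rewrite [leRHS]/Num.norm /= mx_normrE; apply/bigmax_geP; right => /=.
by exists (0, j).
Qed.

Lemma norm_row_le x (e : R) : 0 <= e -> (forall j, `|x 0 j| <= e) -> `|x| <= e.
Proof.
move=> e0 H; rewrite [leLHS]/Num.norm /= mx_normrE; apply/bigmax_leP; split=> // -[i j] _ /=.
by rewrite (ord1 i).
Qed.

Lemma norm_delta_le j : `|delta_mx 0 j : V| <= 1.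
Proof.
apply: norm_row_le => // i; rewrite mxE eqxx/=; case: eqP => _; rewrite ?normr1//.
by rewrite normr0.
Qed.

(** The point x + w is reached along the coordinate axes, one at a time: [u m] keeps the first m
    coordinates of [w]. The mean value theorem applies on each leg and the increments telescope. *)
Lemma mean_value_partial f : (forall j y, derivable f y (delta_mx 0 j)) ->
  forall x w, exists xi : 'I_n -> V, (forall j, `|xi j| <= `|w|) /\
    f (x + w) - f x = \sum_j w 0 j * partial j f (x + xi j).
Proof.
move=> df x w.
pose u (m : nat) : V := \row_j (if (j < m)%N then w 0 j else 0).
have u0 : u 0%N = 0 by apply/rowP => j; rewrite !mxE.
have un : u n = w by apply/rowP => j; rewrite !mxE ltn_ord.
have uS (j : 'I_n) : u j.+1 = u j + w 0 j *: delta_mx 0 j.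
  apply/rowP => i; rewrite !mxE ltnS leq_eqVlt eqxx/=.
  have [->|ij] := eqVneq i j; first by rewrite eqxx ltnn mulr1 add0r.
  by rewrite -val_eqE in ij; rewrite (negbTE ij) mulr0 addr0.
have step (j : 'I_n) : exists xi : V, `|xi| <= `|w| /\
    f (x + u j.+1) - f (x + u j) = w 0 j * partial j f (x + xi).
  have [s sw E] := MVT_line (df j) (x + u j) (w 0 j).
  exists (u j + s *: delta_mx 0 j); split; last by rewrite uS addrA E addrA.
  apply: norm_row_le => // i; rewrite !mxE eqxx/=.
  have [->|ij] := eqVneq i j.
    by rewrite ltnn add0r mulr1 (le_trans sw)// norm_coord_le.
  rewrite mulr0 addr0; case: ifP => _; last by rewrite normr0.
  exact: norm_coord_le.
have [xi Hxi] := choice step.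
exists xi; split; first by move=> j; have [] := Hxi j.
have -> : f (x + w) - f x = f (x + u n) - f (x + u 0%N) by rewrite un u0 addr0.
rewrite -(telescope_sumr (fun m => f (x + u m)) (leq0n n)) big_mkord.
by apply: eq_bigr => j _; have [] := Hxi j.
Qed.

(** The mean value points for the increment h v tend to x with h, where the partials are
    continuous. *)
Lemma is_derive_partial f x v : (forall j y, derivable f y (delta_mx 0 j)) ->
  (forall j, {for x, continuous (partial j f)}) ->
  is_derive x v f (\sum_j v 0 j * partial j f x).
Proof.
move=> df cf.
suff H : (fun h => h^-1 *: ((f \o shift x) (h *: v) - f x)) @ 0^' -->
    \sum_j v 0 j * partial j f x.
  by apply: DeriveDef; [apply/cvg_ex; eexists; exact: H|exact: cvg_lim H].
apply/cvgrPdist_le => e e0.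
pose M := \sum_j `|v 0 j| + 1; have M0 : 0 < M by rewrite ltr_wpDl// sumr_ge0.
have : \forall y \near x, forall j, `|partial j f x - partial j f y| <= e / M.
  apply: (@filter_forall _ _ (fun j y => `|partial j f x - partial j f y| <= e / M)
    (nbhs x)) => j.
  by have /cvgrPdist_le := cf j; apply; exact: divr_gt0.
move=> /nbhs_normP[d /= d0 Hd].
near=> h; rewrite /= [h *: v + x]addrC.
have [xi [xih ->]] := mean_value_partial df x (h *: v).
have h0 : h != 0 by near: h; exact: nbhs_dnbhs_neq.
have -> : h^-1 *: (\sum_j (h *: v) 0 j * partial j f (x + xi j)) =
    \sum_j v 0 j * partial j f (x + xi j).
  rewrite scaler_sumr; apply: eq_bigr => j _; rewrite mxE -mulrA.
  by rewrite [_ *: _]mulrA mulVf// mul1r.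
rewrite -sumrB; apply: (le_trans (ler_norm_sum _ _ _)).
apply: (@le_trans _ _ (\sum_j `|v 0 j| * (e / M))).
  apply: ler_sum => j _; rewrite -mulrBr normrM ler_wpM2l//.
  apply: Hd => /=; rewrite opprD addNKr normrN; apply: le_lt_trans (xih j) _.
  rewrite normrZ; near: h.
  have dv : 0 < d / (`|v| + 1) by rewrite divr_gt0// ltr_wpDl.
  apply: nbhs_dnbhs; apply/nbhs_normP; exists (d / (`|v| + 1)) => //= h.
  rewrite /ball_/= sub0r normrN ltr_pdivlMr ?ltr_wpDl// => /(le_lt_trans _); apply.
  by rewrite ler_wpM2l// lerDl.
rewrite -mulr_suml mulrCA ger_pMr// ler_pdivrMr// mul1r /M lerDl//.
Unshelve. all: by end_near. Qed.

(** The second difference [D u v s] is symmetric in its two directions, and two mean value steps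
    write it as s^2 times a mixed partial at a point within 2 |s| of x. Equating the two orders and
    letting s shrink compares the mixed partials at x. *)
Lemma partial_sym f j k : (forall i y, derivable f y (delta_mx 0 i)) ->
  (forall i l y, derivable (partial i f) y (delta_mx 0 l)) ->
  (forall i l, continuous (partial l (partial i f))) ->
  partial j (partial k f) = partial k (partial j f).
Proof.
move=> d1 d2 c2; apply/funext => x.
have quarter (m : R) : 0 < m -> m / 4 + m / 4 < m by lra.
pose D (u v : 'I_n) s : R := f (x + s *: delta_mx 0 u + s *: delta_mx 0 v) -
  f (x + s *: delta_mx 0 u) - (f (x + s *: delta_mx 0 v) - f x).
have Dsym (u v : 'I_n) s : D u v s = D v u s.
  by rewrite /D (addrAC x (s *: delta_mx 0 u)); ring.
have H (u v : 'I_n) s : exists2 w : V, `|w| <= `|s| + `|s| &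
    D u v s = s * (s * partial v (partial u f) (x + w)).
  pose F := fun y => f (y + s *: delta_mx 0 v) - f y.
  have dF y : is_derive y (delta_mx 0 u) F
      (partial u f (y + s *: delta_mx 0 v) - partial u f y).
    apply: is_deriveB; last exact/derivableP.
    apply: is_derive_of_line.
    have -> : (fun t : R => f (y + t *: delta_mx 0 u + s *: delta_mx 0 v)) =
        (fun t : R => f ((y + s *: delta_mx 0 v) + t *: delta_mx 0 u)).
      by apply/funext => t; rewrite addrAC.
    have := @is_derive_line _ _ f (y + s *: delta_mx 0 v) (delta_mx 0 u) 0.
    by rewrite scale0r addr0; apply.
  have [a as' E] := MVT_line (fun y => @ex_derive _ _ _ _ _ _ _ (dF y)) x s.
  have [b bs E'] := MVT_line (d2 u v) (x + a *: delta_mx 0 u) s.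
  exists (a *: delta_mx 0 u + b *: delta_mx 0 v).
    apply: (le_trans (ler_normD _ _)); rewrite !normrZ; apply: lerD.
      by rewrite (le_trans _ as')// ler_piMr// norm_delta_le.
    by rewrite (le_trans _ bs)// ler_piMr// norm_delta_le.
  have -> : D u v s = F (x + s *: delta_mx 0 u) - F x by rewrite /D /F; ring.
  by rewrite E (@derive_val _ _ _ _ _ _ _ (dF _)) E' addrA.
apply/eqP; rewrite -subr_eq0 -normr_le0; apply/ler_addgt0Pl => e e0; rewrite addr0.
have e2 : 0 < e / 2 by rewrite divr_gt0.
have /cvgrPdist_le/(_ _ e2)/nbhs_normP[d1' /= d10 H1] := c2 k j x.
have /cvgrPdist_le/(_ _ e2)/nbhs_normP[d2' /= d20 H2] := c2 j k x.
(* Both mean value points lie within 2 |s| of [x]; a quarter of the smaller radius keeps them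
   strictly inside both neighbourhoods. *)
pose s := Num.min d1' d2' / 4.
have s0 : 0 < s by rewrite divr_gt0// lt_min d10.
have [w1 w1s E1] := H k j s; have [w2 w2s E2] := H j k s.
have : partial j (partial k f) (x + w1) = partial k (partial j f) (x + w2).
  have sn : s != 0 by rewrite gt_eqF.
  by move: E1; rewrite Dsym E2 => E12; exact: esym (mulfI sn (mulfI sn E12)).
have ws (w : V) : `|w| <= `|s| + `|s| -> `|w| < d1' /\ `|w| < d2'.
  rewrite gtr0_norm// => ww.
  have : `|w| < Num.min d1' d2'.
    apply: le_lt_trans ww _; rewrite /s; have : 0 < Num.min d1' d2' by rewrite lt_min d10.
    exact: quarter.
  by rewrite lt_min => /andP[].
have {}H1 := H1 (x + w1); have {}H2 := H2 (x + w2).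
rewrite /= opprD addNKr normrN in H1; rewrite /= opprD addNKr normrN in H2.
move=> E; rewrite (splitr e).
have := lerD (H1 (ws _ w1s).1) (H2 (ws _ w2s).2); rewrite -E => /(le_trans _); apply.
rewrite [X in _ <= _ + X]distrC; apply: le_trans (ler_normD _ _).
by rewrite addrA subrK.
Qed.

End Partial.

(** * Smooth functions *)

Section Smooth.
Variables (R : realType) (n : nat).
Notation V := 'rV[R]_n.
Implicit Types (f g : V -> R) (x v : V) (k : nat).

Lemma contD f g : continuous f -> continuous g -> continuous (fun x => f x + g x).
Proof. by move=> cf cg x; apply: continuousD; [exact: cf|exact: cg]. Qed.

Lemma contM f g : continuous f -> continuous g -> continuous (fun x => f x * g x).
Proof. by move=> cf cg x; apply: continuousM; [exact: cf|exact: cg]. Qed.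

Lemma contV f : (forall x, f x != 0) -> continuous f -> continuous (fun x => (f x)^-1).
Proof. by move=> f0 cf x; apply: continuousV; [exact: f0|exact: cf]. Qed.

Lemma cont_comp (h : R -> R) f : continuous f -> (forall x, derivable h (f x) 1) ->
  continuous (fun x => h (f x)).
Proof.
move=> cf ch x; apply: continuous_comp; first exact: cf.
by apply: differentiable_continuous; apply/derivable1_diffP.
Qed.

(** Iterated partials of a product are unwieldy. The order-by-order version admits induction on [k],
    since the derivative of a product or a composite is built from functions of order [k] again. *)
Fixpoint Ck k f : Prop := continuous f /\
  if k is k'.+1 then forall j, (forall x, derivable f x (delta_mx 0 j)) /\ Ck k' (partial j f)
  else True.

Lemma Ck_cont k f : Ck k f -> continuous f.
Proof. by case: k => [|k] []. Qed.

Lemma CkW k f : Ck k.+1 f -> Ck k f.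
Proof.
elim: k f => [|k IH] f; first by case.
by move=> [cf H]; split=> // j; have [dj /IH] := H j.
Qed.

Lemma smooth_cont f : smooth f -> continuous f.
Proof. by move=> /(_ [::])[]. Qed.

Lemma smooth_derivable f j x : smooth f -> derivable f x (delta_mx 0 j).
Proof. by move=> /(_ [::])[_]; apply. Qed.

Lemma smooth_partial f j : smooth f -> smooth (partial j f).
Proof. by move=> sf s; have := sf (rcons s j); rewrite foldr_rcons. Qed.

Lemma smoothP f : smooth f <-> forall k, Ck k f.
Proof.
split=> [sf k|Cf].
  elim: k => [|k IH] in f sf *; first by split=> //; exact: smooth_cont.
  split=> [|j]; first exact: smooth_cont.
  by split=> [x|]; [exact: smooth_derivable|apply: IH; exact: smooth_partial].
move=> s; elim/last_ind: s f Cf => [|s j IH] f Cf.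
  by split=> [|j x]; [exact: Ck_cont (Cf 0%N)|have [_ /(_ j)[]] := Cf 1%N].
rewrite foldr_rcons; apply: IH => k.
by have [_ /(_ j)[]] := Cf k.+1.
Qed.

Lemma partialE f j (df : V -> R) : (forall x, is_derive x (delta_mx 0 j) f (df x)) ->
  partial j f = df.
Proof. by move=> H; apply/funext => x; exact: derive_val. Qed.

Lemma CkS k f (df : 'I_n -> V -> R) : continuous f ->
  (forall j x, is_derive x (delta_mx 0 j) f (df j x)) -> (forall j, Ck k (df j)) -> Ck k.+1 f.
Proof.
by move=> cf H Hd; split=> // j; rewrite (partialE (H j)); split.
Qed.

Lemma Ck_is_derive k f j x : Ck k.+1 f -> is_derive x (delta_mx 0 j) f (partial j f x).
Proof. by move=> [_ /(_ j)[df _]]; exact/derivableP. Qed.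

Lemma Ck_partial k f j : Ck k.+1 f -> Ck k (partial j f).
Proof. by move=> [_ /(_ j)[]]. Qed.

Lemma Ck_cst k (c : R) : Ck k (fun=> c).
Proof.
have cc (d : R) : continuous (fun _ : V => d) by exact: cst_continuous.
elim: k c => [|k IH] c; first by split.
by apply: (@CkS _ _ (fun _ _ => 0)) => // j x; exact: is_derive_cst.
Qed.

Lemma CkD k f g : Ck k f -> Ck k g -> Ck k (fun x => f x + g x).
Proof.
elim: k f g => [|k IH] f g Cf Cg.
  by split=> //; exact: contD (Ck_cont Cf) (Ck_cont Cg).
apply: (@CkS _ _ (fun j x => partial j f x + partial j g x)).
- exact: contD (Ck_cont Cf) (Ck_cont Cg).
- move=> j x; have := Ck_is_derive j x Cf; have := Ck_is_derive j x Cg => dg df.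
  exact: is_deriveD.
- by move=> j; apply: IH; exact: Ck_partial.
Qed.

Lemma CkM k f g : Ck k f -> Ck k g -> Ck k (fun x => f x * g x).
Proof.
elim: k f g => [|k IH] f g Cf Cg.
  by split=> //; exact: contM (Ck_cont Cf) (Ck_cont Cg).
apply: (@CkS _ _ (fun j x => f x * partial j g x + g x * partial j f x)).
- exact: contM (Ck_cont Cf) (Ck_cont Cg).
- move=> j x; have := Ck_is_derive j x Cf; have := Ck_is_derive j x Cg => dg df.
  exact: is_deriveM.
- by move=> j; apply: CkD; apply: IH; try exact: CkW; exact: Ck_partial.
Qed.

(* [h 0, h 1, ...] are the successive derivatives of a function of one variable
   on a set containing the range of f. *)
Lemma Ck_comp (h : nat -> R -> R) k f :
  (forall m x, is_derive (f x) (1 : R) (h m) (h m.+1 (f x))) -> Ck k f ->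
  Ck k (h 0%N \o f).
Proof.
move=> Hh Cf; suff H m : Ck k (h m \o f) by exact: H.
elim: k m Cf => [|k IH] m Cf.
  split=> //; apply: cont_comp; first exact: Ck_cont Cf.
  by move=> x; exact: (@ex_derive _ _ _ _ _ _ _ (Hh m x)).
apply: (@CkS _ _ (fun j x => (h m.+1 \o f) x * partial j f x)).
- apply: cont_comp; first exact: Ck_cont Cf.
  by move=> x; exact: (@ex_derive _ _ _ _ _ _ _ (Hh m x)).
- by move=> j x; apply: is_derive_comp1 => //; exact: (Ck_is_derive j x Cf).
- by move=> j; apply: CkM; [apply: IH; exact: CkW|exact: Ck_partial].
Qed.

Lemma CkV k f : (forall x, f x != 0) -> Ck k f -> Ck k (fun x => (f x)^-1).
Proof.
move=> f0; elim: k f f0 => [|k IH] f f0 Cf.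
  by split=> //; exact: contV f0 (Ck_cont Cf).
apply: (@CkS _ _ (fun j x => - ((f x)^-1 * (f x)^-1) * partial j f x)).
- exact: contV f0 (Ck_cont Cf).
- move=> j x; have [dfx _] := Cf.2 j.
  apply: DeriveDef; first exact: derivableV.
  by rewrite (deriveV (f0 x) (dfx x)) expr2 invfM.
- move=> j; apply: CkM; last exact: Ck_partial.
  have -> : (fun x => - ((f x)^-1 * (f x)^-1)) = (fun x => -1 * ((f x)^-1 * (f x)^-1)).
    by apply/funext => x; rewrite mulN1r.
  apply: CkM; first exact: Ck_cst.
  by apply: CkM; apply: IH => //; exact: CkW.
Qed.

Lemma smooth_cst (c : R) : smooth (fun _ : V => c).
Proof. by apply/smoothP => k; exact: Ck_cst. Qed.

Lemma smoothD f g : smooth f -> smooth g -> smooth (fun x => f x + g x).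
Proof. by move=> /smoothP sf /smoothP sg; apply/smoothP => k; exact: CkD. Qed.

Lemma smoothM f g : smooth f -> smooth g -> smooth (fun x => f x * g x).
Proof. by move=> /smoothP sf /smoothP sg; apply/smoothP => k; exact: CkM. Qed.

Lemma smoothN f : smooth f -> smooth (fun x => - f x).
Proof.
move=> sf; have -> : (fun x => - f x) = (fun x => -1 * f x).
  by apply/funext => x; rewrite mulN1r.
exact: smoothM (smooth_cst _) sf.
Qed.

Lemma smoothB f g : smooth f -> smooth g -> smooth (fun x => f x - g x).
Proof. by move=> sf sg; exact: smoothD sf (smoothN sg). Qed.

Lemma smooth_sum (I : Type) (r : seq I) (P : pred I) (F : I -> V -> R) :
  (forall i, P i -> smooth (F i)) -> smooth (fun x => \sum_(i <- r | P i) F i x).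
Proof.
move=> H; elim: r => [|i r IH].
  rewrite (_ : (fun _ => _) = fun=> 0); first exact: smooth_cst.
  by apply/funext => x; rewrite big_nil.
case: (boolP (P i)) => Pi; last first.
  rewrite (_ : (fun _ => _) = fun x => \sum_(j <- r | P j) F j x)//.
  by apply/funext => x; rewrite big_cons (negbTE Pi).
rewrite (_ : (fun _ => _) = fun x => F i x + \sum_(j <- r | P j) F j x).
  exact: smoothD (H i Pi) IH.
by apply/funext => x; rewrite big_cons Pi.
Qed.

Lemma smooth_prod (I : Type) (r : seq I) (F : I -> V -> R) :
  (forall i, smooth (F i)) -> smooth (fun x => \prod_(i <- r) F i x).
Proof.
move=> H; elim: r => [|i r IH].
  rewrite (_ : (fun _ => _) = fun=> 1); first exact: smooth_cst.
  by apply/funext => x; rewrite big_nil.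
rewrite (_ : (fun _ => _) = fun x => F i x * \prod_(j <- r) F j x).
  exact: smoothM (H i) IH.
by apply/funext => x; rewrite big_cons.
Qed.

Lemma smoothV f : (forall x, f x != 0) -> smooth f -> smooth (fun x => (f x)^-1).
Proof. by move=> f0 /smoothP sf; apply/smoothP => k; exact: CkV. Qed.

Lemma smooth_comp (h : nat -> R -> R) f :
  (forall m x, is_derive (f x) (1 : R) (h m) (h m.+1 (f x))) -> smooth f ->
  smooth (h 0%N \o f).
Proof. by move=> Hh /smoothP sf; apply/smoothP => k; exact: Ck_comp. Qed.

Lemma smooth_exp f : smooth f -> smooth (fun x => expR (f x)).
Proof. by apply: (@smooth_comp (fun=> expR)) => m x; exact: is_derive_expR. Qed.

Lemma smooth_ln f : (forall x, 0 < f x) -> smooth f -> smooth (fun x => ln (f x)).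
Proof.
move=> f0 sf.
have cl : continuous (fun x => ln (f x)).
  apply: cont_comp; first exact: smooth_cont.
  by move=> x; exact: (@ex_derive _ _ _ _ _ _ _ (is_derive1_ln (f0 x))).
apply/smoothP => -[|k]; first by split.
apply: (@CkS _ _ (fun j x => (f x)^-1 * partial j f x)) => // j.
  move=> x; apply: (is_derive_comp1 (h := @ln R)); last exact: is_derive1_ln.
  exact/derivableP/smooth_derivable.
have : smooth (fun x => (f x)^-1 * partial j f x).
  apply: smoothM; last exact: smooth_partial.
  by apply: smoothV => // x; rewrite gt_eqF.
by move/smoothP; apply.
Qed.

Lemma is_derive_coord x v j : is_derive x v (fun y : V => y 0 j) (v 0 j).
Proof.
apply: is_derive_of_line.
have -> : (fun s : R => (x + s *: v) 0 j) = (fun s : R => x 0 j + s * v 0 j).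
  by apply/funext => s; rewrite !mxE.
by apply: is_derive_eq; rewrite add0r mul1r [0 *: 0]mul0r add0r [_%:A]mulr1.
Qed.

Lemma smooth_coord j : smooth (fun x : V => x 0 j).
Proof.
have cc : continuous (fun x : V => x 0 j) by move=> x; exact: coord_continuous.
apply/smoothP => -[|k]; first by split.
apply: (@CkS _ _ (fun i _ => (delta_mx 0 i : V) 0 j)) => // [i x|i].
  exact: is_derive_coord.
exact: Ck_cst.
Qed.

End Smooth.

(** * Cutoff functions *)

Section Step.
Variable R : realType.
Implicit Types (t : R) (m : nat).

(** The index [m] makes the family stable: the derivative of each member is a combination of two
    others, so smoothness at all orders follows by one induction. *)
Definition flat m t : R := if 0 < t then t ^- m * expR (- t^-1) else 0.

Lemma flat_ge0 m t : 0 <= flat m t.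
Proof.
rewrite /flat; case: ifP => // t0; apply: mulr_ge0; last exact: expR_ge0.
by rewrite invr_ge0 exprn_ge0// ltW.
Qed.

Lemma flat_gt0 m t : 0 < t -> 0 < flat m t.
Proof. by move=> t0; rewrite /flat t0 mulr_gt0 ?expR_gt0// invr_gt0 exprn_gt0. Qed.

Lemma flat_le0 m t : t <= 0 -> flat m t = 0.
Proof. by rewrite /flat leNgt => /negbTE->. Qed.

(** One term of the exponential series, exp(1/t) >= t^(-(m+1)) / (m+1)!, beats the pole t^(-m) with
    a factor t to spare. *)
Lemma flat_le m t : 0 <= t -> flat m t <= (m.+1)`!%:R * t.
Proof.
rewrite le_eqVlt => /predU1P[<-|t0]; first by rewrite flat_le0// mulr0.
rewrite /flat t0 expRN; have t'0 : 0 <= t^-1 by rewrite invr_ge0 ltW.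
have H := expR_ge1Dxn m t'0.
have fm : 0 < (m.+1)`!%:R :> R by rewrite ltr0n fact_gt0.
have {}H : t ^- m.+1 / (m.+1)`!%:R <= expR t^-1.
  by apply: le_trans H; rewrite exprVn lerDr.
rewrite ler_pdivrMr ?expR_gt0//; apply: le_trans (ler_wpM2l _ H); last first.
  by rewrite mulr_ge0// ltW.
rewrite exprS invfM mulrACA.
have -> : (m.+1)`!%:R * (t^-1 * t ^- m) * (t * (m.+1)`!%:R^-1) = t ^- m :> R.
  by field; rewrite !gt_eqF// exprn_gt0.
by [].
Qed.

Lemma is_derive_flat m t :
  is_derive t (1 : R) (flat m) (flat m.+2 t - m%:R * flat m.+1 t).
Proof.
have [t0|t0|->] := ltgtP t 0.
- rewrite !flat_le0 ?(ltW t0)// mulr0 subr0.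
  apply: (@near_eq_is_derive _ _ _ (cst 0)) => //.
  near=> s; rewrite flat_le0//; apply: ltW; near: s; exact: lt_nbhsl.
(* For t > 0, [flat m] is [phi] composed with inversion. *)
- pose phi (y : R) := y ^+ m * expR (- y).
  have dphi y : is_derive y (1 : R) phi (m%:R * y ^+ m.-1 * expR (- y) - phi y).
    have dE : is_derive y (1 : R) (fun y => expR (- y)) (expR (- y) * -1).
      by apply: (is_derive_comp1 (h := expR)); exact: is_deriveNid.
    have dX : is_derive y (1 : R) (fun y => y ^+ m) (m%:R * y ^+ m.-1).
      apply: DeriveDef; first exact: exprn_derivable.
      by rewrite exp_derive [_ *: 1]mulr1.
    have := is_deriveM dX dE; rewrite -2![_ *: _]/(_ * _).
    rewrite (_ : _ + _ = m%:R * y ^+ m.-1 * expR (- y) - phi y)//.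
    by rewrite /phi; ring.
  have dV : is_derive t (1 : R) (fun s : R => s^-1) (- t ^- 2 *: 1).
    by apply: is_deriveV; rewrite gt_eqF.
  have := is_derive_comp1 dV (dphi t^-1).
  have -> : (m%:R * t^-1 ^+ m.-1 * expR (- t^-1) - phi t^-1) * (- t ^- 2 *: 1) =
      flat m.+2 t - m%:R * flat m.+1 t.
    rewrite /flat t0 /phi [_ *: 1]mulr1; move: (expR _) => E.
    have tn := lt0r_neq0 t0.
    clear phi dphi; case: m => [|m'] /=; first by field; rewrite tn.
    by rewrite !exprVn !exprS; field; rewrite tn expf_neq0.
  apply: near_eq_is_derive.
  near=> s; rewrite /flat ifT; last by near: s; exact: lt_nbhsr.
  by rewrite /phi /= exprVn.
- rewrite !flat_le0// mulr0 subr0.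
  suff H : (fun h => h^-1 *: ((flat m \o shift 0) (h *: (1 : R)) - flat m 0)) @ 0^' --> (0 : R).
    by apply: DeriveDef; [apply/cvg_ex; eexists; exact: H|exact: cvg_lim H].
  apply/cvgrPdist_le => e e0; near=> h.
  have h0 : h != 0 by near: h; exact: nbhs_dnbhs_neq.
  rewrite (flat_le0 m (lexx 0)) subr0 sub0r normrN /= addr0 [h *: 1]mulr1.
  have F : 0 < (m.+2)`!%:R :> R by rewrite ltr0n fact_gt0.
  have he : `|h| <= e / (m.+2)`!%:R.
    near: h; apply: nbhs_dnbhs; apply/nbhs_normP; exists (e / (m.+2)`!%:R) => /=.
      exact: divr_gt0.
    by move=> h /=; rewrite sub0r normrN => /ltW.
  have [hle|hgt] := leP h 0; first by rewrite flat_le0// scaler0 normr0 ltW.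
  (* At the origin the difference quotient is again a member of the family, and [flat_le] for the
     index [m.+1] makes it tend to 0. *)
  have -> : h^-1 *: flat m h = flat m.+1 h.
    by rewrite /flat hgt exprS invfM -mulrA.
  rewrite ger0_norm ?flat_ge0//; apply: le_trans (flat_le _ (ltW hgt)) _.
  by rewrite -ler_pdivlMl// mulrC -(gtr0_norm hgt).
Unshelve. all: by end_near. Qed.

Lemma flat0_mono s t : s <= t -> flat 0 s <= flat 0 t.
Proof.
move=> st; have [s0|s0] := leP s 0; first by rewrite flat_le0// flat_ge0.
rewrite /flat s0 (lt_le_trans s0 st) !expr0 invr1 !mul1r ler_expR lerN2.
by rewrite lef_pV2 ?posrE// (lt_le_trans s0 st).
Qed.

(** The standard smooth step. Since t and 1 - t are never both nonpositive, the denominator does not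
    vanish. *)
Definition stp t : R := flat 0 t / (flat 0 t + flat 0 (1 - t)).

Lemma stp_den_gt0 t : 0 < flat 0 t + flat 0 (1 - t).
Proof.
have [t0|t0] := leP t 0.
  by rewrite ltr_wpDl ?flat_ge0// flat_gt0// subr_gt0 (le_lt_trans t0).
by rewrite ltr_pwDl ?flat_ge0// flat_gt0.
Qed.

Lemma stp_ge0 t : 0 <= stp t.
Proof. by rewrite divr_ge0 ?flat_ge0// ltW// stp_den_gt0. Qed.

Lemma stp_le1 t : stp t <= 1.
Proof. by rewrite ler_pdivrMr ?stp_den_gt0// mul1r lerDl flat_ge0. Qed.

Lemma stp_le0 t : t <= 0 -> stp t = 0.
Proof. by move=> t0; rewrite /stp flat_le0// mul0r. Qed.

Lemma stp_ge1 t : 1 <= t -> stp t = 1.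
Proof.
move=> t1; rewrite /stp (@flat_le0 _ (1 - t)) ?subr_le0// addr0 divff//.
by rewrite gt_eqF// flat_gt0// (lt_le_trans ltr01).
Qed.

Lemma stp_mono s t : s <= t -> stp s <= stp t.
Proof.
move=> st; rewrite /stp ler_pdivrMr ?stp_den_gt0// mulrAC ler_pdivlMr ?stp_den_gt0//.
rewrite !mulrDr (mulrC (flat 0 s) (flat 0 t)) lerD2l; apply: ler_pM; rewrite ?flat_ge0//.
  exact: flat0_mono.
by apply: flat0_mono; rewrite lerD2l lerN2.
Qed.

End Step.

(** * Cutoffs and compact support in several variables *)

Section TestFunctions.
Variables (R : realType) (n : nat).
Notation V := 'rV[R]_n.
Implicit Types (f g : V -> R) (x v : V) (r : R).

Lemma smooth_flat m f : smooth f -> smooth (fun x => flat m (f x)).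
Proof.
move=> /smoothP sf; apply/smoothP => k.
elim: k m => [|k IH] m.
  split=> //; apply: cont_comp; first exact: Ck_cont (sf 0%N).
  by move=> x; exact: (@ex_derive _ _ _ _ _ _ _ (is_derive_flat m (f x))).
apply: (@CkS _ _ _ _ (fun j x => (flat m.+2 (f x) - m%:R * flat m.+1 (f x)) * partial j f x)).
- apply: cont_comp; first exact: Ck_cont (sf 0%N).
  by move=> x; exact: (@ex_derive _ _ _ _ _ _ _ (is_derive_flat m (f x))).
- move=> j x; apply: (is_derive_comp1 (h := flat m)); last exact: is_derive_flat.
  exact: (Ck_is_derive j x (sf 1%N)).
- move=> j; apply: CkM; last exact: Ck_partial.
  rewrite (_ : (fun _ => _) = fun x => flat m.+2 (f x) + (- m%:R) * flat m.+1 (f x)).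
    by apply: CkD => //; apply: CkM => //; exact: Ck_cst.
  by apply/funext => x; rewrite mulNr.
Qed.

Lemma smooth_stp f : smooth f -> smooth (fun x => stp (f x)).
Proof.
move=> sf; have sf1 : smooth (fun x => 1 - f x).
  exact: smoothB (smooth_cst 1) sf.
apply: smoothM; first exact: smooth_flat.
apply: smoothV; first by move=> x; rewrite gt_eqF// stp_den_gt0.
by apply: smoothD; apply: smooth_flat.
Qed.

(** The norm of a row is the maximum of its absolute coordinates, so a product of one-variable steps
    is adapted to balls: for r >= 0 it is 1 up to radius r and 0 beyond r + 1. *)
Definition cutoff r x : R := \prod_j (stp (r + 1 - x 0 j) * stp (r + 1 + x 0 j)).

Lemma smooth_cutoff r : smooth (cutoff r).
Proof.
apply: smooth_prod => j; have sj := smooth_coord R j.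
exact: smoothM (smooth_stp (smoothB (smooth_cst (r + 1)) sj))
  (smooth_stp (smoothD (smooth_cst (r + 1)) sj)).
Qed.

Lemma cutoff_ge0 r x : 0 <= cutoff r x.
Proof. by apply: prodr_ge0 => j _; rewrite mulr_ge0 ?stp_ge0. Qed.

Lemma cutoff1 r x : `|x| <= r -> cutoff r x = 1.
Proof.
move=> xr; apply: big1 => j _; have := le_trans (norm_coord_le x j) xr.
rewrite ler_norml => /andP[x1 x2]; rewrite !stp_ge1 ?mulr1//; lra.
Qed.

Lemma cutoff0 r x : r + 1 < `|x| -> 0 <= r -> cutoff r x = 0.
Proof.
move=> xr r0; have [j xj] : exists j, r + 1 < `|x 0 j|.
  apply: contrapT => H; have : `|x| <= r + 1.
    apply: norm_row_le; first lra.
    by move=> j; rewrite leNgt; apply/negP => xj; apply: H; exists j.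
  by rewrite leNgt xr.
rewrite /cutoff (bigD1 j)//=.
move: xj; rewrite lter_normr => /orP[] xj.
  by rewrite (@stp_le0 _ (_ - _)) ?mul0r//; lra.
by rewrite (@stp_le0 _ (_ + x 0 j)) ?mulr0 ?mul0r//; lra.
Qed.

Lemma compact_ball r : compact [set x : V | `|x| <= r].
Proof.
apply: bounded_closed_compact.
  exists r; split; first exact: num_real.
  by move=> M rM x /= /le_trans; apply; exact: ltW.
rewrite (_ : [set _ | _] = (fun x : V => `|x|) @^-1` [set y | y <= r])//.
apply: preimage_closed; last exact: closed_le.
by move=> x _; exact: norm_continuous.
Qed.

Lemma compact_norm_bounded (A : set V) : compact A -> exists2 r, 0 <= r & forall x, A x -> `|x| <= r.
Proof.
move=> /compact_bounded[M [Mr HM]]; exists (`|M| + 1) => [|x Ax].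
  by rewrite addr_ge0.
by apply: (HM (`|M| + 1)) => //; rewrite (le_lt_trans (ler_norm _))// ltrDl.
Qed.

Lemma test_functionP f : test_function f <->
  smooth f /\ exists2 r, 0 <= r & forall x, r < `|x| -> f x = 0.
Proof.
split=> -[sf]; last first.
  move=> [r r0 H]; split=> //; apply: subclosed_compact (@compact_ball r) _.
    exact: closed_closure.
  have := compact_closed (@norm_hausdorff _ _) (@compact_ball r).
  rewrite closure_id => ->.
  by apply: closureS => x /= fx; rewrite leNgt; apply: contra_neqN fx => /H.
move=> /compact_norm_bounded[r r0 H]; split=> //; exists r => // x xr.
apply/eqP; apply: contraTT xr => fx; rewrite -leNgt; apply: H.
exact: subset_closure.
Qed.

End TestFunctions.

(** * Riesz representation on test functions *)

Section TestClosure.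
Variables (R : realType) (n : nat).
Notation V := 'rV[R]_n.
Implicit Types (f g : V -> R) (x v : V) (r : R).

Lemma test_smooth f : test_function f -> smooth f.
Proof. by case. Qed.

Lemma test0 : test_function (fun _ : V => 0).
Proof. by apply/test_functionP; split; [exact: smooth_cst|exists 0]. Qed.

Lemma testM g f : smooth g -> test_function f -> test_function (fun x => g x * f x).
Proof.
move=> sg /test_functionP[sf [r r0 H]]; apply/test_functionP; split; first exact: smoothM.
by exists r => // x /H->; rewrite mulr0.
Qed.

Lemma testZ (c : R) f : test_function f -> test_function (fun x => c * f x).
Proof. by apply: testM; exact: smooth_cst. Qed.

Lemma testD f g : test_function f -> test_function g -> test_function (fun x => f x + g x).
Proof.
move=> /test_functionP[sf [r r0 H]] /test_functionP[sg [s s0 K]]; apply/test_functionP.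
split; first exact: smoothD.
exists (Num.max r s) => [|x]; first by rewrite le_max r0.
by rewrite gt_max => /andP[/H-> /K->]; rewrite addr0.
Qed.

Lemma test_sum (I : Type) (r : seq I) (P : pred I) (F : I -> V -> R) :
  (forall i, P i -> test_function (F i)) -> test_function (fun x => \sum_(i <- r | P i) F i x).
Proof.
move=> H; elim: r => [|i r IH].
  rewrite (_ : (fun _ => _) = fun=> 0); first exact: test0.
  by apply/funext => x; rewrite big_nil.
case: (boolP (P i)) => Pi; last first.
  rewrite (_ : (fun _ => _) = fun x => \sum_(j <- r | P j) F j x)//.
  by apply/funext => x; rewrite big_cons (negbTE Pi).
rewrite (_ : (fun _ => _) = fun x => F i x + \sum_(j <- r | P j) F j x).
  by apply: testD => //; exact: H.
by apply/funext => x; rewrite big_cons Pi.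
Qed.

Lemma test_partial j f : test_function f -> test_function (partial j f).
Proof.
move=> /test_functionP[sf [r r0 H]]; apply/test_functionP.
split; first exact: smooth_partial.
exists r => // x rx.
have : is_derive x (delta_mx 0 j) f 0.
  apply: (@near_eq_is_derive _ _ _ (cst 0)) => //.
  have : \forall y \near x, r < `|y|.
    have : {for x, continuous (fun y : V => `|y|)} by exact: norm_continuous.
    by move/cvgr_gt; apply.
  by apply: filterS => y /H->.
by move=> H0; exact: (@derive_val _ _ _ _ _ _ _ H0).
Qed.

Lemma test_bounded f : test_function f -> exists2 C, 0 < C & forall x, `|f x| <= C.
Proof.
move=> /test_functionP[sf [r r0 H]].
have cf : {within [set x : V | `|x| <= r], continuous (fun x => `|f x|)}.
  apply: continuous_subspaceT => x; apply: continuous_comp; last exact: norm_continuous.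
  exact: smooth_cont.
have [|c _ fc] := EVT_max_rV _ (@compact_ball R n r) cf.
  by exists 0; rewrite /= normr0.
exists (`|f c| + 1) => [|x]; first by rewrite ltr_wpDl.
have [xr|/H->] := leP `|x| r; last by rewrite normr0 addr_ge0.
by rewrite (le_trans (fc x _)) ?inE// lerDl.
Qed.

Lemma test_cutoff r : 0 <= r -> test_function (@cutoff R n r).
Proof.
move=> r0; apply/test_functionP; split; first exact: smooth_cutoff.
by exists (r + 1) => [|x rx]; [rewrite addr_ge0|exact: cutoff0].
Qed.

End TestClosure.

Section Riesz.
Variables (R : realType) (n : nat).
Notation V := 'rV[R]_n.
Variable L : (V -> R) -> R.
Hypothesis L_lin : forall (c : R) f g, test_function f -> test_function g ->
  L (fun x => c * f x + g x) = c * L f + L g.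
Hypothesis L_pos : forall f, test_function f -> (forall x, 0 <= f x) -> 0 <= L f.
Implicit Types (f g : V -> R) (x v : V) (A B X : set V).

Lemma L_D f g : test_function f -> test_function g -> L (fun x => f x + g x) = L f + L g.
Proof.
move=> tf tg; rewrite -[L f]mul1r -L_lin//; congr L.
by apply/funext => x; rewrite mul1r.
Qed.

Lemma L_0 : L (fun=> 0) = 0.
Proof.
have := L_D (@test0 R n) (@test0 R n).
rewrite (_ : (fun _ => _) = fun=> 0); last by apply/funext => x; rewrite addr0.
by move=> /eqP; rewrite -subr_eq0 opprD addNKr oppr_eq0 => /eqP.
Qed.

Lemma L_Z c f : test_function f -> L (fun x => c * f x) = c * L f.
Proof.
move=> tf; rewrite -[RHS]addr0 -L_0 -L_lin//; last exact: test0.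
by congr L; apply/funext => x; rewrite addr0.
Qed.

Lemma L_B f g : test_function f -> test_function g -> L (fun x => f x - g x) = L f - L g.
Proof.
move=> tf tg; rewrite -[- L g]mulN1r addrC -L_lin//; congr L.
by apply/funext => x; rewrite mulN1r addrC.
Qed.

Lemma testB f g : test_function f -> test_function g -> test_function (fun x => f x - g x).
Proof.
move=> tf tg; rewrite (_ : (fun _ => _) = fun x => f x + -1 * g x).
  by apply: testD => //; exact: testZ.
by apply/funext => x; rewrite mulN1r.
Qed.

Lemma L_le f g : test_function f -> test_function g -> (forall x, f x <= g x) -> L f <= L g.
Proof.
move=> tf tg fg; rewrite -subr_ge0 -L_B//; apply: L_pos; first exact: testB.
by move=> x; rewrite subr_ge0.
Qed.

Lemma L_sum (I : Type) (r : seq I) (F : I -> V -> R) :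
  (forall i, test_function (F i)) -> L (fun x => \sum_(i <- r) F i x) = \sum_(i <- r) L (F i).
Proof.
move=> tF; elim: r => [|i r IH].
  by rewrite big_nil -[RHS]L_0; congr L; apply/funext => x; rewrite big_nil.
rewrite big_cons -IH -L_D//; last exact: test_sum.
by congr L; apply/funext => x; rewrite big_cons.
Qed.

(** Daniell's construction with increasing sequences of test functions in place of lower
    semicontinuous functions. Each point of A reaches the level 1 at a finite index, which lets
    covers be multiplied by cutoffs and summed diagonally. *)
Definition covers A (f : nat -> V -> R) (c : R) :=
  [/\ forall m, test_function (f m), forall m x, 0 <= f m x,
      forall m x, f m x <= f m.+1 x, forall m, L (f m) <= c &
      forall x, A x -> exists m, 1 <= f m x].

Lemma covers_mono A (f : nat -> V -> R) (c : R) : covers A f c -> forall m k x, (m <= k)%N -> f m x <= f k x.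
Proof.
move=> [_ _ fS _ _] m k x /subnKC <-; elim: (k - m)%N => [|l IH]; first by rewrite addn0.
by rewrite addnS; exact: le_trans IH (fS _ _).
Qed.

Definition outer A : \bar R :=
  ereal_inf [set c%:E | c in [set c | exists f : nat -> V -> R, covers A f c]].

Lemma outer_le A (f : nat -> V -> R) (c : R) : covers A f c -> (outer A <= c%:E)%E.
Proof. by move=> H; apply: ereal_inf_lbound; exists c => //; exists f. Qed.

Lemma covers_ge0 A (f : nat -> V -> R) (c : R) : covers A f c -> 0 <= c.
Proof. by move=> [tf f0 _ fc _]; apply: le_trans (fc 0%N); exact: L_pos. Qed.

Lemma outer_ge0 A : (0 <= outer A)%E.
Proof.
by apply: le_ereal_inf_tmp => _ [c [f /covers_ge0 c0] <-]; rewrite lee_fin.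
Qed.

Lemma outer_adherent A (e : R) : 0 < e -> (outer A < +oo)%E ->
  exists (f : nat -> V -> R) (c : R), covers A f c /\ (c%:E <= outer A + e%:E)%E.
Proof.
move=> e0 A1; have Af : outer A \is a fin_num by rewrite ge0_fin_numE// outer_ge0.
have [_ [c [f fc] <-] ce] := lb_ereal_inf_adherent e0 Af.
by exists f, c; split=> //; exact: ltW.
Qed.

Lemma outer_set0 : outer set0 = 0%E.
Proof.
apply/eqP; rewrite eq_le outer_ge0 andbT; apply: (@outer_le _ (fun _ _ => 0)).
by split=> // m; [exact: test0|rewrite L_0].
Qed.

Lemma le_outer : {homo outer : A B / A `<=` B >-> (A <= B)%E}.
Proof.
move=> A B AB; apply: ereal_inf_le_tmp => _ [c [f [H1 H2 H3 H4 H5]] <-].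
by exists c => //; exists f; split=> // x /AB/H5.
Qed.

Lemma sum_half_pow (e : R) m : 0 < e -> \sum_(i < m) e / 2 ^+ i.+1 <= e.
Proof.
move=> e0; have -> : \sum_(i < m) e / 2 ^+ i.+1 = e * (1 - (2 ^+ m)^-1).
  elim: m => [|m IH]; first by rewrite big_ord0 expr0 invr1 subrr mulr0.
  rewrite big_ord_recr/= IH exprS; field.
  by rewrite expf_neq0.
by rewrite ger_pMr// gerBl invr_ge0 exprn_ge0.
Qed.

Lemma outer_subadd : sigma_subadditive outer.
Proof.
move=> F; set S := (X in (_ <= X)%E).
have [->|Sfin] := eqVneq S +oo%E; first exact: leey.
have FS m : (\sum_(i < m) outer (F i) <= S)%E.
  by rewrite -(big_mkord xpredT (outer \o F)); apply: nneseries_lim_ge => k _ _; exact: outer_ge0.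
have S0 : (0 <= S)%E by apply: nneseries_ge0 => k _ _; exact: outer_ge0.
have Sf : S \is a fin_num by rewrite ge0_fin_numE// ltey.
have Flt m : (outer (F m) < +oo)%E.
  apply: (@le_lt_trans _ _ S); last by rewrite ltey.
  apply: le_trans (FS m.+1); rewrite big_ord_recr/= leeDr//.
  by apply: sume_ge0 => i _; exact: outer_ge0.
apply/lee_addgt0Pr => e e0.
have H m : exists fc : (nat -> V -> R) * R, covers (F m) fc.1 fc.2 /\
    (fc.2%:E <= outer (F m) + (e / 2 ^+ m.+1)%:E)%E.
  have [|f [c fc]] := @outer_adherent (F m) (e / 2 ^+ m.+1) _ (Flt m).
    by rewrite divr_gt0// exprn_gt0.
  by exists (f, c).
have [fc Hfc] := choice H.
(* Diagonal cover: stage m adds the first m covers, each taken at its own stage m. The allowances e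
   / 2^(i+1) add up to at most e. *)
rewrite -(fineK Sf) -EFinD; apply: (@outer_le _ (fun m x => \sum_(i < m) (fc i).1 m x)).
have tfc i m : test_function ((fc i).1 m) by have [[]] := Hfc i.
have fc0 i m x : 0 <= (fc i).1 m x by have [[]] := Hfc i.
split.
- by move=> m; apply: test_sum.
- by move=> m x; apply: sumr_ge0.
- move=> m x; rewrite big_ord_recr/= ler_wpDr//; apply: ler_sum => i _.
  by have [[]] := Hfc i.
- move=> m; rewrite L_sum//; rewrite -lee_fin EFinD (fineK Sf).
  apply: (@le_trans _ _ (\sum_(i < m) (outer (F i) + (e / 2 ^+ i.+1)%:E))%E).
    rewrite -sumEFin; apply: lee_sum => i _; have [[_ _ _ H1 _] H2] := Hfc i.
    by apply: le_trans H2; rewrite lee_fin.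
  rewrite big_split/=; apply: leeD; first exact: FS.
  by rewrite sumEFin lee_fin; exact: sum_half_pow.
- move=> x [i _ Fx]; have [C _] := Hfc i; have [_ _ _ _ /(_ x Fx)[m fm]] := C.
  exists (maxn m i.+1); have im : (i < maxn m i.+1)%N by rewrite leq_maxr.
  rewrite (bigD1 (Ordinal im))//= ler_wpDr ?sumr_ge0//.
  by apply: le_trans fm _; apply: (covers_mono C); rewrite leq_maxl.
Qed.

(** Let [th m] increase to the indicator of the half-space and let [f] be a near-optimal cover of X.
    Then [th m * f m] covers the part of X inside, and [(1 - th k) * f m] covers the part outside
    because [th k] vanishes there; for suitable k the two masses add up to little more than that of
    [f]. *)
Lemma halfspace_caratheodory (j : 'I_n) (t : R) :
  caratheodory_measurable outer [set x : V | t < x 0 j].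
Proof.
pose M : {outer_measure set V -> \bar R} := HB.pack outer
  (isOuterMeasure.Build R V outer outer_set0 outer_ge0 le_outer outer_subadd).
apply: (@le_caratheodory_measurable _ _ M) => X; rewrite /M/=.
set H := [set x | _].
have [->|Xfin] := eqVneq (outer X) +oo%E; first exact: leey.
have Xf : outer X \is a fin_num by rewrite ge0_fin_numE ?outer_ge0// ltey.
apply/lee_addgt0Pr => e e0.
have e2 : 0 < e / 2 by rewrite divr_gt0.
have [|f [c [fc ce]]] := @outer_adherent X (e / 2) e2; first by rewrite ltey.
have [tf f0 fS Lf fX] := fc.
pose th (m : nat) (x : V) : R := stp (m%:R * (x 0 j - t)).
have sth m : smooth (th m).
  apply: smooth_stp; apply: smoothM; first exact: smooth_cst.
  by apply: smoothB; [exact: smooth_coord|exact: smooth_cst].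
have th0 m x : 0 <= th m x by exact: stp_ge0.
have th1 m x : th m x <= 1 by exact: stp_le1.
have thS m x : th m x <= th m.+1 x.
  have [xt|xt] := leP (x 0 j) t.
    by rewrite {1}/th stp_le0// mulr_ge0_le0// subr_le0.
  by apply: stp_mono; rewrite ler_wpM2r ?ler_nat// subr_ge0 ltW.
have thH m x : ~ H x -> th m x = 0.
  by move=> /negP; rewrite -leNgt => xt; rewrite /th stp_le0// mulr_ge0_le0// subr_le0.
have thHt x : H x -> exists m, forall k, (m <= k)%N -> th k x = 1.
  rewrite /H/= -subr_gt0 => xt; exists (Num.bound (x 0 j - t)^-1) => k mk.
  rewrite /th stp_ge1// -ler_pdivrMr// div1r.
  apply: (le_trans (ltW (archi_boundP _))); first by rewrite invr_ge0 ltW.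
  by rewrite ler_nat.
have tfth m k : test_function (fun x => th m x * f k x) by exact: testM.
have Lfth m k : L (fun x => th m x * f k x) <= c.
  apply: le_trans (Lf k); apply: L_le => // x.
  by rewrite ler_piMl.
pose E := [set L (fun x => th m x * f m x) | m in [set: nat]].
have supE : has_sup E.
  split; first by exists (L (fun x => th 0%N x * f 0%N x)), 0%N.
  by exists c => _ [m _ <-].
have HX : covers (X `&` H) (fun m x => th m x * f m x) (sup E).
  split=> //.
  - by move=> m x; rewrite mulr_ge0.
  - by move=> m x; apply: ler_pM.
  - by move=> m; apply: sup_upper_bound => //; exists m.
  - move=> x [/fX[m fm] /thHt[k thk]]; exists (maxn m k).
    by rewrite thk ?leq_maxr// mul1r (le_trans fm)// (covers_mono fc)// leq_maxl.
have [_ [k _ <-] Ek] := sup_adherent e2 supE.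
have HXC : covers (X `&` ~` H) (fun m x => (1 - th k x) * f m x) (c - sup E + e / 2).
  have s1 : smooth (fun x => 1 - th k x) by apply: smoothB => //; exact: smooth_cst.
  have th1' x : 0 <= 1 - th k x by rewrite subr_ge0.
  split.
  - by move=> m; exact: testM.
  - by move=> m x; rewrite mulr_ge0.
  - by move=> m x; rewrite ler_wpM2l.
  (* Raising the stage to [maxn m k] gives [th k * f (maxn m k) >= th k * f k], and the mass of the
     latter is within e / 2 of [sup E]. *)
  - move=> m; apply: (@le_trans _ _ (L (fun x => (1 - th k x) * f (maxn m k) x))).
      apply: L_le; [exact: testM|exact: testM|move=> x].
      by rewrite ler_wpM2l// (covers_mono fc)// leq_maxl.
    rewrite (_ : (fun _ => _) = fun x => f (maxn m k) x - th k x * f (maxn m k) x); last first.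
      by apply/funext => x; rewrite mulrBl mul1r.
    rewrite L_B//; have := Lf (maxn m k).
    have : L (fun x => th k x * f k x) <= L (fun x => th k x * f (maxn m k) x).
      by apply: L_le => // x; rewrite ler_wpM2l// (covers_mono fc)// leq_maxr.
    by lra.
  - move=> x [/fX[m fm] Hx]; exists m.
    by rewrite thH// subr0 mul1r.
apply: (@le_trans _ _ (sup E + (c - sup E + e / 2))%:E).
  by rewrite EFinD; apply: leeD; [exact: outer_le HX|exact: outer_le HXC].
apply: (@le_trans _ _ (c + e / 2)%:E); first by rewrite lee_fin; lra.
rewrite EFinD; apply: (le_trans (leeD2r _ ce)).
by rewrite -addeA -EFinD -splitr.
Qed.

(** Half-spaces suffice: an open set is a countable union of half-open boxes with rational centres
    and half-width 1/(m+1), each cut out by finitely many half-spaces and complements of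
    half-spaces. *)
Lemma open_caratheodory (U : set V) : open U -> caratheodory_measurable outer U.
Proof.
move=> oU.
pose M : {outer_measure set V -> \bar R} := HB.pack outer
  (isOuterMeasure.Build R V outer outer_set0 outer_ge0 le_outer outer_subadd).
change (M.-cara.-measurable U).
pose r (m : nat) : R := m.+1%:R^-1.
pose B (qm : 'rV[rat]_n * nat) : set V :=
  \big[setI/setT]_(j < n) ([set x : V | ratr (qm.1 0 j) - r qm.2 < x 0 j] `&`
    ~` [set x : V | ratr (qm.1 0 j) + r qm.2 < x 0 j]).
have mB qm : M.-cara.-measurable (B qm).
  apply: bigsetI_measurable => j _; apply: measurableI.
    exact: halfspace_caratheodory.
  by apply: measurableC; exact: halfspace_caratheodory.
have BE qm x : B qm x <-> forall j, ratr (qm.1 0 j) - r qm.2 < x 0 j <= ratr (qm.1 0 j) + r qm.2.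
  split=> [+ j|H]; first by rewrite /B (bigD1 j)//= => -[[h1 /negP]]; rewrite -leNgt h1.
  apply: (big_ind (fun S : set V => S x)) => // j _.
  by have /andP[h1 h2] := H j; split=> //; apply/negP; rewrite -leNgt.
pose D (qm : 'rV[rat]_n * nat) : set V := if `[< B qm `<=` U >] then B qm else set0.
have -> : U = \bigcup_qm D qm.
  apply/seteqP; split=> [x Ux|x [qm _]]; last first.
    by rewrite /D; case: asboolP => // BU /BU.
  move: oU => /(_ x Ux)/nbhs_normP[d /= d0 xd].
  have [m md] : exists m, r m * 2 < d.
    exists (Num.bound (2 / d)).
    have b0 : 0 <= 2 / d by rewrite divr_ge0// ltW.
    have := archi_boundP b0; rewrite ltr_pdivrMr// => b.
    rewrite /r mulrC ltr_pdivrMr ?ltr0n//; apply: lt_le_trans b _.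
    by rewrite mulrC ler_pM2l// ler_nat.
  have r0 : 0 < r m by rewrite invr_gt0.
  have H (j : 'I_n) : exists q : rat, x 0 j - r m < ratr q < x 0 j + r m.
    have [|q] := @rat_in_itvoo R (x 0 j - r m) (x 0 j + r m); first by lra.
    by rewrite in_itv/=; exists q.
  have [q Hq] := choice H.
  exists (\row_j q j, m) => //.
  rewrite /D asboolT; last first.
    move=> y /BE/= yB; apply: xd => /=; apply: le_lt_trans md.
    apply: norm_row_le; first by rewrite mulr_ge0// ltW.
    move=> j; have := yB j; have := Hq j; rewrite !mxE => /andP[h1 h2] /andP[h3 h4].
    by rewrite ler_norml; apply/andP; split; lra.
  by apply/BE => j /=; have := Hq j; rewrite !mxE => /andP[h1 h2]; apply/andP; split; lra.
apply: countable_bigcupT_measurable => [|qm]; first exact: countableP.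
by rewrite /D; case: ifP.
Qed.

Let Lmeasure_semi_sigma_additive :
  semi_sigma_additive (outer : set (@borel_space R n) -> \bar R).
Proof.
pose M : {outer_measure set V -> \bar R} := HB.pack outer
  (isOuterMeasure.Build R V outer outer_set0 outer_ge0 le_outer outer_subadd).
have sub : (@measurable _ (borel_space R n)) `<=` M.-cara.-measurable.
  apply: smallest_sub; first exact: sigma_algebra_measurable.
  exact: open_caratheodory.
move=> F mF tF mUF; apply: (@caratheodory_measure_sigma_additive _ _ M) => //.
  by move=> k; exact: sub.
exact: sub.
Qed.

Definition Lmeasure : {measure set (@borel_space R n) -> \bar R} := HB.pack
  (outer : set (@borel_space R n) -> \bar R)
  (isMeasure.Build _ (borel_space R n) R (outer : set (@borel_space R n) -> \bar R)
    outer_set0 outer_ge0 Lmeasure_semi_sigma_additive).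

Lemma outer_le_test f A : test_function f -> (forall x, 0 <= f x) ->
  (forall x, A x -> 1 <= f x) -> (outer A <= (L f)%:E)%E.
Proof.
move=> tf f0 fA; apply: (@outer_le _ (fun=> f)); split=> //.
by move=> x /fA; exists 0%N.
Qed.

Lemma outer_bounded A (r : R) : 0 <= r -> (forall x, A x -> `|x| <= r) ->
  (outer A <= (L (@cutoff R n r))%:E)%E.
Proof.
move=> r0 Ar; apply: outer_le_test; first exact: test_cutoff.
  by move=> x; exact: cutoff_ge0.
by move=> x /Ar xr; rewrite cutoff1.
Qed.

(* Dini: by compactness one member of an increasing cover already dominates g
   up to a small error. *)
Lemma test_le_outer f A : test_function f -> (forall x, f x <= 1) ->
  (forall x, f x != 0 -> A x) -> ((L f)%:E <= outer A)%E.
Proof.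
move=> tf f1 fA; apply: le_ereal_inf_tmp => _ [c [h hc] <-]; rewrite lee_fin.
have [th h0 hS Lh hA] := hc.
have /test_functionP[sf [r r0 fr]] := tf.
apply/ler_addgt0Pr => e e0.
have tc := @test_cutoff R n r r0.
pose K := L (@cutoff R n r) + 1.
have K0 : 0 < K by rewrite ltr_wpDl// L_pos// => x; exact: cutoff_ge0.
pose d := e / K; have d0 : 0 < d by rewrite divr_gt0.
have [m Hm] : exists m, forall x, `|x| <= r -> f x <= h m x + d.
  have := @compact_ball R n r; rewrite compact_cover.
  move=> /(_ nat setT (fun m => [set x | f x - h m x < d])) [m _|x xr|D _ HD].
  - have cs : continuous (fun x => f x - h m x).
      by apply: smooth_cont; apply: smoothB; exact: test_smooth.
    rewrite (_ : [set _ | _] = (fun x => f x - h m x) @^-1` [set y | y < d])//.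
    by apply: open_comp => // x _; exact: cs.
  - have [fx0|/fA/hA[m hm]] := eqVneq (f x) 0.
      by exists 0%N => //=; rewrite fx0 sub0r (le_lt_trans _ d0)// oppr_le0.
    by exists m => //=; rewrite (le_lt_trans _ d0)// subr_le0 (le_trans (f1 x)).
  - exists (\max_(i <- finmap.enum_fset D) i)%N => x xr.
    have [i iD] := HD x xr; rewrite /= => /ltW; rewrite lerBlDl => /le_trans; apply.
    rewrite lerD2r; apply: (covers_mono hc).
    exact: (@leq_bigmax_seq _ (finmap.enum_fset D) xpredT id).
apply: (@le_trans _ _ (L (fun x => d * cutoff r x + h m x))).
  apply: (L_le tf (testD (testZ d tc) (th m))) => x; have [xr|xr] := leP `|x| r.
    by rewrite cutoff1// mulr1 addrC Hm.
  by rewrite fr// addr_ge0// mulr_ge0 ?cutoff_ge0// ltW.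
rewrite L_lin// addrC lerD ?Lh// /d mulrAC ler_pdivrMr//.
by rewrite ler_pM2l// lerDl.
Qed.

Lemma Lmeasure_locally_finite : locally_finite Lmeasure.
Proof.
move=> A /compact_norm_bounded[r r0 Ar].
by apply: le_lt_trans (outer_bounded r0 Ar) _; rewrite ltry.
Qed.

Lemma measurable_test f : continuous f ->
  measurable_fun [set: borel_space R n] (f : borel_space R n -> R).
Proof.
move=> cf; apply: (measurability _ (RGenOInfty.measurableE R)).
move=> _ [_ [t ->] <-]; rewrite setTI; apply: sub_sigma_algebra.
rewrite (_ : _ @^-1` _ = f @^-1` [set y | t < y]).
  by apply: open_comp => // x _; exact: cf.
by apply/seteqP; split=> x /=; rewrite in_itv/= andbT.
Qed.

Lemma measurable_superlevel f t : continuous f ->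
  measurable ([set x | t < f x] : set (borel_space R n)).
Proof.
move=> cf; apply: sub_sigma_algebra.
rewrite (_ : [set _ | _] = f @^-1` [set y | t < y])//.
by apply: open_comp => // x _; exact: cf.
Qed.

(** The lower layer-cake sum of step [d]. The second bound carries the induction: it is what
    controls the sum when a new layer is added. *)
Lemma layers_le (s d : R) (M : nat) : 0 <= s -> 0 < d ->
  \sum_(k < M) d * (k.+1%:R * d < s)%R%:R <= s /\
  \sum_(k < M) d * (k.+1%:R * d < s)%R%:R <= M%:R * d.
Proof.
move=> s0 d0; elim: M => [|M [IH1 IH2]]; first by rewrite big_ord0 mul0r.
rewrite big_ord_recr/=.
have h' : M.+1%:R * d = M%:R * d + d by rewrite -addn1 natrD mulrDl mul1r.
have [h|h] := ltP (M.+1%:R * d) s; rewrite h' in h *.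
  by rewrite mulr1; split; lra.
by rewrite mulr0 addr0; split; lra.
Qed.

Lemma le_layers (s d : R) (M : nat) : 0 <= s -> 0 < d ->
  (s <= M%:R * d -> s <= \sum_(k < M) d * (k%:R * d < s)%R%:R) /\
  (M%:R * d <= s -> M%:R * d <= \sum_(k < M) d * (k%:R * d < s)%R%:R).
Proof.
move=> s0 d0; elim: M => [|M [IH1 IH2]]; first by rewrite big_ord0 mul0r.
rewrite big_ord_recr/=.
have h' : M.+1%:R * d = M%:R * d + d by rewrite -addn1 natrD mulrDl mul1r.
have [h|h] := ltP (M%:R * d) s; rewrite h'.
  by rewrite mulr1; have IH := IH2 (ltW h); split=> ?; lra.
by rewrite mulr0 addr0; have IH := IH1 h; split=> ?; lra.
Qed.

Lemma layer_stp (s d : R) (k : nat) : 0 < d ->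
  (k.+1%:R * d < s)%R%:R <= stp ((s - k%:R * d) / d) <= (k%:R * d < s)%R%:R.
Proof.
move=> d0; have h' : k.+1%:R * d = k%:R * d + d by rewrite -addn1 natrD mulrDl mul1r.
apply/andP; split.
  case: ltP => [h|_]; last exact: stp_ge0.
  by rewrite stp_ge1// ler_pdivlMr// mul1r; lra.
case: ltP => [_|h]; first exact: stp_le1.
by rewrite stp_le0// pmulr_lle0 ?invr_gt0// subr_le0.
Qed.

(** Layer-cake comparison. The smooth layers [eta k] lie between the indicators of consecutive
    superlevel sets, so [L (eta k)] lies between their measures. Smoothing [f] and shifting the
    layers by one each cost at most d X, with X the mass of a cutoff equal to 1 where [f] lives, and
    d is arbitrary. *)
Lemma Lmeasure_integral_ge0 f : test_function f -> (forall x, 0 <= f x) ->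
  (\int[Lmeasure]_x (f x)%:E = (L f)%:E)%E.
Proof.
move=> tf f0; have /test_functionP[sf [r r0 fr]] := tf.
have cf := smooth_cont sf.
have tc := @test_cutoff R n r r0; set X := L (@cutoff R n r).
have X0 : 0 <= X by apply: L_pos => // x; exact: cutoff_ge0.
have [C C0 fC] := test_bounded tf.
have key (d : R) : 0 < d -> ((L f - (d * X + d * X))%:E <= \int[Lmeasure]_x (f x)%:E)%E /\
    (\int[Lmeasure]_x (f x)%:E <= (L f + (d * X + d * X))%:E)%E.
  move=> d0; pose M := Num.bound (C / d).
  have MC : C <= M%:R * d.
    have := archi_boundP (divr_ge0 (ltW C0) (ltW d0)).
    by rewrite ltr_pdivrMr// => /ltW.
  have fM x : f x <= M%:R * d.
    by rewrite (le_trans (ler_norm _))// (le_trans (fC x)).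
  pose A (k : nat) : set V := [set x | k%:R * d < f x].
  have mA k : measurable (A k : set (borel_space R n)) by exact: measurable_superlevel.
  have Abd k : (outer (A k) <= X%:E)%E.
    apply: outer_bounded => // x; rewrite /A/= => kx; rewrite leNgt; apply/negP => /fr fx.
    by move: kx; rewrite fx ltNge mulr_ge0// ltW.
  have Afin k : outer (A k) \is a fin_num.
    by rewrite ge0_fin_numE ?outer_ge0//; apply: le_lt_trans (Abd k) _; rewrite ltry.
  pose a k := fine (outer (A k)).
  have a0 k : 0 <= a k by rewrite fine_ge0// outer_ge0.
  have aX k : a k <= X by rewrite -lee_fin (fineK (Afin k)).
  pose eta (k : nat) x := stp ((f x - k%:R * d) / d).
  have teta k : test_function (eta k).
    apply/test_functionP; split.
      apply: smooth_stp; apply: smoothM; last exact: smooth_cst.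
      exact: smoothB (test_smooth tf) (smooth_cst _).
    exists r => // x /fr fx; rewrite /eta fx stp_le0// pmulr_lle0 ?invr_gt0//.
    by rewrite sub0r oppr_le0 mulr_ge0// ltW.
  have etaA k : a k.+1 <= L (eta k) <= a k.
    rewrite -!lee_fin !(fineK (Afin _)); apply/andP; split.
      apply: outer_le_test => // x; first exact: stp_ge0.
      rewrite /A/= => kx; have /andP[+ _] := layer_stp (f x) k d0.
      by rewrite kx.
    apply: test_le_outer => // x; first exact: stp_le1.
    rewrite /A/= => ex; have /andP[_] := layer_stp (f x) k d0.
    case: ltP => // _; rewrite -/(eta k x) => ele.
    by move: ex; rewrite eq_le ele stp_ge0.
  have tsum : test_function (fun x => \sum_(k < M) d * eta k x).
    by apply: test_sum => k _; exact: testZ.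
  have Lsum : L (fun x => \sum_(k < M) d * eta k x) = \sum_(k < M) d * L (eta k).
    rewrite L_sum => [|k]; last exact: testZ.
    by apply: eq_bigr => k _; rewrite L_Z.
  have S1 x : \sum_(k < M) d * (k.+1%:R * d < f x)%R%:R <= f x.
    by have [] := layers_le M (f0 x) d0.
  have S0 x : f x <= \sum_(k < M) d * (k%:R * d < f x)%R%:R.
    by have [/(_ (fM x))] := le_layers M (f0 x) d0.
  (* Shifting every layer by one changes the sum only by the end terms of a telescoping sum, so the
     loss is at most [d * u 0]. *)
  have tele (u : nat -> R) : (forall k, 0 <= u k) ->
      \sum_(k < M) d * u k <= \sum_(k < M) d * u k.+1 + d * u 0%N.
    move=> u0; suff -> : \sum_(k < M) d * u k.+1 + d * u 0%N = \sum_(k < M) d * u k + d * u M.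
      by rewrite lerDl mulr_ge0// ltW.
    transitivity (\sum_(k < M.+1) d * u k); last by rewrite big_ord_recr.
    by rewrite [RHS]big_ord_recl addrC; congr (_ + _); apply: eq_bigr => k _.
  have Lf : `|L f - \sum_(k < M) d * L (eta k)| <= d * X.
    have tX : test_function (fun x => d * @cutoff R n r x) by exact: testZ.
    have fe x : `|f x - \sum_(k < M) d * eta k x| <= d * cutoff r x.
      have [xr|xr] := leP `|x| r; last first.
        rewrite fr// big1 ?subrr ?normr0 ?mulr_ge0 ?cutoff_ge0 ?ltW// => k _.
        by rewrite /eta fr// stp_le0 ?mulr0// pmulr_lle0 ?invr_gt0// sub0r oppr_le0 mulr_ge0// ltW.
      have e1 : \sum_(k < M) d * (k.+1%:R * d < f x)%R%:R <= \sum_(k < M) d * eta k x.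
        by apply: ler_sum => k _; rewrite ler_pM2l//; have /andP[] := layer_stp (f x) k d0.
      have e2 : \sum_(k < M) d * eta k x <= \sum_(k < M) d * (k%:R * d < f x)%R%:R.
        by apply: ler_sum => k _; rewrite ler_pM2l//; have /andP[] := layer_stp (f x) k d0.
      have e3 : \sum_(k < M) d * (k%:R * d < f x)%R%:R <=
          \sum_(k < M) d * (k.+1%:R * d < f x)%R%:R + d.
        apply: le_trans (tele (fun k => (k%:R * d < f x)%R%:R) _) _ => //.
        by rewrite lerD2l ger_pMr// lern1; case: (_ < _).
      rewrite cutoff1// mulr1 ler_norml; have := S1 x; have := S0 x.
      by move=> h1 h2; apply/andP; split; lra.
    rewrite -Lsum -L_B// -L_Z// ler_norml -mulN1r -(L_Z (-1))//; apply/andP; split.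
      apply: L_le => [||x]; [exact: testZ|exact: testB|].
      by rewrite mulN1r; have := fe x; rewrite ler_norml => /andP[].
    apply: L_le => [||x]; [exact: testB|exact: tX|].
    by have := fe x; rewrite ler_norml => /andP[].
  have intA (b : nat -> nat) :
      (\int[Lmeasure]_x (\sum_(k < M) d * ((b k)%:R * d < f x)%R%:R)%:E =
       (\sum_(k < M) d * a (b k))%:E)%E.
    have E x : ((\sum_(k < M) d * ((b k)%:R * d < f x)%R%:R)%:E =
        \sum_(k < M) (d%:E * (\1_(A (b k)) x)%:E))%E.
      rewrite -sumEFin; apply: eq_bigr => k _; rewrite EFinM indicE; congr (_ * ((nat_of_bool _)%:R)%:E)%E.
      by apply/idP/idP; rewrite /A inE.
    under eq_integral do rewrite E.
    have mi k : measurable_fun [set: borel_space R n] (fun x => (\1_(A (b k)) x)%:E : \bar R).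
      by apply/measurable_EFinP; exact: measurable_indic.
    rewrite ge0_integral_sum//; first last.
    - by move=> k x _; rewrite mule_ge0 ?lee_fin// ltW.
    - by move=> k; apply: measurable_funeM.
    rewrite -sumEFin; apply: eq_bigr => k _.
    rewrite ge0_integralZl_EFin ?ltW// integral_indic// setIT EFinM.
    by rewrite /a fineK.
  have mf : measurable_fun [set: borel_space R n] (fun x => (f x)%:E : \bar R).
    by apply/measurable_EFinP; exact: measurable_test.
  have mS (b : nat -> nat) : measurable_fun [set: borel_space R n]
      (fun x => (\sum_(k < M) d * ((b k)%:R * d < f x)%R%:R)%:E : \bar R).
    apply/measurable_EFinP; apply: measurable_sum => k; apply: measurable_funM => //.
    rewrite (_ : (fun _ => _) = \1_(A (b k))); first exact: measurable_indic.
    apply/funext => x; rewrite indicE; congr ((nat_of_bool _)%:R).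
    by apply/idP/idP; rewrite /A inE.
  have I1 : ((\sum_(k < M) d * a k.+1)%:E <= \int[Lmeasure]_x (f x)%:E)%E.
    rewrite -(intA S); apply: ge0_le_integral => //.
    - by move=> x _; rewrite lee_fin; apply: sumr_ge0 => k _; rewrite mulr_ge0// ltW.
    - by move=> x _; rewrite lee_fin.
  have I0 : (\int[Lmeasure]_x (f x)%:E <= (\sum_(k < M) d * a k)%:E)%E.
    rewrite -(intA id); apply: ge0_le_integral => //.
    - by move=> x _; rewrite lee_fin.
    - exact (mS id).
    - by move=> x _; rewrite lee_fin.
  have T := tele a a0; have aX' : d * a 0%N <= d * X by rewrite ler_pM2l.
  have e1 : \sum_(k < M) d * a k.+1 <= \sum_(k < M) d * L (eta k).
    by apply: ler_sum => k _; rewrite ler_pM2l//; have /andP[] := etaA k.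
  have e2 : \sum_(k < M) d * L (eta k) <= \sum_(k < M) d * a k.
    by apply: ler_sum => k _; rewrite ler_pM2l//; have /andP[] := etaA k.
  move: Lf; rewrite ler_norml => /andP[l1 l2]; split.
    by apply: le_trans I1; rewrite lee_fin; lra.
  by apply: le_trans I0 _; rewrite lee_fin; lra.
have fin : (\int[Lmeasure]_x (f x)%:E)%E \is a fin_num.
  rewrite ge0_fin_numE; last by apply: integral_ge0 => x _; rewrite lee_fin.
  by have [_ /le_lt_trans] := key 1 ltr01; apply; rewrite ltry.
rewrite -(fineK fin); congr (_%:E).
have X2 : 0 < X + X + 1 by rewrite ltr_wpDl ?addr_ge0.
apply/eqP; rewrite eq_le; apply/andP; split; apply/ler_addgt0Pr => e e0.
  have [_] := key (e / (X + X + 1)) (divr_gt0 e0 X2); rewrite -{1}(fineK fin) lee_fin => /le_trans; apply.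
  rewrite lerD2l -mulrDr mulrAC ler_pdivrMr// ler_pM2l//; lra.
have [+ _] := key (e / (X + X + 1)) (divr_gt0 e0 X2); rewrite -{1}(fineK fin) lee_fin lerBlDr.
move=> /le_trans; apply; rewrite lerD2l -mulrDr mulrAC ler_pdivrMr// ler_pM2l//; lra.
Qed.

Lemma Lmeasure_integral f : test_function f -> \int[Lmeasure]_x f x = L f.
Proof.
move=> tf; have /test_functionP[sf [r r0 fr]] := tf.
have [C C0 fC] := test_bounded tf.
have tc := @test_cutoff R n r r0.
(* f = g - h with two nonnegative test functions; the positive part of [f] need not be smooth. *)
pose g x := C * @cutoff R n r x; pose h x := g x - f x.
have tg : test_function g by exact: testZ.
have th : test_function h by exact: testB.
have g0 x : 0 <= g x by rewrite mulr_ge0 ?cutoff_ge0// ltW.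
have h0 x : 0 <= h x.
  rewrite /h /g subr_ge0; have [xr|/fr->] := leP `|x| r; last first.
    by rewrite mulr_ge0 ?cutoff_ge0// ltW.
  by rewrite cutoff1// mulr1 (le_trans (ler_norm _)).
have int (u : V -> R) : test_function u -> (forall x, 0 <= u x) ->
    Lmeasure.-integrable [set: borel_space R n] (EFin \o u).
  move=> tu u0; apply/integrableP; split.
    by apply/measurable_EFinP; apply: measurable_test; apply: smooth_cont; case: tu.
  under eq_integral do rewrite /= ger0_norm//.
  by rewrite Lmeasure_integral_ge0// ltry.
have -> : L f = L g - L h.
  by rewrite -L_B//; congr L; apply/funext => x; rewrite /h opprB addrC subrK.
rewrite (_ : (fun x => _) = (fun x => g x - h x)); last first.
  by apply/funext => x; rewrite /h opprB addrC subrK.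
rewrite RintegralB//; try exact: int.
by rewrite /Rintegral !Lmeasure_integral_ge0.
Qed.

End Riesz.

Lemma riesz_representation (R : realType) (n : nat) (L : ('rV[R]_n -> R) -> R) :
  (forall (c : R) f g, test_function f -> test_function g ->
    L (fun x => c * f x + g x) = c * L f + L g) ->
  (forall f, test_function f -> (forall x, 0 <= f x) -> 0 <= L f) ->
  exists2 mu : {measure set (@borel_space R n) -> \bar R}, locally_finite mu &
    forall f, test_function f -> L f = \int[mu]_x f x.
Proof.
move=> L_lin L_pos; exists (Lmeasure L_lin L_pos).
  exact: Lmeasure_locally_finite.
by move=> f tf; rewrite Lmeasure_integral.
Qed.

(** * Convex functions *)

Section Convex.
Variables (R : realType) (n : nat).
Notation V := 'rV[R]_n.
Implicit Types (psi phi : V -> R) (x y v w : V) (r t : R).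

Lemma near_norm_lt x (d : R) : 0 < d -> \forall y \near x, `|x - y| < d.
Proof.
move=> d0.
have : nbhs_ball_ (ball_ (fun y : V => `|y|)) x [set y | `|x - y| < d] by exists d.
by move=> /nbhs_normP.
Qed.

Lemma cvg_rowP psi x : (forall e, 0 < e -> \forall y \near x, `|psi x - psi y| <= e) ->
  psi y @[y --> x] --> psi x.
Proof.
by move=> H; apply: (proj2 (@cvgrPdist_le _ _ _ (nbhs x) (nbhs_filter x) psi (psi x))).
Qed.

Lemma convexP psi : convex psi <-> forall t x y, 0 <= t -> t <= 1 ->
  psi (t *: x + (1 - t) *: y) <= t * psi x + (1 - t) * psi y.
Proof.
split=> [H t x y t0 t1|H t x y _ _]; last exact: H.
by have := H (Itv01 t0 t1) x y; apply; rewrite inE.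
Qed.

Lemma convexP2 psi : convex psi -> forall (a b : R) x y, 0 <= a -> 0 <= b -> 0 < a + b ->
  (a + b) * psi ((a + b)^-1 *: (a *: x + b *: y)) <= a * psi x + b * psi y.
Proof.
move=> /convexP H a b x y a0 b0 ab.
have abn := lt0r_neq0 ab.
have := H (a / (a + b)) x y; rewrite divr_ge0 ?(ltW ab)// ler_pdivrMr// mul1r lerDl b0.
have -> : 1 - a / (a + b) = b / (a + b) by field.
move=> /(_ isT isT); rewrite -(ler_pM2l ab) => h; apply: le_trans (le_trans _ h) _.
  by rewrite scalerDr !scalerA ![_^-1 * _]mulrC.
by rewrite le_eqVlt; apply/orP; left; apply/eqP; field.
Qed.

(** Induction on the number of coordinates allowed to be nonzero: x is the midpoint of twice its
    first m coordinates and twice the next one. The radius doubles at each step, and each axis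
    contributes the values at two of its points. *)
Lemma convex_bounded_above psi r : convex psi ->
  exists B, forall x, `|x| <= r -> psi x <= B.
Proof.
move=> /convexP cp.
suff H (m : nat) : forall s : R, exists B, forall x, `|x| <= s ->
    (forall j : 'I_n, (m <= j)%N -> x 0 j = 0) -> psi x <= B.
  have [B HB] := H n r; exists B => x xr; apply: HB => // j.
  by rewrite leqNgt ltn_ord.
elim: m => [|m IH] s.
  by exists (psi 0) => x _ H; rewrite (_ : x = 0)//; apply/rowP => j; rewrite mxE H.
have [nm|mn] := leqP n m.
  have [B HB] := IH s; exists B => x xs _; apply: HB => // j mj.
  by have := leq_trans (ltn_ord j) (leq_trans nm mj); rewrite ltnn.
have [B HB] := IH (2 * s).
pose e : V := delta_mx 0 (Ordinal mn).
pose C := Num.max (psi ((2 * s) *: e)) (psi (- (2 * s) *: e)).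
exists (2^-1 * B + 2^-1 * C) => x xs H.
have s0 : 0 <= s := le_trans (normr_ge0 _) xs.
pose x' : V := \row_j (if (j < m)%N then 2 * x 0 j else 0).
pose u := 2 * x 0 (Ordinal mn).
have us : `|u| <= 2 * s.
  by rewrite normrM ger0_norm// ler_pM2l// (le_trans (norm_coord_le _ _)).
have -> : x = 2^-1 *: x' + (1 - 2^-1) *: (u *: e).
  apply/rowP => j; rewrite !mxE eqxx/= -val_eqE/=.
  case: ltngtP => jm; rewrite /u ?mulr0 ?mulr1 ?addr0 ?add0r.
  - by rewrite mulKf.
  - by rewrite H.
  - have -> : j = Ordinal mn by exact/val_inj.
    by field.
apply: (le_trans (cp _ _ _ _ _)) => //; first by rewrite invf_le1// ler1n.
have -> : 1 - 2^-1 = 2^-1 :> R by field.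
apply: lerD; rewrite ler_pM2l//.
  apply: HB; last by move=> j mj; rewrite mxE ltnNge mj.
  apply: norm_row_le; first by rewrite mulr_ge0.
  move=> j; rewrite mxE; case: ifP => _; last by rewrite normr0 mulr_ge0.
  by rewrite normrM ger0_norm// ler_pM2l// (le_trans (norm_coord_le _ _)).
have [s00|s00] := eqVneq s 0.
  have -> : u = 2 * s.
    by apply/eqP; rewrite s00 mulr0 -normr_le0; move: us; rewrite s00 mulr0.
  by rewrite /C le_max lexx.
have sp : 0 < s by rewrite lt_neqAle eq_sym s00.
(* The position of [u] on the segment from -2s to 2s. *)
pose t := (u + 2 * s) / (4 * s).
have [t0 t1] : 0 <= t /\ t <= 1.
  move: us; rewrite ler_norml => /andP[u1 u2]; split.
    by apply: divr_ge0; lra.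
  by rewrite ler_pdivrMr; lra.
have -> : u *: e = t *: ((2 * s) *: e) + (1 - t) *: (- (2 * s) *: e).
  by rewrite !scalerA -scalerDl; congr (_ *: _); rewrite /t; field.
apply: (le_trans (cp _ _ _ t0 t1)).
have C1 : psi ((2 * s) *: e) <= C by rewrite /C le_max lexx.
have C2 : psi (- (2 * s) *: e) <= C by rewrite /C le_max lexx orbT.
have := ler_wpM2l t0 C1; have : 0 <= 1 - t by lra.
by move=> t1'; have := ler_wpM2l t1' C2; lra.
Qed.

(** A local upper bound suffices. For |v| <= t <= 1, x + v lies between x and x + v / t, which
    bounds psi(x + v) from above, and x lies between x + v and x - v / t, which bounds it from
    below. *)
Lemma convex_continuous_at psi x : convex psi -> psi y @[y --> x] --> psi x.
Proof.
move=> cp.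
have [B0 HB0] := @convex_bounded_above psi (`|x| + 1) cp.
(* The maximum forces B > psi x, so that the error can be divided by B - psi x. *)
pose B := Num.max B0 (psi x + 1).
have HB y : `|y| <= `|x| + 1 -> psi y <= B by move=> /HB0 h; rewrite /B le_max h.
have Bx : 0 < B - psi x by rewrite subr_gt0 /B lt_max ltrDl ltr01 orbT.
have key v t : 0 < t -> t <= 1 -> `|v| <= t -> `|psi (x + v) - psi x| <= t * (B - psi x).
  move=> t0 t1 vt.
  have tvx : `|t^-1 *: v| <= 1.
    by rewrite normrZ ger0_norm ?invr_ge0 ?(ltW t0)// mulrC ler_pdivrMr// mul1r.
  have b1 : psi (x + t^-1 *: v) <= B.
    by apply: HB; apply: (le_trans (ler_normD _ _)); rewrite lerD2l.
  have b2 : psi (x - t^-1 *: v) <= B.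
    by apply: HB; apply: (le_trans (ler_normB _ _)); rewrite lerD2l.
  have t't : 0 <= 1 - t by rewrite subr_ge0.
  have h1 := convexP2 cp x (x + t^-1 *: v) t't (ltW t0).
  have h2 := convexP2 cp (x + v) (x - t^-1 *: v) ler01 (ltW t0).
  move: h1 h2; rewrite subrK invr1 scale1r => /(_ ltr01) h1 h2.
  have t2 : 0 < 1 + t by rewrite addr_gt0.
  have E1 : (1 - t) *: x + t *: (x + t^-1 *: v) = x + v.
    by rewrite scalerDr addrA -scalerDl subrK scale1r scalerA divff ?lt0r_neq0// scale1r.
  have E2 : (1 + t)^-1 *: (1 *: (x + v) + t *: (x - t^-1 *: v)) = x.
    rewrite scalerBr scalerA divff ?lt0r_neq0// !scale1r addrACA subrr addr0.
    have -> : x + t *: x = (1 + t) *: x by rewrite scalerDl scale1r.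
    by rewrite scalerA mulVf ?lt0r_neq0// scale1r.
  move: h1 (h2 t2); rewrite E1 E2 => h1 {}h2.
  have := ler_wpM2l (ltW t0) b1; have := ler_wpM2l (ltW t0) b2 => b2' b1'.
  by rewrite ler_norml; apply/andP; split; lra.
apply: cvg_rowP => e e0.
pose d := Num.min 1 (e / (B - psi x)).
have d0 : 0 < d by rewrite lt_min ltr01/= divr_gt0.
apply: filterS (near_norm_lt x d0) => y; rewrite distrC => yd.
have d1 : d <= 1 by rewrite ge_min lexx.
have := key (y - x) d d0 d1 (ltW yd); rewrite (addrC x) subrK distrC => h.
apply: (le_trans h); by rewrite -ler_pdivlMr// ge_min lexx orbT.
Qed.

Lemma convex_continuous psi : convex psi -> continuous psi.
Proof. by move=> cp x; exact: convex_continuous_at. Qed.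

Definition dotv w v : R := \sum_j w 0 j * v 0 j.

(* Hahn-Banach, one coordinate at a time. *)
Lemma convex_subgradient psi x : convex psi ->
  exists w, forall y, psi x + dotv w (y - x) <= psi y.
Proof.
move=> cp0.
pose phi v := psi (x + v) - psi x.
have cp : convex phi.
  apply/convexP => t v1 v2 t0 t1; have /convexP H := cp0.
  have := H t (x + v1) (x + v2) t0 t1.
  have -> : t *: (x + v1) + (1 - t) *: (x + v2) = x + (t *: v1 + (1 - t) *: v2).
    by rewrite !scalerDr addrACA -scalerDl (_ : t + (1 - t) = 1) ?scale1r//; ring.
  by rewrite /phi; lra.
have phi0 : phi 0 = 0 by rewrite /phi addr0 subrr.
pose inV (m : nat) v := forall j : 'I_n, (m <= j)%N -> v 0 j = 0.
suff H m : exists w, forall v, inV m v -> dotv w v <= phi v.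
  have [w Hw] := H n; exists w => y.
  have := Hw (y - x); rewrite /phi (addrC x) subrK => h.
  rewrite -lerBrDl; apply: h => j; by rewrite leqNgt ltn_ord.
elim: m => [|m [w Hw]].
  exists 0 => v v0; have -> : v = 0 by apply/rowP => j; rewrite mxE v0.
  by rewrite phi0 /dotv big1// => j _; rewrite mxE mul0r.
have [nm|mn] := leqP n m.
  exists w => v _; apply: Hw => j mj.
  by have := leq_trans (ltn_ord j) (leq_trans nm mj); rewrite ltnn.
pose jm := Ordinal mn; pose e : V := delta_mx 0 jm.
have dotD u v : dotv w (u + v) = dotv w u + dotv w v.
  by rewrite /dotv -big_split; apply: eq_bigr => j _; rewrite mxE mulrDr.
have dotZ c v : dotv w (c *: v) = c * dotv w v.
  by rewrite /dotv mulr_sumr; apply: eq_bigr => j _; rewrite mxE mulrCA.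
(* Slopes required from below never exceed those allowed from above: the segment from [u - s e] to
   [v + t e] meets the subspace [inV m], where the functional is already dominated. Any value in
   between, here [sup E], extends it. *)
have key s t u v : 0 < s -> 0 < t -> inV m u -> inV m v ->
    (dotv w u - phi (u - s *: e)) / s <= (phi (v + t *: e) - dotv w v) / t.
  move=> s0 t0 mu mv; have st := addr_gt0 t0 s0.
  have := convexP2 cp (u - s *: e) (v + t *: e) (ltW t0) (ltW s0) st.
  have -> : t *: (u - s *: e) + s *: (v + t *: e) = t *: u + s *: v.
    by rewrite scalerBr scalerDr !scalerA (mulrC s t) addrA addrAC subrK.
  have mz : inV m ((t + s)^-1 *: (t *: u + s *: v)).
    by move=> j mj; rewrite !mxE mu// mv// !mulr0 addr0 mulr0.
  have h := Hw _ mz; rewrite dotZ dotD !dotZ ler_pdivrMl// in h; move=> h'.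
  rewrite ler_pdivrMr// mulrAC ler_pdivlMr//.
  have := le_trans h h'; lra.
pose E := [set z | exists s u, [/\ 0 < s, inV m u & z = (dotv w u - phi (u - s *: e)) / s]].
have V0 : inV m 0 by move=> j _; rewrite mxE.
have supE : has_sup E.
  split; first by exists ((dotv w 0 - phi (0 - 1 *: e)) / 1); exists 1, 0; split.
  exists ((phi (0 + 1 *: e) - dotv w 0) / 1) => _ [s [u [s0 mu ->]]].
  exact: key.
exists (\row_j (if j == jm then sup E else w 0 j)) => v mv.
pose t := v 0 jm; pose v' : V := v - t *: e.
have mv' : inV m v'.
  move=> j mj; rewrite !mxE eqxx/=; have [->|jn] := eqVneq j jm; first by rewrite mulr1 subrr.
  rewrite mulr0 subr0 mv// ltn_neqAle mj andbT; apply: contra jn => /eqP mj'.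
  exact/eqP/val_inj.
have vE : v = v' + t *: e by rewrite subrK.
have -> : dotv (\row_j (if j == jm then sup E else w 0 j)) v = dotv w v' + t * sup E.
  rewrite /dotv (bigD1 jm)//= [in RHS](bigD1 jm)//= !mxE !eqxx mulr1 subrr mulr0 add0r.
  rewrite addrC mulrC; congr (_ + _); apply: eq_bigr => j jn.
  by rewrite !mxE (negbTE jn) mulr0 subr0.
rewrite vE; have [t0|t0|t0] := ltgtP t 0.
- have : (dotv w v' - phi (v' - (- t) *: e)) / (- t) <= sup E.
    by apply: sup_upper_bound => //; exists (- t), v'; rewrite oppr_gt0.
  by rewrite ler_pdivrMr ?oppr_gt0// scaleNr opprK; lra.
- have : sup E <= (phi (v' + t *: e) - dotv w v') / t.
    by apply: ge_sup; [exact: supE.1|move=> _ [s [u [s0 mu ->]]]; exact: key].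
  by rewrite ler_pdivlMr//; lra.
- by rewrite t0 mul0r scale0r !addr0; exact: Hw.
Qed.

Lemma ler_convex_expR (t a b : R) : 0 <= t -> t <= 1 ->
  expR (t * a + (1 - t) * b) <= t * expR a + (1 - t) * expR b.
Proof. by move=> t0 t1; exact: (convex_expR (Itv01 t0 t1) a b). Qed.

Lemma sum_conv (T : Type) (s : seq T) t (E1 E2 : T -> R) :
  \sum_(x <- s) (t * E1 x + (1 - t) * E2 x) =
  t * \sum_(x <- s) E1 x + (1 - t) * \sum_(x <- s) E2 x.
Proof. by rewrite big_split !mulr_sumr. Qed.

(* A convex function is locally uniformly a maximum of finitely many of its
   tangents, and the maximum is smoothed by log-sum-exp. *)
Lemma convex_approx psi r (eps : R) : convex psi -> 0 < eps ->
  exists phi, [/\ smooth phi, convex phi & forall x, `|x| <= r -> `|phi x - psi x| <= eps].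
Proof.
move=> cp e0.
have [w Hw] := choice (fun x => convex_subgradient x cp).
pose g x y := psi x + dotv (w x) (y - x).
have gcont x : continuous (g x).
  apply: smooth_cont; apply: smoothD; first exact: smooth_cst.
  apply: smooth_sum => j _; apply: smoothM; first exact: smooth_cst.
  rewrite (_ : (fun _ => _) = fun y => y 0 j - x 0 j); last by apply/funext => y; rewrite !mxE.
  by apply: smoothB; [exact: smooth_coord|exact: smooth_cst].
(* For r < 0 the ball is empty and the finite subcover may be empty too, which would leave an empty
   sum under the logarithm. *)
have [r0|r0] := ltP r 0.
  exists (fun=> 0); split; first exact: smooth_cst.
    by apply/convexP => *; rewrite !mulr0 addr0.
  by move=> x xr; have := le_lt_trans (le_trans (normr_ge0 x) xr) r0; rewrite ltxx.
have e2 : 0 < eps / 2 by rewrite divr_gt0.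
have := @compact_ball R n r; rewrite compact_cover.
move=> /(_ _ setT (fun x => [set y | psi y - g x y < eps / 2])) [x _|x xr|D _ HD].
- have cs : continuous (fun y => psi y - g x y).
    by move=> y; apply: continuousB; [exact: convex_continuous|exact: gcont].
  rewrite (_ : [set _ | _] = (fun y => psi y - g x y) @^-1` [set z | z < eps / 2])//.
  by apply: open_comp => // y _; exact: cs.
- exists x => //=; rewrite /g subrr /dotv big1 ?addr0 ?subrr// => j _.
  by rewrite mxE mulr0.
pose s := finmap.enum_fset D.
have Hs y : `|y| <= r -> exists2 x, x \in s & psi y - g x y < eps / 2.
  by move=> /HD[x xD /= h]; exists x.
have s0 : (0 < size s)%N.
  by have [|x xs _] := Hs 0; [rewrite normr0|case: (s) xs].
(* Log-sum-exp of N tangents exceeds their maximum by at most (ln N) / c, which this [c] makes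
   smaller than eps; the added 1 keeps [c] positive when N = 1. *)
pose c : R := (ln (size s)%:R + 1) / eps.
have N1 : 1 <= (size s)%:R :> R by rewrite ler1n.
have lnN : 0 <= ln (size s)%:R :> R by rewrite ln_ge0.
have c0 : 0 < c by rewrite divr_gt0// ltr_wpDl.
pose F y := \sum_(x <- s) expR (c * g x y).
have F0 y : 0 < F y.
  rewrite /F; case: (s) s0 => // x s' _; rewrite big_cons ltr_pwDl ?expR_gt0//.
  by apply: sumr_ge0 => z _; exact: expR_ge0.
pose phi y := c^-1 * ln (F y).
have cn := lt0r_neq0 c0.
have gsm x : smooth (g x).
  apply: smoothD; first exact: smooth_cst.
  apply: smooth_sum => j _; apply: smoothM; first exact: smooth_cst.
  rewrite (_ : (fun _ => _) = fun y => y 0 j - x 0 j); last by apply/funext => y; rewrite !mxE.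
  by apply: smoothB; [exact: smooth_coord|exact: smooth_cst].
exists phi; split.
- apply: smoothM; first exact: smooth_cst.
  apply: smooth_ln => //; apply: smooth_sum => x _; apply: smooth_exp.
  by apply: smoothM; [exact: smooth_cst|exact: gsm].
- apply/convexP => t y1 y2 t0 t1; set z := t *: y1 + (1 - t) *: y2.
  have gz x : g x z = t * g x y1 + (1 - t) * g x y2.
    rewrite /g /z [RHS](_ : _ = psi x + (t * dotv (w x) (y1 - x) +
        (1 - t) * dotv (w x) (y2 - x))); last by ring.
    congr (_ + _); rewrite /dotv !mulr_sumr -big_split; apply: eq_bigr => j _ /=.
    by rewrite !mxE; ring.
  have phiE y : c * phi y = ln (F y) by rewrite mulVKf.
  rewrite -(ler_pM2l c0) mulrDr (mulrCA c t) (mulrCA c (1 - t)) (phiE z) (phiE y1) (phiE y2).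
  have lnE y : expR (ln (F y)) = F y by rewrite lnK// posrE.
  rewrite -ler_expR lnE -[leRHS]mulr1.
  set A := ln (F y1) in lnE *; set B := ln (F y2).
  rewrite -ler_pdivrMl ?expR_gt0// -expRN.
  (* Convexity of log-sum-exp: after division by F(y1)^t F(y2)^(1-t), every summand is the
     exponential of a convex combination, and the exponentials at y1 and at y2 are normalized to
     have sum 1. *)
  have -> : expR (- (t * A + (1 - t) * B)) * F z =
      \sum_(x <- s) expR (t * (c * g x y1 - A) + (1 - t) * (c * g x y2 - B)).
    rewrite /F mulr_sumr; apply: eq_bigr => x _; rewrite -expRD gz; congr expR; ring.
  have H1 y : \sum_(x <- s) expR (c * g x y - ln (F y)) = 1.
    rewrite -[RHS](divff (lt0r_neq0 (F0 y))) /F -/(F y) mulr_suml; apply: eq_bigr => x _.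
    by rewrite expRD expRN lnK// posrE.
  apply: (@le_trans _ _ (\sum_(x <- s) (t * expR (c * g x y1 - A) +
      (1 - t) * expR (c * g x y2 - B)))).
    by apply: ler_sum => x _; exact: ler_convex_expR.
  have hA : \sum_(x <- s) expR (c * g x y1 - A) = 1 := H1 y1.
  have hB : \sum_(x <- s) expR (c * g x y2 - B) = 1 := H1 y2.
  have E1 : t * 1 + (1 - t) * 1 = 1 by ring.
  rewrite le_eqVlt; apply/orP; left; apply/eqP; apply: etrans E1.
  exact: etrans (sum_conv s t _ _) (congr2 (fun a b => t * a + (1 - t) * b) hA hB).
- move=> y /Hs[x xs gx].
  have lo : g x y <= phi y.
    rewrite /phi -[leLHS](mulKf cn) ler_pM2l ?invr_gt0//.
    rewrite -[leLHS]expRK ler_ln ?posrE ?expR_gt0//.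
    rewrite /F (big_rem x)//= lerDl; apply: sumr_ge0 => z _; exact: expR_ge0.
  have up : phi y <= psi y + eps.
    have : F y <= (size s)%:R * expR (c * psi y).
      rewrite /F; apply: (@le_trans _ _ (\sum_(x <- s) expR (c * psi y))).
        by apply: ler_sum => z _; rewrite ler_expR ler_pM2l// Hw.
      by rewrite big_const_seq count_predT iter_addr_0 mulr_natl.
    move=> FN; have N0 : 0 < (size s)%:R :> R by rewrite ltr0n.
    have : ln (F y) <= ln ((size s)%:R * expR (c * psi y)).
      by rewrite ler_ln ?posrE// mulr_gt0 ?expR_gt0.
    rewrite lnM ?posrE ?expR_gt0// expRK => h.
    rewrite /phi ler_pdivrMl//; apply: (le_trans h).
    rewrite mulrDr addrC lerD2l /c divfK ?lt0r_neq0// lerDl//.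
  by rewrite ler_norml; apply/andP; split; lra.
Qed.

(** A negative second derivative along [v] at x persists nearby. Then phi(x + s v) + phi(x - s v) is
    smaller at some s > 0 than at s = 0, against midpoint convexity. *)
Lemma hessian_psd phi x v : smooth phi -> convex phi ->
  0 <= \sum_j \sum_k partial j (partial k phi) x * v 0 j * v 0 k.
Proof.
move=> sp cp.
pose F y := \sum_k v 0 k * partial k phi y.
have sF : smooth F.
  by apply: smooth_sum => k _; apply: smoothM; [exact: smooth_cst|exact: smooth_partial].
pose Q y := \sum_j v 0 j * partial j F y.
have sQ : smooth Q.
  by apply: smooth_sum => k _; apply: smoothM; [exact: smooth_cst|exact: smooth_partial].
have -> : \sum_j \sum_k partial j (partial k phi) x * v 0 j * v 0 k = Q x.
  apply: eq_bigr => j _; rewrite /F.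
  have -> : partial j (fun y => \sum_k v 0 k * partial k phi y) =
      fun y => \sum_k v 0 k * partial j (partial k phi) y.
    apply: partialE => y.
    have := @is_derive_sum _ _ _ n (fun k y => v 0 k * partial k phi y) y (delta_mx 0 j)
      (fun k => v 0 k * partial j (partial k phi) y).
    rewrite (_ : \sum_(i < n) _ = fun y => \sum_k v 0 k * partial k phi y); last first.
      by apply/funext => z; rewrite fct_sumE.
    apply => k; apply: is_deriveZ; apply/derivableP.
    by apply: smooth_derivable; exact: smooth_partial.
  by rewrite mulr_sumr; apply: eq_bigr => k _; ring.
have dphi y : is_derive y v phi (F y).
  apply: is_derive_partial => [j z|j]; first exact: smooth_derivable.
  by apply: smooth_cont; exact: smooth_partial.
have dF y : is_derive y v F (Q y).
  apply: is_derive_partial => [j z|j]; first exact: smooth_derivable.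
  by apply: smooth_cont; exact: smooth_partial.
rewrite leNgt; apply/negP => Qx.
have : \forall y \near x, Q y < 0.
  have : {for x, continuous Q} by exact: smooth_cont.
  by move/cvgr_lt; apply.
move=> /nbhs_normP[d /= d0 Qd].
(* The point where the second derivative is evaluated is within 3 e |v| of x; the factor 4 and the
   added 1 keep this strictly below [d], also for v = 0. *)
pose e := d / (4 * (`|v| + 1)).
have v1 : 0 < `|v| + 1 by rewrite ltr_wpDl.
have e0 : 0 < e by rewrite divr_gt0// mulr_gt0.
pose k (s : R) := phi (x + s *: v) + phi (x + s *: (- v)).
have dk s : is_derive s (1 : R) k (F (x + s *: v) - F (x - s *: v)).
  apply: is_deriveD.
    have := @is_derive_line _ _ phi x v s _; rewrite (@derive_val _ _ _ _ _ _ _ (dphi _)); apply.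
    exact: (@ex_derive _ _ _ _ _ _ _ (dphi _)).
  have dN : is_derive (x + s *: (- v)) (- v) phi (- F (x - s *: v)).
    have -> : - F (x - s *: v) = \sum_k (- v) 0 k * partial k phi (x + s *: (- v)).
      rewrite /F -sumrN; apply: eq_bigr => i _.
      by rewrite !mxE mulNr scalerN.
    apply: is_derive_partial => [j z|j]; first exact: smooth_derivable.
    by apply: smooth_cont; exact: smooth_partial.
  have := @is_derive_line _ _ phi x (- v) s _; rewrite (@derive_val _ _ _ _ _ _ _ dN); apply.
  exact: (@ex_derive _ _ _ _ _ _ _ dN).
have ck : continuous k.
  move=> s; apply: differentiable_continuous; apply/derivable1_diffP.
  exact: (@ex_derive _ _ _ _ _ _ _ (dk s)).
have [c] := MVT e0 (fun s _ => dk s) (continuous_subspaceT ck).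
rewrite in_itv/= subr0 => /andP[c0 ce].
have [s sc] := MVT_line (fun y => @ex_derive _ _ _ _ _ _ _ (dF y)) (x - c *: v) (c + c).
rewrite (_ : x - c *: v + (c + c) *: v = x + c *: v); last by rewrite scalerDl addrA subrK.
rewrite (@derive_val _ _ _ _ _ _ _ (dF _)) => -> .
set z := x - c *: v + s *: v => E.
have Qz : Q z < 0.
  apply: Qd => /=; have -> : x - z = (c - s) *: v.
    by rewrite /z scalerBl !opprD opprK !addrA subrr add0r.
  rewrite normrZ; apply: (@le_lt_trans _ _ (3 * e * `|v|)).
    apply: ler_wpM2r => //; apply: (le_trans (ler_normB _ _)).
    have cc : `|c + c| = c + c by rewrite gtr0_norm// addr_gt0.
    have ab : `|c| = c := gtr0_norm c0.
    rewrite ab; move: sc; rewrite cc => sc.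
    apply: (@le_trans _ _ (c + (c + c))); first by rewrite lerD2l.
    have -> : c + (c + c) = 3 * c by ring.
    by rewrite ler_pM2l// ltW.
  have dE : d = 4 * (e * `|v|) + 4 * e by rewrite /e; field; rewrite lt0r_neq0.
  have := mulr_ge0 (ltW e0) (normr_ge0 v).
  rewrite dE -mulrA; move: (e * `|v|) => a a0; apply: (@le_lt_trans _ _ (4 * a)).
    by rewrite ler_wpM2r// ler_nat.
  by rewrite ltrDl mulr_gt0.
have : k e < k 0.
  by rewrite -subr_lt0 E pmulr_llt0// pmulr_rlt0// addr_gt0.
apply/negP; rewrite -leNgt /k !scale0r !addr0.
have := convexP2 cp (x + e *: v) (x + e *: (- v)) ler01 ler01 (addr_gt0 ltr01 ltr01).
rewrite !scale1r addrACA scalerN subrr addr0 !mul1r.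
have -> : (1 + 1)^-1 *: (x + x) = x.
  have -> : x + x = (1 + 1) *: x by rewrite scalerDl scale1r.
  by rewrite scalerA mulVf ?scale1r// lt0r_neq0// addr_gt0.
by rewrite mulrDl !mul1r.
Qed.

End Convex.

(** * Superforms *)

Section Superforms.
Variables (R : realType) (n : nat).
Notation V := 'rV[R]_n.
Notation form := (sform R n).
Notation sfm := (superform R n).
Implicit Types (f g : V -> R) (x : V) (j k l : 'I_n) (al be : sfm).

Definition smooth_form al := forall u, smooth (coef al u).
Definition pform j al : sfm := fun x => [ffun u => partial j (coef al u) x].

Lemma test_sm q r al : test_form q r al -> smooth_form al.
Proof. by move=> [_ H] u; exact: test_smooth. Qed.

Lemma lin_coef (F : form -> form) (a : form) w : lin F ->
  F a w = \sum_u a u * F (ebase R u) w.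
Proof.
move=> lF; rewrite {1}[a]sform_basis (lin_sumE _ _ _ lF) sform_sum.
by apply: eq_bigr => u _; rewrite (linZE _ _ lF) sformZE.
Qed.

Lemma coef_lin (F : form -> form) al w : lin F ->
  coef (fun x => F (al x)) w = fun x => \sum_u F (ebase R u) w * coef al u x.
Proof.
move=> lF; apply/funext => x; rewrite /coef (lin_coef _ _ lF).
by apply: eq_bigr => u _; rewrite mulrC.
Qed.

Lemma sm_lin (F : form -> form) al : lin F -> smooth_form al -> smooth_form (fun x => F (al x)).
Proof.
move=> lF sal w; rewrite coef_lin//; apply: smooth_sum => u _.
by apply: smoothM; [exact: smooth_cst|exact: sal].
Qed.

Lemma partial_sum (I : finType) j (c : I -> R) (F : I -> V -> R) :
  (forall i, smooth (F i)) ->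
  partial j (fun x => \sum_i c i * F i x) = fun x => \sum_i c i * partial j (F i) x.
Proof.
move=> sF; apply: partialE => x.
elim: (index_enum I) => [|i r IH].
  rewrite big_nil (_ : (fun _ => _) = cst 0); first exact: is_derive_cst.
  by apply/funext => y; rewrite big_nil.
rewrite big_cons (_ : (fun _ => _) = (fun y => c i * F i y + \sum_(i0 <- r) c i0 * F i0 y)).
  by apply: is_deriveD; apply: is_deriveZ; apply/derivableP; exact: smooth_derivable.
by apply/funext => y; rewrite big_cons.
Qed.

Lemma partial_cst j (c : R) : partial j (fun _ : V => c) = fun=> 0.
Proof. by apply: partialE => x; exact: is_derive_cst. Qed.

Lemma partialM j f g : smooth f -> smooth g ->
  partial j (fun x => f x * g x) = fun x => partial j f x * g x + f x * partial j g x.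
Proof.
move=> sf sg; apply: partialE => x.
have df : is_derive x (delta_mx 0 j) f (partial j f x).
  by apply/derivableP; exact: smooth_derivable.
have dg : is_derive x (delta_mx 0 j) g (partial j g x).
  by apply/derivableP; exact: smooth_derivable.
have := is_deriveM df dg; rewrite -2![_ *: _]/(_ * _).
by rewrite addrC (mulrC (g x)).
Qed.

Lemma pform_lin j (F : form -> form) al : lin F -> smooth_form al ->
  pform j (fun x => F (al x)) = fun x => F (pform j al x).
Proof.
move=> lF sal; apply/funext => x; apply/ffunP => w; rewrite ffunE coef_lin//.
rewrite partial_sum// (lin_coef _ _ lF); apply: eq_bigr => u _.
by rewrite ffunE mulrC.
Qed.

Lemma smooth_partial_sym f j k : smooth f -> partial j (partial k f) = partial k (partial j f).
Proof.
move=> sf; apply: partial_sym => [i y|i l y|i l]; first exact: smooth_derivable.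
  by apply: smooth_derivable; exact: smooth_partial.
by apply: smooth_cont; do 2 apply: smooth_partial.
Qed.

Lemma coef_pform j al u : coef (pform j al) u = partial j (coef al u).
Proof. by apply/funext => x; rewrite /coef ffunE. Qed.

Lemma sm_pform j al : smooth_form al -> smooth_form (pform j al).
Proof. by move=> sal u; rewrite coef_pform; exact: smooth_partial. Qed.

Lemma pformC j k al : smooth_form al -> pform j (pform k al) = pform k (pform j al).
Proof.
move=> sal; apply/funext => x; apply/ffunP => u.
by rewrite [LHS]ffunE [RHS]ffunE !coef_pform (smooth_partial_sym j k (sal u)).
Qed.

Lemma coef_scale f al u : coef (fun x => f x *: al x) u = fun x => f x * coef al u x.
Proof. by apply/funext => x; rewrite /coef sformZE. Qed.

Lemma coef_add al be u : coef (fun x => al x + be x) u = fun x => coef al u x + coef be u x.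
Proof. by apply/funext => x; rewrite /coef ffunE. Qed.

Lemma coef_sum (I : Type) (r : seq I) (F : I -> sfm) u :
  coef (fun x => \sum_(i <- r) F i x) u = fun x => \sum_(i <- r) coef (F i) u x.
Proof. by apply/funext => x; rewrite /coef sform_sum. Qed.

Lemma sm_scale f al : smooth f -> smooth_form al -> smooth_form (fun x => f x *: al x).
Proof. by move=> sf sal u; rewrite coef_scale; exact: (smoothM sf (sal u)). Qed.

Lemma sm_sum (I : Type) (r : seq I) (F : I -> sfm) :
  (forall i, smooth_form (F i)) -> smooth_form (fun x => \sum_(i <- r) F i x).
Proof. by move=> sF u; rewrite coef_sum; apply: smooth_sum => i _; exact: sF. Qed.

Lemma sm_cst (a : form) : smooth_form (fun=> a).
Proof. by move=> u; exact: smooth_cst. Qed.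

Lemma pform_scale j f al : smooth f -> smooth_form al ->
  pform j (fun x => f x *: al x) = fun x => partial j f x *: al x + f x *: pform j al x.
Proof.
move=> sf sal; apply/funext => x; apply/ffunP => u.
rewrite [LHS]ffunE coef_scale (partialM j sf (sal u)).
by rewrite [RHS]ffunE !sformZE [pform j al x u]ffunE.
Qed.

Lemma pform_sum j (I : finType) (F : I -> sfm) : (forall i, smooth_form (F i)) ->
  pform j (fun x => \sum_i F i x) = fun x => \sum_i pform j (F i) x.
Proof.
move=> sF; apply/funext => x; apply/ffunP => u; rewrite ffunE coef_sum sform_sum.
have -> : (fun x0 => \sum_(i <- index_enum I) coef (F i) u x0) =
    fun x0 => \sum_i 1 * coef (F i) u x0.
  by apply/funext => y; apply: eq_bigr => i _; rewrite mul1r.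
rewrite partial_sum => [|i]; last exact: sF.
by apply: eq_bigr => i _; rewrite mul1r ffunE.
Qed.

Lemma wedge_coef al be w : coef (fun x => wedge (al x) (be x)) w =
  fun x => \sum_u \sum_v (wedge_sign R u v * (w == joini u v)%:R) * (coef al u x * coef be v x).
Proof.
apply/funext => x; rewrite /coef swedgeE; apply: eq_bigr => u _.
by apply: eq_bigr => v _; rewrite -mulrA mulrC.
Qed.

Lemma sm_wedge al be : smooth_form al -> smooth_form be -> smooth_form (fun x => wedge (al x) (be x)).
Proof.
move=> sal sbe w; rewrite wedge_coef; apply: smooth_sum => u _; apply: smooth_sum => v _.
by apply: smoothM; [exact: smooth_cst|apply: smoothM; [exact: sal|exact: sbe]].
Qed.

Lemma test_wedge q r q' r' al be : (forall x, bidegree q r (al x)) -> smooth_form al ->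
  test_form q' r' be -> test_form (q + q') (r + r') (fun x => wedge (al x) (be x)).
Proof.
move=> bal sal [bbe tbe]; split=> [x|w]; first exact: bidegree_swedge.
rewrite wedge_coef; apply: test_sum => u _; apply: test_sum => v _; apply: testZ.
by apply: testM; [exact: sal|exact: tbe].
Qed.

Lemma test_wedge_dx q r j al : test_form q r al -> test_form q.+1 r (fun x => wedge (dx R j) (al x)).
Proof.
by apply: (@test_wedge 1 0) => [x|]; [exact: bidegree_dx|exact: sm_cst].
Qed.

Lemma test_wedge_dxi q r j al : test_form q r al -> test_form q r.+1 (fun x => wedge (dxi R j) (al x)).
Proof.
by apply: (@test_wedge 0 1) => [x|]; [exact: bidegree_dxi|exact: sm_cst].
Qed.

Lemma test_scale q r g al : smooth g -> test_form q r al -> test_form q r (fun x => g x *: al x).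
Proof.
move=> sg [b t]; split=> [x|u]; first exact: bidegreeZ.
by rewrite coef_scale; exact: (testM sg (t u)).
Qed.

Lemma test_scale_cst q r f (a : form) : test_function f -> bidegree q r a ->
  test_form q r (fun x => f x *: a).
Proof.
move=> tf ba; split=> [x|u]; first exact: bidegreeZ.
rewrite coef_scale (_ : (fun _ => _) = fun x => a u * f x); first exact: testZ.
by apply/funext => x; rewrite mulrC.
Qed.

Lemma test_formD q r al be : test_form q r al -> test_form q r be ->
  test_form q r (fun x => al x + be x).
Proof.
move=> [b1 t1] [b2 t2]; split=> [x|u]; first exact: bidegreeD.
by rewrite coef_add; exact: testD.
Qed.

Lemma test_form0 q r : test_form q r (fun=> 0 : form).
Proof.
split=> [x|u]; first exact: bidegree0.
by rewrite (_ : coef _ u = fun=> 0); [exact: test0|apply/funext => x; rewrite /coef ffunE].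
Qed.

Lemma test_form_sum q r (I : Type) (s : seq I) (F : I -> sfm) :
  (forall i, test_form q r (F i)) -> test_form q r (fun x => \sum_(i <- s) F i x).
Proof.
move=> tF; split=> [x|u]; first by apply: bidegree_sum => i _; have [] := tF i.
by rewrite coef_sum; apply: test_sum => i _; have [] := tF i.
Qed.

Lemma test_pform q r j al : test_form q r al -> test_form q r (pform j al).
Proof.
move=> [b t]; split=> [x|u]; last by rewrite coef_pform; exact: test_partial.
apply/bidegreeP => u Nu; rewrite ffunE.
have -> : coef al u = fun=> 0.
  by apply/funext => y; have /bidegreeP := b y; apply.
by rewrite partial_cst.
Qed.

Lemma test_swapx q r al : test_form q r al -> test_form r q (fun x => swapx (al x)).
Proof.
move=> [b t]; split=> [x|u]; first exact: bidegree_swapx.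
rewrite (coef_lin _ _ (@lin_swapx R n)); apply: test_sum => v _; exact: testZ.
Qed.

(** The operator dd^# on forms of any degree, with all derivatives falling on the coefficients;
    [hess] is the corresponding (1,1)-form of a function. *)
Definition ddc al : sfm := fun x =>
  \sum_j \sum_k wedge (dx R j) (wedge (dxi R k) (pform j (pform k al) x)).

Definition hess f : sfm := fun x =>
  \sum_j \sum_k partial j (partial k f) x *: wedge (dx R j) (dxi R k).

Lemma test_ddc q r al : test_form q r al -> test_form q.+1 r.+1 (ddc al).
Proof.
move=> ta; apply: test_form_sum => j; apply: test_form_sum => k.
by apply: test_wedge_dx; apply: test_wedge_dxi; do 2 apply: test_pform.
Qed.

Lemma ext_dE al : ext_d al = fun x => \sum_j wedge (dx R j) (pform j al x).
Proof. by rewrite wedge_unlock. Qed.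

Lemma dd_sharpE f : smooth f -> dd_sharp f = hess f.
Proof.
move=> sf; rewrite /dd_sharp ext_dE; apply/funext => x; apply: eq_bigr => j _.
have -> : d_sharp f = fun x => \sum_k partial k f x *: dxi R k by [].
rewrite pform_sum => [|k]; last first.
  by apply: sm_scale; [exact: smooth_partial|exact: sm_cst].
rewrite swedge_sumr; apply: eq_bigr => k _.
rewrite pform_scale; [|exact: smooth_partial|exact: sm_cst].
rewrite (_ : pform j (fun=> dxi R k) x = 0) ?scaler0 ?addr0 ?swedgeZr//.
apply/ffunP => u; rewrite !ffunE.
by rewrite [coef _ u](_ : _ = fun=> dxi R k u)// partial_cst.
Qed.

Lemma sm_hess f : smooth f -> smooth_form (hess f).
Proof.
move=> sf; apply: sm_sum => j; apply: sm_sum => k; apply: sm_scale; last exact: sm_cst.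
by do 2 apply: smooth_partial.
Qed.

Lemma bidegree_hess f x : bidegree 1 1 (hess f x).
Proof.
apply: bidegree_sum => j _; apply: bidegree_sum => k _; apply: bidegreeZ.
exact: (bidegree_swedge (@bidegree_dx R n j) (@bidegree_dxi R n k)).
Qed.

Lemma dx_dxiC j k (a : form) : wedge (dxi R k) (wedge (dx R j) a) = - wedge (dx R j) (wedge (dxi R k) a).
Proof.
have := swedge_sgnC (@bidegree_dxi R n k) (@bidegree_dx R n j).
rewrite expr1 scaleN1r => E.
by rewrite -[LHS]swedgeA E swedgeNl swedgeA.
Qed.

Lemma dx_dxC j k (a : form) : wedge (dx R k) (wedge (dx R j) a) = - wedge (dx R j) (wedge (dx R k) a).
Proof.
have := swedge_sgnC (@bidegree_dx R n k) (@bidegree_dx R n j).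
rewrite expr1 scaleN1r => E.
by rewrite -[LHS]swedgeA E swedgeNl swedgeA.
Qed.

(** Swapping turns dx_j /\ dxi_k into dxi_j /\ dx_k, which is -dx_k /\ dxi_j; the symmetry of second
    derivatives absorbs the exchange of j and k. *)
Lemma ddc_swapx al : smooth_form al -> ddc (fun x => swapx (al x)) = fun x => - swapx (ddc al x).
Proof.
move=> sal.
have E j k x : pform j (pform k (fun x => swapx (al x))) x = swapx (pform k (pform j al) x).
  rewrite (pform_lin k (@lin_swapx R n) sal) (pform_lin j (@lin_swapx R n) (sm_pform k sal)).
  by rewrite (pformC j k sal).
apply/funext => x; rewrite /ddc (lin_sumE _ _ _ (@lin_swapx R n)).
under [in RHS]eq_bigr do rewrite (lin_sumE _ _ _ (@lin_swapx R n)).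
rewrite [in RHS]exchange_big -sumrN; apply: eq_bigr => j _.
rewrite -sumrN; apply: eq_bigr => k _.
rewrite !swapx_swedge swapx_dx swapx_dxi dx_dxiC opprK.
congr (wedge _ (wedge _ _)); exact: E.
Qed.

(** The summands dx_j /\ dxi_k /\ dx_l are antisymmetric in j and l, while the third derivatives are
    symmetric, so the sum equals its own negative. This is the source of closedness of the
    products. *)
Lemma ddc_ext_d al : smooth_form al -> ddc (ext_d al) = fun=> 0.
Proof.
move=> sal; apply/funext => x.
have slj l m : smooth_form (fun x => wedge (dx R l) (pform m al x)).
  by apply: (sm_lin (lin_swedger _)); exact: sm_pform.
have E j k : pform j (pform k (ext_d al)) x = \sum_l wedge (dx R l) (pform j (pform k (pform l al)) x).
  have E1 : pform k (ext_d al) = fun x => \sum_l wedge (dx R l) (pform k (pform l al) x).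
    rewrite ext_dE (pform_sum k (fun l => slj l l)); apply/funext => y.
    apply: eq_bigr => l _.
    by rewrite (pform_lin k (lin_swedger (dx R l)) (sm_pform l sal)).
  have s2 l : smooth_form (fun x => wedge (dx R l) (pform k (pform l al) x)).
    by apply: (sm_lin (lin_swedger _)); do 2 apply: sm_pform.
  rewrite E1 (pform_sum j s2); apply: eq_bigr => l _.
  by rewrite (pform_lin j (lin_swedger (dx R l)) (sm_pform k (sm_pform l sal))).
rewrite /ddc exchange_big big1// => k _.
under eq_bigr do rewrite E swedge_sumr swedge_sumr.
pose G j l := wedge (dx R j) (wedge (dxi R k) (wedge (dx R l) (pform j (pform k (pform l al)) x))).
have Gsym j l : G l j = - G j l.
  rewrite /G; have -> : pform l (pform k (pform j al)) = pform j (pform k (pform l al)).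
    rewrite (pformC k j sal) (pformC l j (sm_pform k sal)) (pformC k l sal).
    by [].
  move: (pform j (pform k (pform l al)) x) => b.
  have H (a c d : form) : (forall e, wedge d (wedge c e) = - wedge c (wedge d e)) ->
      (forall e, wedge d (wedge a e) = - wedge a (wedge d e)) ->
      (forall e, wedge a (wedge c e) = - wedge c (wedge a e)) ->
      wedge a (wedge d (wedge c b)) = - wedge c (wedge d (wedge a b)).
    by move=> H1 H2 H3; rewrite H1 H2 !swedgeNr H3.
  by apply: H => e; [exact: dx_dxiC|exact: dx_dxiC|exact: dx_dxC].
set S := \sum_j _; have : S = - S.
  rewrite {2}/S -sumrN; transitivity (\sum_j \sum_l G l j); first by rewrite exchange_big.
  by apply: eq_bigr => j _; rewrite -sumrN; apply: eq_bigr => l _; exact: Gsym.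
move=> /eqP; rewrite -addr_eq0 -mulr2n -scaler_nat scaler_eq0 pnatr_eq0 => /eqP.
by [].
Qed.

(** The vectors depend on x without any regularity, which is enough because strong positivity and
    weak nullity are pointwise conditions. *)
Lemma hess_sq f x : smooth f -> convex f ->
  exists s : seq V, hess f x = \sum_(a <- s) sq a.
Proof.
move=> sf cf; pose H : 'M[R]_n := \matrix_(j, k) partial j (partial k f) x.
have pH : psd H.
  split; first by apply/matrixP => j k; rewrite !mxE smooth_partial_sym.
  move=> v; rewrite bformE; have := hessian_psd x v sf cf.
  congr (0 <= _); apply: eq_bigr => j _; apply: eq_bigr => k _; by rewrite mxE.
have [s Hs] := psd_sum_sqr pH; exists s.
transitivity (\sum_j \sum_k \sum_(a <- s)
    (a 0 j * a 0 k) *: wedge (dx R j) (dxi R k)).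
  apply: eq_bigr => j _; apply: eq_bigr => k _; rewrite -scaler_suml -Hs.
  by rewrite mxE.
transitivity (\sum_j \sum_(a <- s) \sum_k (a 0 j * a 0 k) *: wedge (dx R j) (dxi R k)).
  by apply: eq_bigr => j _; rewrite exchange_big.
rewrite exchange_big/=; apply: eq_bigr => a _.
rewrite /sq swedge_suml; apply: eq_bigr => j _; rewrite swedgeZl swedge_sumr scaler_sumr.
by apply: eq_bigr => k _; rewrite swedgeZr scalerA.
Qed.

End Superforms.

(** * Currents *)

Section Currents.
Variables (R : realType) (n : nat).
Notation V := 'rV[R]_n.
Notation form := (sform R n).
Notation sfm := (superform R n).
Notation func := (functional R n).
Implicit Types (f g phi psi : V -> R) (x : V) (j k l : 'I_n) (al be ga : sfm) (T S : func).

Definition linear_on q T := forall (c : R) al be,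
  test_form q q al -> test_form q q be ->
  T (fun x => c *: al x + be x) = c * T al + T be.

(** What the mass estimates rest on. Closedness is kept apart, as it serves the integration by
    parts, and measure coefficients are recovered in [positive_strong_current]. *)
Definition positive_strong p T :=
  [/\ forall q, (p + q)%N = n -> linear_on q T,
      weakly_positive_current p T & strong_current p T].

Lemma closed_positive_strongW p T : closed_positive_strong p T -> positive_strong p T.
Proof. by move=> [[Tl _] _ wp st]; split=> // q pq c al be; exact: Tl. Qed.

Section Linear.
Variables (q : nat) (T : func).
Hypothesis Tl : linear_on q T.

Lemma current0 : T (fun=> 0) = 0.
Proof.
have := Tl 1 (@test_form0 R n q q) (@test_form0 R n q q).
rewrite (_ : (fun _ => _) = fun=> 0); last by apply/funext => x; rewrite scaler0 addr0.
by rewrite mul1r => /eqP; rewrite -subr_eq0 opprD addNKr oppr_eq0 => /eqP.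
Qed.

Lemma currentD al be : test_form q q al -> test_form q q be ->
  T (fun x => al x + be x) = T al + T be.
Proof.
move=> ta tb; rewrite -[T al]mul1r -Tl//; congr T.
by apply/funext => x; rewrite scale1r.
Qed.

Lemma currentZ c al : test_form q q al -> T (fun x => c *: al x) = c * T al.
Proof.
move=> ta; rewrite -[RHS]addr0 -current0 -Tl//; last exact: test_form0.
by congr T; apply/funext => x; rewrite addr0.
Qed.

Lemma test_formZ c al : test_form q q al -> test_form q q (fun x => c *: al x).
Proof. by apply: test_scale; exact: smooth_cst. Qed.

Lemma test_formB al be : test_form q q al -> test_form q q be ->
  test_form q q (fun x => al x - be x).
Proof.
move=> ta tb; rewrite (_ : (fun _ => _) = fun x => -1 *: be x + al x).
  by apply: test_formD => //; exact: test_formZ.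
by apply/funext => x; rewrite scaleN1r addrC.
Qed.

Lemma currentB al be : test_form q q al -> test_form q q be ->
  T (fun x => al x - be x) = T al - T be.
Proof.
move=> ta tb; rewrite -[- T be]mulN1r addrC -Tl//; congr T.
by apply/funext => x; rewrite scaleN1r addrC.
Qed.

Lemma current_sum (I : Type) (r : seq I) (F : I -> sfm) : (forall i, test_form q q (F i)) ->
  T (fun x => \sum_(i <- r) F i x) = \sum_(i <- r) T (F i).
Proof.
move=> tF; elim: r => [|i r IH].
  by rewrite big_nil -[RHS]current0; congr T; apply/funext => x; rewrite big_nil.
rewrite big_cons -IH -currentD//; last exact: test_form_sum.
by congr T; apply/funext => x; rewrite big_cons.
Qed.

End Linear.

Lemma bidegree_setC q (u : {set 'I_n} * {set 'I_n}) p : (p + q)%N = n -> #|u.1| = q ->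
  #|(~: u.1)%SET| = p.
Proof. by move=> pq uq; have := cardsC u.1; rewrite card_ord uq -[in RHS]pq addnC => /addIn. Qed.

Lemma dual_coef_neq0 (I K : {set 'I_n}) :
  top_coef (swedge (dxdxi R I K) (dxdxi R (~: I)%SET (~: K)%SET)) != 0.
Proof.
rewrite -wedge_unlock (swedge_ebase R (I, K) ((~: I)%SET, (~: K)%SET)) top_coefZ /joini/=.
rewrite !finset.setUCr /top_coef -/(ebase R _) ebaseE eqxx.
have [e [e0 ->]] := volE R n; rewrite sformZE ebaseE eqxx.
have w0 : wedge_sign R (I, K) ((~: I)%SET, (~: K)%SET) != 0.
  by rewrite /wedge_sign/= !shuffle_signE ?mulf_neq0 ?signr_eq0// -finset.setI_eq0 finset.setICr.
by apply: mulf_neq0 => //; rewrite mul1r invr_eq0 mulr1.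
Qed.

Lemma dual_coef_sym (I K : {set 'I_n}) : #|I| = #|K| ->
  top_coef (swedge (dxdxi R I K) (dxdxi R (~: I)%SET (~: K)%SET)) =
  top_coef (swedge (dxdxi R K I) (dxdxi R (~: K)%SET (~: I)%SET)).
Proof.
move=> IK; have IK' : #|(~: I)%SET| = #|(~: K)%SET|.
  by apply/eqP; rewrite -(eqn_add2l #|I|) cardsC IK cardsC.
have D (I1 K1 : {set 'I_n}) : top_coef (swedge (dxdxi R I1 K1) (dxdxi R (~: I1)%SET (~: K1)%SET)) =
    wedge_sign R (I1, K1) ((~: I1)%SET, (~: K1)%SET) * top_coef (ebase R ([set: 'I_n]%SET, [set: 'I_n]%SET)).
  rewrite -wedge_unlock (swedge_ebase R (I1, K1) ((~: I1)%SET, (~: K1)%SET)) top_coefZ.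
  by rewrite /joini/= !finset.setUCr.
apply: etrans (D I K) (etrans _ (esym (D K I))); rewrite /wedge_sign/= IK IK'.
by congr (_ * _); exact: mulrAC.
Qed.

(** The pairs (I, K) and (K, I) receive the same normalizing constant, so symmetry of [current_coef]
    passes to the values on basis forms. *)
Lemma dual_formC (I K : {set 'I_n}) : #|I| = #|K| -> exists2 c : R, c != 0 &
  dual_form R (~: I)%SET (~: K)%SET = c *: ebase R (I, K) /\
  dual_form R (~: K)%SET (~: I)%SET = c *: ebase R (K, I).
Proof.
move=> IK; have IK' : #|(~: I)%SET| = #|(~: K)%SET|.
  by apply/eqP; rewrite -(eqn_add2l #|I|) cardsC IK cardsC.
have c0 := dual_coef_neq0 (~: I)%SET (~: K)%SET.
have sc := dual_coef_sym IK'.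
move: c0 sc; rewrite /dual_form/= !finset.setCK => + <-.
by move: (top_coef _) => c c0; exists c^-1; rewrite ?invr_eq0.
Qed.

Section Basis.
Variables (q : nat) (al : sfm).
Hypothesis ta : test_form q q al.

Lemma test_form_coef_eq0 (u : {set 'I_n} * {set 'I_n}) :
  ~~ ((#|u.1| == q) && (#|u.2| == q)) -> coef al u = fun=> 0.
Proof. by move=> Nu; apply/funext => x; have /bidegreeP := ta.1 x; apply. Qed.

Lemma test_form_coef u : test_form q q (fun x => coef al u x *: ebase R u).
Proof.
have [/andP[/eqP u1 /eqP u2]|/test_form_coef_eq0->] := boolP ((#|u.1| == q) && (#|u.2| == q)).
  by apply: (test_scale_cst (ta.2 u)); have := @bidegree_ebase R n u; rewrite u1 u2.
rewrite (_ : (fun _ => _) = fun=> 0); first exact: test_form0.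
by apply/funext => x; rewrite scale0r.
Qed.

Lemma current_basis T : linear_on q T -> T al = \sum_u T (fun x => coef al u x *: ebase R u).
Proof.
move=> Tl; rewrite -(current_sum Tl _ test_form_coef); congr T.
by apply/funext => x; exact: sform_basis.
Qed.

End Basis.

(** Termwise on basis forms: a symmetric current takes the same value on f dx_I /\ dxi_K and f dx_K
    /\ dxi_I, and [swapx] adds the sign (-1)^(q q) = (-1)^q. *)
Lemma current_swapx p q T al : (p + q)%N = n -> linear_on q T -> symmetric_current p T ->
  test_form q q al -> T (fun x => swapx (al x)) = (-1) ^+ q * T al.
Proof.
move=> pq Tl Ts ta.
have E (I K : {set 'I_n}) f : test_function f -> #|I| = q -> #|K| = q ->
    T (fun x => f x *: ebase R (I, K)) = T (fun x => f x *: ebase R (K, I)).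
  move=> tf Iq Kq; have [c c0 [D1 D2]] := dual_formC (etrans Iq (esym Kq)).
  have := Ts _ _ (bidegree_setC (u := (I, K)) pq Iq) (bidegree_setC (u := (K, I)) pq Kq).
  move=> /(_ _ (testZ c^-1 tf)); rewrite /current_coef D1 D2.
  have F (e : form) : T (fun x => (c^-1 * f x) *: (c *: e)) = T (fun x => f x *: e).
    by congr (T _); apply/funext => x; rewrite scalerA mulrAC (mulVf c0) mul1r.
  by move=> H; exact: etrans (esym (F (ebase R (I, K)))) (etrans H (F (ebase R (K, I)))).
rewrite (current_basis (test_swapx ta) Tl) (current_basis ta Tl) mulr_sumr.
rewrite (reindex_inj (h := fun u : {set 'I_n} * {set 'I_n} => (u.2, u.1))); last first.
  by move=> [I K] [I' K'] [-> ->].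
apply: eq_bigr => -[I K] _ /=.
have [/andP[/eqP u1 /eqP u2]|Nu] := boolP ((#|I| == q) && (#|K| == q)); last first.
  rewrite (test_form_coef_eq0 (u := (I, K)) ta Nu).
  rewrite (test_form_coef_eq0 (u := (K, I)) (test_swapx ta)) 1?andbC//.
  have Z (e : form) : T (fun x : V => 0 *: e) = 0.
    by apply: etrans (current0 Tl); congr (T _); apply/funext => x; rewrite scale0r.
  apply: (etrans (Z _)); apply: esym.
  by apply: (etrans (congr1 (fun t => (-1) ^+ q * t) (Z _))); rewrite mulr0.
have C x : coef (fun y => swapx (al y)) (K, I) x = (-1) ^+ q * coef al (I, K) x.
  by rewrite /coef ffunE/= u1 u2 sqr_sign.
rewrite (E K I _ ((test_swapx ta).2 (K, I)) u2 u1) -(currentZ Tl _ (test_form_coef ta (I, K))).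
by congr (T _); apply/funext => x; rewrite C scalerA.
Qed.

Lemma current_decomposition p q : (p + q)%N = n ->
  exists (m : nat) (E : 'I_m -> seq V) (mu : 'I_m -> {set 'I_n} * {set 'I_n} -> R),
    (forall i, size (E i) = q) /\ forall T, positive_strong p T -> forall al, test_form q q al ->
      T al = \sum_i T (fun x => (\sum_u al x u * mu i u) *: elem (E i)).
Proof.
move=> pq; have [m [E [l [Eq H]]]] := elem_decomposition R n q.
(* Projection onto the symmetric forms. Weak nullity includes symmetry, so the remainder has to be
   formed from [F al]; by [current_swapx], [T] takes the same value on [al] and on [F al]. *)
pose F (a : form) : form := 2^-1 *: (a + (-1) ^+ q *: swapx a).
have linF : lin F.
  move=> c a b; rewrite /F lin_swapx; rewrite !(scalerDr, scalerA).
  by rewrite !addrA (mulrC c) -!mulrA (mulrC c) !mulrA; congr (_ + _); rewrite addrAC.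
have Fb u v : F (ebase R u) v = F (ebase R u) v by [].
exists m, E, (fun i u => \sum_v F (ebase R u) v * l i v); split=> // T [Tl Tp Ts] al ta.
have Tl' := Tl q pq; have Tsym := Tp.1.
have tsw : test_form q q (fun x => swapx (al x)) by exact: test_swapx.
have tF : test_form q q (fun x => F (al x)).
  by apply: test_formZ; apply: test_formD => //; exact: test_formZ.
have TF : T (fun x => F (al x)) = T al.
  rewrite (currentZ Tl'); last by apply: test_formD => //; exact: test_formZ.
  rewrite (currentD Tl')//; last exact: test_formZ.
  rewrite (currentZ Tl')// (current_swapx pq Tl' Tsym ta) mulrA -expr2 sqrr_sign.
  by field.
have Fsym x : Defs.symmetric_form q (F (al x)).
  apply/symmetric_formP; split; first by have [] := tF.
  rewrite (linZE _ _ (@lin_swapx R n)) (linDE _ _ (@lin_swapx R n)) (linZE _ _ (@lin_swapx R n)).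
  rewrite swapxK /F scalerA [in RHS]mulrC -scalerA; congr (_ *: _).
  by rewrite scalerDr scalerA -expr2 sqrr_sign scale1r addrC.
have coefE i x : \sum_u al x u * (\sum_v F (ebase R u) v * l i v) =
    \sum_v F (al x) v * l i v.
  under eq_bigr do rewrite mulr_sumr.
  rewrite exchange_big; apply: eq_bigr => v _; rewrite (lin_coef _ _ linF) mulr_suml.
  by apply: eq_bigr => u _; rewrite mulrA.
pose ga x := F (al x) - \sum_i (\sum_v F (al x) v * l i v) *: elem (E i).
have tE i : test_form q q (fun x => (\sum_v F (al x) v * l i v) *: elem (E i)).
  apply: test_scale_cst; last by rewrite -(Eq i); exact: bidegree_elem.
  apply: test_sum => v _; rewrite (_ : (fun _ => _) = fun x => l i v * coef (fun y => F (al y)) v x).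
    by apply: testZ; have [_] := tF; apply.
  by apply/funext => x; rewrite mulrC.
have tga : test_form q q ga by apply: test_formB => //; exact: test_form_sum.
have : T ga = 0.
  apply: (Ts.2 q pq) => // x; apply: elem_null_weakly_null; last exact: H.
  rewrite /ga -scaleN1r; apply: symmetricD => //; apply: symmetricZ.
  apply: symmetric_sum => i _; apply: symmetricZ; exact: symmetric_elem.
rewrite (currentB Tl')//; last exact: test_form_sum.
rewrite (current_sum Tl')// TF => /eqP; rewrite subr_eq0 => /eqP->.
by apply: eq_bigr => i _; congr T; apply/funext => x; rewrite coefE.
Qed.

Lemma current_elem_ge0 p q T f s : (p + q)%N = n -> positive_strong p T -> test_function f ->
  (forall x, 0 <= f x) -> size s = q -> 0 <= T (fun x => f x *: elem s).
Proof.
move=> pq [_ [_ Tp] _] tf f0 sq'; apply: (Tp q pq) => [|x].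
  by apply: test_scale_cst => //; rewrite -sq'; exact: bidegree_elem.
by apply: spZ => //; exact: sp_elem.
Qed.

Lemma mass_bound p q al : (p + q)%N = n -> test_form q q al ->
  exists2 ga, test_form q q ga & forall T, positive_strong p T ->
    0 <= T ga /\ forall g (e : R), smooth g -> 0 <= e -> (forall x, al x != 0 -> `|g x| <= e) ->
      `|T (fun x => g x *: al x)| <= e * T ga.
Proof.
move=> pq ta; have [m [E [mu [Eq H]]]] := current_decomposition pq.
pose f i x := \sum_u al x u * mu i u.
have tf i : test_function (f i).
  apply: test_sum => u _; rewrite (_ : (fun _ => _) = fun x => mu i u * coef al u x).
    by apply: testZ; have [_] := ta; apply.
  by apply/funext => x; rewrite mulrC.
have /choice[C HC] : forall i, exists C, 0 < C /\ forall x, `|f i x| <= C.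
  by move=> i; have [C C0 fC] := test_bounded (tf i); exists C.
have /choice[r Hr] : forall i, exists r, 0 <= r /\ forall x, r < `|x| -> f i x = 0.
  by move=> i; have /test_functionP[_ [r r0 fr]] := tf i; exists r.
(* A smooth majorant of |f_i|, which itself need not be smooth. *)
pose h i x : R := C i * @cutoff R n (r i) x.
have th i : test_function (h i) by apply: testZ; apply: test_cutoff; have [] := Hr i.
have h0 i x : 0 <= h i x by rewrite mulr_ge0 ?cutoff_ge0// ltW//; have [] := HC i.
have fh i x : `|f i x| <= h i x.
  have [C0 fC] := HC i; have [r0 fr] := Hr i.
  have [xr|/fr->] := leP `|x| (r i); last by rewrite normr0.
  by rewrite /h cutoff1// mulr1.
have bE i : bidegree q q (elem (E i)) by rewrite -(Eq i); exact: bidegree_elem.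
have thE i : test_form q q (fun x => h i x *: elem (E i)) by exact: test_scale_cst.
exists (fun x => \sum_i h i x *: elem (E i)); first exact: test_form_sum.
move=> T pT; have Tl : linear_on q T by have [Tl _ _] := pT; exact: Tl.
have Th i : 0 <= T (fun x => h i x *: elem (E i)) by apply: (current_elem_ge0 pq pT).
split; first by rewrite (current_sum Tl)//; apply: sumr_ge0.
move=> g e sg e0 ge; rewrite (current_sum Tl)// (H T pT); last exact: test_scale.
rewrite mulr_sumr; apply: (le_trans (ler_norm_sum _ _ _)); apply: ler_sum => i _.
have gf x : \sum_u (g x *: al x) u * mu i u = g x * f i x.
  by rewrite mulr_sumr; apply: eq_bigr => u _; rewrite sformZE mulrA.
have -> : (fun x => (\sum_u (g x *: al x) u * mu i u) *: elem (E i)) =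
    fun x => (g x * f i x) *: elem (E i) by apply/funext => x; rewrite gf.
have tgf := testM sg (tf i).
have gfh x : `|g x * f i x| <= e * h i x.
  have [a0|a0] := eqVneq (al x) 0.
    rewrite /f a0 big1 ?mulr0 ?normr0; first by apply: mulr_ge0.
    by move=> u _; rewrite ffunE mul0r.
  by rewrite normrM ler_pM// ge.
have teh := testZ e (th i).
have tgfE : test_form q q (fun x => (g x * f i x) *: elem (E i)) := test_scale_cst tgf (bE i).
(* Positivity of [T] on (e h_i - c g f_i) E_i, for c = 1 and c = -1, bounds the absolute value. *)
have key (c : R) : `|c| = 1 -> c * T (fun x => (g x * f i x) *: elem (E i)) <=
    e * T (fun x => h i x *: elem (E i)).
  move=> c1; rewrite -subr_ge0 -(currentZ Tl e (thE i)) -(currentZ Tl c tgfE).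
  rewrite -(currentB Tl (test_formZ e (thE i)) (test_formZ c tgfE)).
  rewrite (_ : (fun x => _) = fun x => (e * h i x - c * (g x * f i x)) *: elem (E i)); last first.
    by apply/funext => x; rewrite scalerBl !scalerA.
  apply: (current_elem_ge0 pq pT _ _ (Eq i)).
    rewrite (_ : (fun _ => _) = fun x => e * h i x + (- c) * (g x * f i x)).
      exact: testD teh (testZ (- c) tgf).
    by apply/funext => x; rewrite mulNr.
  move=> x; rewrite subr_ge0; apply: le_trans (gfh x).
  by apply: (le_trans (ler_norm _)); rewrite normrM c1 mul1r.
rewrite ler_norml; apply/andP; split.
  by rewrite lerNl -mulN1r key// normrN normr1.
by rewrite -[leLHS]mul1r key// normr1.
Qed.

Lemma positive_strong_current p T : positive_strong p T -> current p p T.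
Proof.
move=> pT; have [Tl _ _] := pT; split.
  move=> p' q' pp' pq' c al be; have -> : q' = p' by apply/eqP; rewrite -(eqn_add2l p) pp' pq'.
  exact: Tl.
move=> I K Ip Kp; pose q := (n - p)%N.
have pq : (p + q)%N = n by rewrite subnKC// -Ip -[X in (_ <= X)%N]card_ord max_card.
have Tl' := Tl q pq.
have [m [E [mu [Eq H]]]] := current_decomposition pq.
pose b i := \sum_u dual_form R I K u * mu i u.
have bE i : bidegree q q (elem (E i)) by rewrite -(Eq i); exact: bidegree_elem.
have bd : bidegree q q (dual_form R I K).
  apply: bidegreeZ; have := @bidegree_ebase R n ((~: I)%SET, (~: K)%SET); rewrite /=.
  have cC (J : {set 'I_n}) : #|J| = p -> #|(~: J)%SET| = q.
    by move=> Jp; have := cardsC J; rewrite card_ord Jp -[in RHS]pq => /addnI.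
  by rewrite !cC.
(* A coefficient of [T] is a combination of the positive functionals f |-> T (f E_i) with real
   weights [b i]. [L 1] keeps the positive parts of the weights and [L (-1)] the negative parts;
   both are positive functionals. *)
pose L (s : R) f := \sum_i Num.max (s * b i) 0 * T (fun x => f x *: elem (E i)).
have tE f i : test_function f -> test_form q q (fun x => f x *: elem (E i)).
  by move=> tf; exact: test_scale_cst.
have Llin s (c : R) f g : test_function f -> test_function g ->
    L s (fun x => c * f x + g x) = c * L s f + L s g.
  move=> tf tg; rewrite /L mulr_sumr -big_split; apply: eq_bigr => i _ /=.
  rewrite (_ : (fun x => _ *: _) = fun x => c *: (f x *: elem (E i)) + g x *: elem (E i)).
    by rewrite Tl'; [ring|exact: tE|exact: tE].
  by apply/funext => x; rewrite scalerDl scalerA.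
have Lpos s f : test_function f -> (forall x, 0 <= f x) -> 0 <= L s f.
  move=> tf f0; apply: sumr_ge0 => i _; apply: mulr_ge0; last exact: (current_elem_ge0 pq pT).
  by rewrite le_max lexx orbT.
have [mu1 lf1 H1] := riesz_representation (Llin 1) (Lpos 1).
have [mu2 lf2 H2] := riesz_representation (Llin (-1)) (Lpos (-1)).
exists mu1, mu2; split=> // f tf; rewrite -H1// -H2// /L -sumrB /current_coef.
rewrite (H T pT); last exact: test_scale_cst.
apply: eq_bigr => i _.
have -> : (fun x => (\sum_u (f x *: dual_form R I K) u * mu i u) *: elem (E i)) =
    fun x => b i *: (f x *: elem (E i)).
  apply/funext => x; rewrite [RHS]scalerA (mulrC (b i)) mulr_sumr; congr (_ *: _).
  by apply: eq_bigr => u _; rewrite sformZE mulrA.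
rewrite (currentZ Tl'); last exact: tE.
rewrite -mulrBl; congr (_ * _); rewrite mul1r mulN1r.
have [b0|b0] := leP (b i) 0; last by rewrite max_r ?subr0// oppr_le0 ltW.
by rewrite max_l ?oppr_ge0// sub0r opprK.
Qed.

End Currents.

(** * Integration by parts against a closed current *)

Section Currents.
Variables (R : realType) (n : nat).
Notation V := 'rV[R]_n.
Notation form := (sform R n).
Notation sfm := (superform R n).
Notation func := (functional R n).
Implicit Types (f g phi psi : V -> R) (x : V) (j k l : 'I_n) (al be ga : sfm) (T S : func).

Lemma test_form_bounded_supp q r al : test_form q r al ->
  exists N : nat, forall x, al x != 0 -> `|x| <= N%:R.
Proof.
move=> [_ tal].
have /choice[c Hc] : forall u, exists c : R, 0 <= c /\ forall x, c < `|x| -> coef al u x = 0.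
  by move=> u; have /test_functionP[_ [c c0 H]] := tal u; exists c.
have [N HN] : exists N : nat, \sum_u c u < N%:R.
  by exists (Num.bound (\sum_u c u)); rewrite archi_boundP// sumr_ge0// => u _; have [] := Hc u.
exists N => x; apply: contraNT; rewrite -ltNge => xN; apply/eqP/ffunP => u.
rewrite ffunE; have [_] := Hc u; apply; apply: le_lt_trans xN; apply: le_trans (ltW HN).
by rewrite (bigD1 u)//= lerDl sumr_ge0// => v _; have [] := Hc v.
Qed.

Definition dsharp al : sfm := fun x => \sum_k wedge (dxi R k) (pform k al x).

(** The mixed terms, with one derivative on [f] and one on [al], cancel between the two exact forms,
    since moving dxi_k past dx_j reverses the sign. What remains has both derivatives on [al] or
    both on [f]. *)
Lemma ibp_identity f al x : smooth f -> smooth_form al ->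
  f x *: ddc al x - wedge (hess f x) (al x) =
  ext_d (fun y => \sum_k wedge (dxi R k) (f y *: pform k al y)) x +
  dsharp (fun y => \sum_j wedge (dx R j) (partial j f y *: al y)) x.
Proof.
move=> sf sal.
have sA k : smooth_form (fun y => f y *: pform k al y) by exact: (sm_scale sf (sm_pform k sal)).
have sB j : smooth_form (fun y => partial j f y *: al y) by exact: (sm_scale (smooth_partial j sf) sal).
have sA' k := sm_lin (lin_swedger (dxi R k)) (sA k).
have sB' j := sm_lin (lin_swedger (dx R j)) (sB j).
rewrite ext_dE /dsharp.
have EA j : wedge (dx R j) (pform j (fun y => \sum_k wedge (dxi R k) (f y *: pform k al y)) x) =
    \sum_k (partial j f x *: wedge (dx R j) (wedge (dxi R k) (pform k al x)) +
            f x *: wedge (dx R j) (wedge (dxi R k) (pform j (pform k al) x))).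
  rewrite (pform_sum j sA') swedge_sumr; apply: eq_bigr => k _.
  rewrite (pform_lin j (lin_swedger (dxi R k)) (sA k)) (pform_scale j sf (sm_pform k sal)).
  move: (dx R j) (dxi R k) (pform k al x) (pform j _ x) => a d u v.
  by rewrite !(swedgeDr, swedgeZr).
have EB k : wedge (dxi R k) (pform k (fun y => \sum_j wedge (dx R j) (partial j f y *: al y)) x) =
    \sum_j - (partial j (partial k f) x *: wedge (dx R j) (wedge (dxi R k) (al x)) +
              partial j f x *: wedge (dx R j) (wedge (dxi R k) (pform k al x))).
  rewrite (pform_sum k sB') swedge_sumr; apply: eq_bigr => j _.
  rewrite (pform_lin k (lin_swedger (dx R j)) (sB j)) (pform_scale k (smooth_partial j sf) sal).
  rewrite dx_dxiC (smooth_partial_sym k j sf); congr (- _).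
  move: (dx R j) (dxi R k) (pform k al x) (al x) => a d u v.
  by rewrite !(swedgeDr, swedgeZr).
under [X in _ = X + _]eq_bigr do rewrite EA.
under [X in _ = _ + X]eq_bigr do rewrite EB.
rewrite [X in _ = _ + X]exchange_big -big_split /=.
rewrite /hess swedge_suml /ddc scaler_sumr -sumrB; apply: eq_bigr => j _.
rewrite swedge_suml scaler_sumr -sumrB -big_split; apply: eq_bigr => k _ /=.
rewrite swedgeZl swedgeA; set a := f x *: _; set b := _ *: wedge _ _; set c := _ *: wedge _ _.
by rewrite [c + a]addrC opprD [- b - c]addrC addrA addrK.
Qed.

Lemma test_hess_wedge q f al : smooth f -> test_form q q al ->
  test_form q.+1 q.+1 (fun x => wedge (hess f x) (al x)).
Proof. by move=> sf ta; exact: (test_wedge (@bidegree_hess R n f) (sm_hess sf) ta). Qed.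

Section Closed.
Variables (p q : nat) (T : func).
Hypotheses (pT : positive_strong p T) (cT : closed_current p p T) (pq : (p + q.+1)%N = n).

Let Tl : linear_on q.+1 T. Proof. by have [H _ _] := pT; exact: H. Qed.

Lemma current_ext_d be : test_form q q.+1 be -> T (ext_d be) = 0.
Proof. by apply: cT; rewrite -?addnS. Qed.

Lemma test_ext_d be : test_form q q.+1 be -> test_form q.+1 q.+1 (ext_d be).
Proof.
by move=> tb; rewrite ext_dE; apply: test_form_sum => j; apply: test_wedge_dx; exact: test_pform.
Qed.

Lemma dsharp_swapx be : smooth_form be ->
  ext_d (fun x => swapx (be x)) = fun x => swapx (dsharp be x).
Proof.
move=> sb; rewrite ext_dE; apply/funext => x.
rewrite /dsharp (lin_sumE _ _ _ (@lin_swapx R n)); apply: eq_bigr => k _.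
by rewrite swapx_swedge swapx_dxi (pform_lin k (@lin_swapx R n) sb).
Qed.

Lemma test_dsharp be : test_form q.+1 q be -> test_form q.+1 q.+1 (dsharp be).
Proof. by move=> tb; apply: test_form_sum => j; apply: test_wedge_dxi; exact: test_pform. Qed.

(** [swapx] exchanges d and d^#, and a symmetric current is invariant under it up to sign, so
    d-closedness yields d^#-closedness. *)
Lemma current_dsharp be : test_form q.+1 q be -> T (dsharp be) = 0.
Proof.
move=> tb; have := current_ext_d (test_swapx tb); rewrite dsharp_swapx; last exact: test_sm tb.
have [_ [Tsym _] _] := pT.
rewrite (current_swapx pq Tl Tsym); last exact: test_dsharp.
by move=> /eqP; rewrite mulf_eq0 signr_eq0 => /eqP.
Qed.

Lemma current_ibp f al : smooth f -> test_form q q al ->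
  T (fun x => f x *: ddc al x) = T (fun x => wedge (hess f x) (al x)).
Proof.
move=> sf ta; have sal := test_sm ta.
have t1 := test_scale sf (test_ddc ta).
have t2 := test_hess_wedge sf ta.
apply/eqP; rewrite -subr_eq0 -(currentB Tl t1 t2); apply/eqP.
have -> : (fun x => f x *: ddc al x - wedge (hess f x) (al x)) = _ := funext (fun x => ibp_identity x sf sal).
have tA : test_form q q.+1 (fun y => \sum_k wedge (dxi R k) (f y *: pform k al y)).
  apply: test_form_sum => k; exact: test_wedge_dxi (test_scale sf (test_pform k ta)).
have tB : test_form q.+1 q (fun y => \sum_j wedge (dx R j) (partial j f y *: al y)).
  apply: test_form_sum => j; exact: test_wedge_dx (test_scale (smooth_partial j sf) ta).
by rewrite (currentD Tl (test_ext_d tA) (test_dsharp tB)) current_ext_d// current_dsharp// addr0.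
Qed.

End Closed.
End Currents.

(** * Products with a convex function *)

Section Currents.
Variables (R : realType) (n : nat).
Notation V := 'rV[R]_n.
Notation form := (sform R n).
Notation sfm := (superform R n).
Notation func := (functional R n).
Implicit Types (f g phi psi : V -> R) (x : V) (j k l : 'I_n) (al be ga : sfm) (T S : func).

(** A fixed choice of approximants; the default 0 of [xget] is taken only when no such function
    exists, hence never for convex [psi]. The ball grows with [i], so it eventually contains the
    support of any given test form. *)
Definition appr psi (i : nat) : V -> R :=
  xget (fun=> 0) [set f | [/\ smooth f, convex f &
    forall x, `|x| <= i%:R -> `|f x - psi x| <= i.+1%:R^-1]].

Lemma apprP psi i : convex psi -> [/\ smooth (appr psi i), convex (appr psi i) &
    forall x, `|x| <= i%:R -> `|appr psi i x - psi x| <= i.+1%:R^-1].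
Proof.
move=> cpsi; have e0 : (0 : R) < i.+1%:R^-1 by rewrite invr_gt0.
by have := xgetPex (fun=> 0) (convex_approx i%:R cpsi e0).
Qed.

Definition scalar_mul psi T al : R := lim (T (fun x => appr psi i x *: al x) @[i --> \oo]).

(** Comparing with every smooth [f] near [psi], and not with the approximants alone, makes the limit
    independent of their choice; taking e = 0 recovers T (psi al) for smooth [psi]. *)
Lemma scalar_mul_bound p q al : (p + q)%N = n -> test_form q q al ->
  exists2 ga, test_form q q ga & forall T, positive_strong p T -> 0 <= T ga /\
    forall psi, convex psi ->
      T (fun x => appr psi i x *: al x) @[i --> \oo] --> scalar_mul psi T al /\
      forall f e, smooth f -> 0 <= e -> (forall x, al x != 0 -> `|f x - psi x| <= e) ->
        `|scalar_mul psi T al - T (fun x => f x *: al x)| <= e * T ga.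
Proof.
move=> pq ta; have [ga tga H] := mass_bound pq ta; exists ga => // T pT.
have [Tga Hg] := H T pT; split=> // psi cpsi.
have Tl : linear_on q T by have [Tl _ _] := pT; exact: Tl.
have [N HN] := test_form_bounded_supp ta.
pose u i := T (fun x => appr psi i x *: al x).
have su i : smooth (appr psi i) by have [] := apprP i cpsi.
have ua i x : (N <= i)%N -> al x != 0 -> `|appr psi i x - psi x| <= i.+1%:R^-1.
  move=> Ni /HN xN; have [_ _] := apprP i cpsi; apply; apply: le_trans xN _.
  by rewrite ler_nat.
have diff f g e : smooth f -> smooth g -> 0 <= e ->
    (forall x, al x != 0 -> `|f x - g x| <= e) ->
    `|T (fun x => f x *: al x) - T (fun x => g x *: al x)| <= e * T ga.
  move=> sf sg e0 fg; rewrite -(currentB Tl); [|exact: test_scale|exact: test_scale].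
  rewrite (_ : (fun _ => _) = fun x => (f x - g x) *: al x).
    exact: (Hg _ _ (smoothB sf sg) e0 fg).
  by apply/funext => x; rewrite scalerBl.
have fu f e : smooth f -> 0 <= e -> (forall x, al x != 0 -> `|f x - psi x| <= e) ->
    forall i, (N <= i)%N -> `|u i - T (fun x => f x *: al x)| <= (e + i.+1%:R^-1) * T ga.
  move=> sf e0 fe i Ni; apply: (diff _ _ _ (su i) sf (addr_ge0 e0 _)) => [|x ax]; first by rewrite invr_ge0.
  rewrite -(subrK (psi x) (appr psi i x)) -addrA addrC.
  by apply: (le_trans (ler_normD _ _)); rewrite distrC lerD// ?fe// ua.
have inv_cvg : (fun i => i.+1%:R^-1 * T ga) @ \oo --> (0 : R).
  by rewrite -[X in _ --> X](mul0r (T ga)); exact: cvgM cvg_harmonic (cvg_cst _).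
have cu : cvgn u.
  apply/cauchy_cvgP/cauchyP => e e0.
  have /cvgrPdist_lt/(_ (e / 2)) := inv_cvg; rewrite divr_gt0// => /(_ isT)[N' _ HN'].
  pose i0 := maxn N N'; have Ni0 : (N <= i0)%N by exact: leq_maxl.
  exists (u i0); exists i0 => // i /= i0i; rewrite /ball/= distrC.
  (* Cauchy property: the approximant of index [i0] plays the role of the smooth [f]. *)
  have := @fu _ i0.+1%:R^-1 (su i0) _ (ua i0 ^~ Ni0) i (leq_trans Ni0 i0i).
  move=> /(_ _)/le_lt_trans; apply; first by [].
  have := HN' i0 (leq_maxr _ _); rewrite /= sub0r normrN ger0_norm ?mulr_ge0// => H0.
  have := HN' i (leq_trans (leq_maxr _ _) i0i); rewrite /= sub0r normrN ger0_norm ?mulr_ge0// => H1.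
  by rewrite mulrDl [ltRHS]splitr ltrD.
split; first exact: cu.
move=> f e sf e0 fe; have L : (`|u i - T (fun x => f x *: al x)|) @[i --> \oo] -->
    `|scalar_mul psi T al - T (fun x => f x *: al x)|.
  by apply: cvg_norm; apply: cvgB; [exact: cu|exact: cvg_cst].
have L' : (e * T ga + i.+1%:R^-1 * T ga) @[i --> \oo] --> e * T ga.
  rewrite -[X in _ --> X]addr0; apply: cvgD => //; exact: cvg_cst.
apply: (ler_cvg_to L L'); exists N => // i /= Ni.
by rewrite -mulrDl; exact: fu.
Qed.

End Currents.

(** * The product of dd^# psi with a current, for one convex function *)

Section Currents.
Variables (R : realType) (n : nat).
Notation V := 'rV[R]_n.
Notation form := (sform R n).
Notation sfm := (superform R n).
Notation func := (functional R n).
Implicit Types (f g phi psi : V -> R) (x : V) (j k l : 'I_n) (al be ga : sfm) (T S : func).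

Definition ddc_current psi T : func := fun al => scalar_mul psi T (ddc al).

(** The induction over the squares in [hess f x] shared by strong positivity and weak nullity. *)
Lemma hess_wedge_ind (P Q : form -> Prop) f x (a : form) : smooth f -> convex f ->
  P a -> Q 0 -> (forall b c, Q b -> Q c -> Q (b + c)) ->
  (forall (b : form) v, P b -> Q (wedge (sq v) b)) -> Q (wedge (hess f x) a).
Proof.
move=> sf cf Pa Q0 QD PQ; have [s ->] := hess_sq x sf cf.
by rewrite swedge_suml; apply: big_ind => // v _; exact: PQ.
Qed.

Lemma ddc_lin (c : R) al be : smooth_form al -> smooth_form be ->
  ddc (fun x => c *: al x + be x) = fun x => c *: ddc al x + ddc be x.
Proof.
move=> sal sbe; have E k ga de : smooth_form ga -> smooth_form de ->
    pform k (fun x => c *: ga x + de x) = fun x => c *: pform k ga x + pform k de x.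
  move=> sga sde; apply/funext => x; apply/ffunP => u.
  rewrite ffunE coef_add (coef_scale (fun=> c)) [RHS]ffunE sformZE !ffunE.
  have := @partial_sum R n bool k (fun b => if b then c else 1) (fun b => if b then coef ga u else coef de u).
  move=> /(_ _)/(congr1 (fun F => F x)); rewrite /= big_bool mul1r => <-; last by case.
  by congr (partial _ _ _); apply/funext => y; rewrite big_bool mul1r.
apply/funext => x; rewrite /ddc scaler_sumr -big_split; apply: eq_bigr => j _ /=.
rewrite scaler_sumr -big_split; apply: eq_bigr => k _ /=.
rewrite (E k _ _ sal sbe) (E j _ _ (sm_pform k sal) (sm_pform k sbe)).
move: (dx R j) (dxi R k) (pform j _ x) (pform j _ x) => a d u v.
by rewrite !(swedgeDr, swedgeZr).
Qed.

Section ConvexProduct.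
Variables (p : nat) (psi : V -> R) (T : func).
Hypotheses (pT : positive_strong p T) (cT : closed_current p p T) (cpsi : convex psi).

Let sappr i : smooth (appr psi i). Proof. by have [] := apprP i cpsi. Qed.
Let cappr i : convex (appr psi i). Proof. by have [] := apprP i cpsi. Qed.

Lemma ddc_current_cvg q al : (p + q.+1)%N = n -> test_form q q al ->
  T (fun x => appr psi i x *: ddc al x) @[i --> \oo] --> ddc_current psi T al.
Proof.
move=> pq ta; have [ga _ H] := scalar_mul_bound pq (test_ddc ta).
by have [_ /(_ psi cpsi)[]] := H T pT.
Qed.

Lemma ddc_current_cvg_hess q al : (p + q.+1)%N = n -> test_form q q al ->
  T (fun x => wedge (hess (appr psi i) x) (al x)) @[i --> \oo] --> ddc_current psi T al.
Proof.
move=> pq ta; have := ddc_current_cvg pq ta.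
by rewrite (_ : (fun i => _) = fun i => T (fun x => appr psi i x *: ddc al x))//;
   apply/funext => i; rewrite (current_ibp pT cT pq).
Qed.

Let ddc_current_unique q al (u : nat -> R) (c : R) : (p + q.+1)%N = n -> test_form q q al ->
  (forall i, T (fun x => appr psi i x *: ddc al x) = u i) -> u @ \oo --> c -> ddc_current psi T al = c.
Proof.
move=> pq ta Tu ul; have := ddc_current_cvg pq ta.
rewrite (_ : (fun i => _) = u); last by apply/funext.
by move=> H; exact: (cvg_unique _ H ul).
Qed.

Lemma ddc_current_smooth q al : (p + q.+1)%N = n -> test_form q q al -> smooth psi ->
  ddc_current psi T al = T (fun x => wedge (hess psi x) (al x)).
Proof.
move=> pq ta spsi; have [ga _ H] := scalar_mul_bound pq (test_ddc ta).
have [_ /(_ psi cpsi)[_ /(_ psi 0 spsi (lexx _))]] := H T pT.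
rewrite mul0r normr_le0 subr_eq0 -(current_ibp pT cT pq)// => H0; apply/eqP/H0 => x _.
by rewrite subrr normr0.
Qed.

Lemma ddc_current_linear q : (p.+1 + q)%N = n -> linear_on q (ddc_current psi T).
Proof.
rewrite addSnnS => pq c al be ta tb.
have Tl : linear_on q.+1 T by have [H _ _] := pT; exact: H.
have tab : test_form q q (fun x => c *: al x + be x).
  by apply: test_formD => //; exact: test_formZ.
apply: (ddc_current_unique pq tab (fun=> erefl)).
rewrite (_ : (fun i => _) = fun i => c * T (fun x => appr psi i x *: ddc al x) +
   T (fun x => appr psi i x *: ddc be x)).
  exact: (cvgD (cvgM (cvg_cst c) (ddc_current_cvg pq ta)) (ddc_current_cvg pq tb)).
apply/funext => i; rewrite -Tl; [|by apply: test_scale => //; exact: test_ddc..].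
congr T; apply/funext => x; rewrite (ddc_lin c (test_sm ta) (test_sm tb)).
by rewrite scalerDr !scalerA mulrC.
Qed.

(** dd^# anticommutes with [swapx], and [T] contributes (-1)^(q+1) in degree q + 1; the net sign is
    (-1)^q. *)
Lemma ddc_current_swapx q al : (p.+1 + q)%N = n -> test_form q q al ->
  ddc_current psi T (fun x => swapx (al x)) = (-1) ^+ q * ddc_current psi T al.
Proof.
rewrite addSnnS => pq ta; have Tl : linear_on q.+1 T by have [H _ _] := pT; exact: H.
have [_ [Tsym _] _] := pT.
apply: (ddc_current_unique pq (test_swapx ta) (fun=> erefl)).
rewrite (_ : (fun i => _) = fun i => (-1) ^+ q * T (fun x => appr psi i x *: ddc al x)).
  exact: (cvgM (cvg_cst _) (ddc_current_cvg pq ta)).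
apply/funext => i.
have tw : test_form q.+1 q.+1 (fun x => appr psi i x *: ddc al x).
  by apply: test_scale => //; exact: test_ddc.
rewrite (ddc_swapx (test_sm ta)).
rewrite (_ : (fun x => _ *: - _) = fun x => -1 *: swapx (appr psi i x *: ddc al x)); last first.
  by apply/funext => x; rewrite (linZE _ _ (@lin_swapx R n)) scaleN1r scalerN.
rewrite (currentZ Tl); last exact: test_swapx.
by rewrite (current_swapx pq Tl Tsym tw) exprS mulN1r mulNr mulrNN mul1r.
Qed.

Lemma ddc_current_positive_strong : positive_strong p.+1 (ddc_current psi T).
Proof.
have Tsym : symmetric_current p.+1 (ddc_current psi T).
  move=> I K Ip Kp f tf; pose q := (n - p.+1)%N.
  have pq : (p.+1 + q)%N = n by rewrite subnKC// -Ip -[X in (_ <= X)%N]card_ord max_card.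
  have cC (J : {set 'I_n}) : #|J| = p.+1 -> #|(~: J)%SET| = q.
    by move=> Jp; have := cardsC J; rewrite card_ord Jp -[in RHS]pq => /addnI.
  have td : test_form q q (fun x => f x *: dual_form R K I).
    apply: test_scale_cst => //; apply: bidegreeZ.
    by have := @bidegree_ebase R n ((~: K)%SET, (~: I)%SET); rewrite /= !cC.
  have tsd := test_swapx td.
  (* The normalizing constants agree by [dual_coef_sym], so only the sign of the swap remains, and
     symmetry of the coefficients reduces to [ddc_current_swapx]. *)
  have D : dual_form R I K = (-1) ^+ q *: swapx (dual_form R K I).
    rewrite /dual_form/= (linZE _ _ (@lin_swapx R n)).
    rewrite -[dxdxi R (~: K)%SET _]/(ebase R ((~: K)%SET, (~: I)%SET)) swapx_ebase/= !cC//.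
    rewrite (@dual_coef_sym R n I K) ?Ip// scalerA scalerA mulrAC.
    by rewrite sqr_sign -expr2 sqrr_sign mul1r.
  have E : (fun x => f x *: dual_form R I K) = fun x => (-1) ^+ q *: swapx (f x *: dual_form R K I).
    by apply/funext => x; rewrite (linZE _ _ (@lin_swapx R n)) D !scalerA mulrC.
  rewrite /current_coef E (currentZ (ddc_current_linear pq) _ tsd) (ddc_current_swapx pq td).
  by rewrite mulrA -expr2 sqrr_sign mul1r.
split; first exact: ddc_current_linear.
  split=> // q; rewrite addSnnS => pq al ta pal.
  have [_ [_ Tp] _] := pT.
  have H i : 0 <= T (fun x => wedge (hess (appr psi i) x) (al x)).
    apply: (Tp q.+1 pq _ (test_hess_wedge (sappr i) ta)) => x.
    apply: (hess_wedge_ind (P := strongly_positive q) _ (sappr i) (cappr i) (pal x)).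
    - exact: sp0.
    - exact: spD.
    - by move=> b v; exact: sp_sq.
  have L := ddc_current_cvg_hess pq ta.
  by rewrite -(cvg_lim _ L)//; apply: limr_ge; [exact: cvgP L|exact: nearW].
split=> // q; rewrite addSnnS => pq al ta nal.
have [_ _ [_ Tn]] := pT.
have H i : T (fun x => wedge (hess (appr psi i) x) (al x)) = 0.
  apply: (Tn q.+1 pq _ (test_hess_wedge (sappr i) ta)) => x.
  apply: (hess_wedge_ind (P := weakly_null q) _ (sappr i) (cappr i) (nal x)).
  - exact: weakly_null0.
  - exact: weakly_nullD.
  - by move=> b v; exact: weakly_null_sq.
have L := ddc_current_cvg_hess pq ta; apply: (cvg_unique _ L) => //.
rewrite (_ : (fun i => _) = fun=> 0); last by apply/funext.
exact: cvg_cst.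
Qed.

Lemma ddc_current_closed : closed_positive_strong p.+1 (ddc_current psi T).
Proof.
have pM := ddc_current_positive_strong; split; [exact: positive_strong_current| |by have [] := pM|by have [] := pM].
move=> p' q' pp' pq' al ta; have E : q' = p'.+1 by lia.
rewrite E in ta pq'; have pq : (p + p'.+2)%N = n by lia.
have td : test_form p'.+1 p'.+1 (ext_d al).
  rewrite ext_dE; apply: test_form_sum => j; apply: test_wedge_dx; exact: test_pform.
(* Each approximating value already vanishes because dd^# d = 0. *)
apply: (ddc_current_unique (u := fun=> 0) pq td) => [i|]; last exact: cvg_cst.
rewrite (ddc_ext_d (test_sm ta)) (_ : (fun _ => _) = fun=> 0).
  have [Tl _ _] := pT; exact: (current0 (Tl _ pq)).
by apply/funext => x; rewrite scaler0.
Qed.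

End ConvexProduct.

(** One smooth [f] within [d] of [psi] on the support is compared with both products; for large i it
    is within 2 d of [psi_ i]. On the test form [f *: ddc al] weak* convergence applies, and the
    same convergence on [ga] bounds the masses. *)
Lemma ddc_current_continuous p q (psi_ : nat -> V -> R) psi (T_ : nat -> func) T al :
  (p + q.+1)%N = n -> (forall i, convex (psi_ i)) -> convex psi ->
  (forall i, positive_strong p (T_ i)) -> positive_strong p T ->
  (forall e, 0 < e -> \forall i \near \oo, forall x, `|psi x - psi_ i x| < e) ->
  (forall be, test_form q.+1 q.+1 be -> T_ i be @[i --> \oo] --> T be) ->
  test_form q q al -> ddc_current (psi_ i) (T_ i) al @[i --> \oo] --> ddc_current psi T al.
Proof.
move=> pq ci c pTi pT U W ta; have td := test_ddc ta.
have [ga tga H] := scalar_mul_bound pq td.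
have [Tga HT] := H T pT.
apply/cvgrPdist_lt => e e0.
have fin (a b c' : R) : c' * b <= c' * (a + 4^-1) -> c' * (a + 1) = e / 4 -> 0 < e -> 0 < c' ->
    c' * a + e / 8 + (c' + c') * b < e.
  move=> H1 H2 H3 H4; rewrite mulrDr in H1; rewrite mulrDr mulr1 in H2; rewrite mulrDl.
  lra.
(* This makes [d * (T ga + 1)] equal to e / 4. The errors are [d * T ga] for the limit, e / 8 for
   exchanging the currents, and [2 d * T_ i ga] with [T_ i ga] below [T ga + 1 / 4]: at most 7 e / 8
   in all. *)
pose d : R := e / (4 * (T ga + 1)).
have Tga1 : 0 < T ga + 1 by rewrite ltr_wpDl.
have d0 : 0 < d by rewrite divr_gt0// mulr_gt0.
have [N HN] := test_form_bounded_supp td.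
have [f [sf cf fpsi]] := convex_approx N%:R c d0.
have tf : test_form q.+1 q.+1 (fun x => f x *: ddc al x) by exact: test_scale.
near=> i.
have A1 : `|ddc_current psi T al - T (fun x => f x *: ddc al x)| <= d * T ga.
  by apply: (HT psi c).2 => // [|x /HN]; [exact: ltW|exact: fpsi].
have [Tiga HTi] := H (T_ i) (pTi i).
have A2 : `|ddc_current (psi_ i) (T_ i) al - T_ i (fun x => f x *: ddc al x)| <= (d + d) * T_ i ga.
  apply: (HTi _ (ci i)).2 => // [|x /HN xN]; first by rewrite addr_ge0// ltW.
  rewrite -(subrK (psi x) (f x)) -addrA; apply: (le_trans (ler_normD _ _)).
  apply: lerD; first exact: fpsi.
  by apply: ltW; move: x {xN}; near: i; exact: U.
have A3 : `|T (fun x => f x *: ddc al x) - T_ i (fun x => f x *: ddc al x)| < e / 8.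
  by near: i; have /cvgrPdist_lt/(_ (e / 8)) := W _ tf; apply; rewrite divr_gt0.
have A4 : `|T ga - T_ i ga| < 4^-1.
  by near: i; have /cvgrPdist_lt/(_ 4^-1) := W _ tga; apply; rewrite invr_gt0.
have dE : d * (T ga + 1) = e / 4 by rewrite /d; field; rewrite gt_eqF.
have A5 : d * T_ i ga <= d * (T ga + 4^-1).
  by rewrite ler_pM2l// -lerBlDl; apply: ltW; move: A4; rewrite distrC; apply/le_lt_trans/ler_norm.
have A6 : `|ddc_current psi T al - ddc_current (psi_ i) (T_ i) al| <= d * T ga + e / 8 + (d + d) * T_ i ga.
  apply: (le_trans (ler_distD (T (fun x => f x *: ddc al x)) _ _)).
  rewrite -addrA; apply: lerD => //.
  apply: (le_trans (ler_distD (T_ i (fun x => f x *: ddc al x)) _ _)).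
  by apply: lerD; [exact: ltW|rewrite distrC].
exact: (le_lt_trans A6 (fin _ _ _ A5 dE e0 d0)).
Unshelve. all: by end_near.
Qed.

End Currents.

(** * Iterated products *)

Section Currents.
Variables (R : realType) (n : nat).
Notation V := 'rV[R]_n.
Notation form := (sform R n).
Notation sfm := (superform R n).
Notation func := (functional R n).
Implicit Types (x : V) (T : func).

Lemma uniform_cvg_near (psi_ : nat -> V -> R) (psi : V -> R) : {uniform, psi_ @ \oo --> psi} ->
  forall e, 0 < e -> \forall i \near \oo, forall x, `|psi x - psi_ i x| < e.
Proof.
move=> H e e0.
have N : @nbhs _ {uniform V -> R} psi [set f | forall x, `|psi x - f x| < e].
  apply/uniform_nbhs; exists [set xy | ball xy.1 e xy.2]; split; first exact: (entourage_ball (R : pseudoMetricType R) (PosNum e0)).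
  by move=> f /= Hf x; have := Hf x; rewrite /ball/=; apply.
exact: H N.
Qed.

(** One function at a time, [psi ord0] acting first: under the standing hypotheses each step returns
    a closed, positive and strong current, as the next step requires. *)
Fixpoint ddc_currents (k : nat) : ('I_k -> V -> R) -> func -> func :=
  if k is k'.+1 then fun (psi : 'I_k'.+1 -> V -> R) T => ddc_currents (fun j => psi (lift ord0 j)) (ddc_current (psi ord0) T)
  else fun _ T => T.

Lemma ddc_currents_closed (k : nat) p (psi : 'I_k -> V -> R) T : (forall j, convex (psi j)) ->
  closed_positive_strong p T -> closed_positive_strong (p + k) (ddc_currents psi T).
Proof.
elim: k p psi T => [|k IH] p psi T cpsi HT; first by rewrite addn0.
have [_ cT _ _] := HT.
have cM := ddc_current_closed (closed_positive_strongW HT) cT (cpsi ord0).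
rewrite addnS -addSn; exact: (IH p.+1 _ _ (fun j => cpsi (lift ord0 j)) cM).
Qed.

Lemma dd_sharp_wedgeS (k : nat) (psi : 'I_k.+1 -> V -> R) : (forall j, smooth (psi j)) ->
  dd_sharp_wedge psi =
  fun x => wedge (hess (psi ord0) x) (dd_sharp_wedge (fun j => psi (lift ord0 j)) x).
Proof.
move=> spsi; apply/funext => x; rewrite /dd_sharp_wedge wedge_unlock big_ord_recl.
by rewrite (dd_sharpE (spsi ord0)).
Qed.

Lemma dd_sharp_wedge_smooth (k : nat) (psi : 'I_k -> V -> R) : (forall j, smooth (psi j)) ->
  (forall x, bidegree k k (dd_sharp_wedge psi x)) /\ smooth_form (dd_sharp_wedge psi).
Proof.
elim: k psi => [|k IH] psi spsi.
  rewrite (_ : dd_sharp_wedge psi = fun=> sform1 R n); last first.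
    by apply/funext => x; rewrite /dd_sharp_wedge big_ord0.
  split=> [x|]; last exact: sm_cst.
  by have := @bidegree_ebase R n (finset.set0, finset.set0); rewrite /= cards0.
rewrite (dd_sharp_wedgeS spsi).
have [b s] := IH (fun j => psi (lift ord0 j)) (fun j => spsi (lift ord0 j)).
split=> [x|]; last exact: (sm_wedge (sm_hess (spsi ord0)) s).
exact: (bidegree_swedge (@bidegree_hess R n (psi ord0) x) (b x)).
Qed.

Lemma ddc_currents_smooth (k : nat) p (psi : 'I_k -> V -> R) T :
  (forall j, smooth (psi j)) -> (forall j, convex (psi j)) ->
  closed_positive_strong p T ->
  eq_current (p + k) (p + k) (ddc_currents psi T) (wedge_current (dd_sharp_wedge psi) T).
Proof.
elim: k p psi T => [|k IH] p psi T spsi cpsi HT p' q' pp' pq' al ta.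
  rewrite /= /wedge_current -wedge_unlock; congr T; apply/funext => x.
  by rewrite /dd_sharp_wedge big_ord0 swedge1l.
have E : q' = p' by lia.
rewrite E in ta; have pT := closed_positive_strongW HT; have [_ cT _ _] := HT.
pose psi' j := psi (lift ord0 j).
have pk : (p.+1 + k + p')%N = n by lia.
have [b s] := dd_sharp_wedge_smooth (fun j => spsi (lift ord0 j)).
(* The forms of the remaining functions are smooth and are absorbed into the test form, so that
   [ddc_current_smooth] can strip off [psi ord0]. *)
have tw : test_form (k + p') (k + p') (fun x => wedge (dd_sharp_wedge psi' x) (al x)).
  exact: test_wedge.
have cM := ddc_current_closed pT cT (cpsi ord0).
have H := IH p.+1 psi' _ (fun j => spsi (lift ord0 j)) (fun j => cpsi (lift ord0 j)) cM p' p' pk pk al ta.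
apply: (etrans H); rewrite /wedge_current -wedge_unlock.
have pq : (p + (k + p').+1)%N = n by lia.
rewrite (ddc_current_smooth pT cT (cpsi ord0) pq tw (spsi ord0)).
by congr T; apply/funext => x; rewrite (dd_sharp_wedgeS spsi) swedgeA.
Qed.

Lemma ddc_currents_continuous (k : nat) p (psi_ : nat -> 'I_k -> V -> R) (psi : 'I_k -> V -> R)
    (T_ : nat -> func) T :
  (forall i j, convex (psi_ i j)) -> (forall j, convex (psi j)) ->
  (forall i, closed_positive_strong p (T_ i)) -> closed_positive_strong p T ->
  (forall j, {uniform, (fun i => psi_ i j) @ \oo --> psi j}) ->
  weak_star_cvg p p T_ T ->
  weak_star_cvg (p + k) (p + k) (fun i => ddc_currents (psi_ i) (T_ i)) (ddc_currents psi T).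
Proof.
elim: k p psi_ psi T_ T => [|k IH] p psi_ psi T_ T ci c HTi HT U W; first by rewrite addn0.
have cM i := ddc_current_closed (closed_positive_strongW (HTi i)) (let: And4 _ cl _ _ := HTi i in cl) (ci i ord0).
have cM' := ddc_current_closed (closed_positive_strongW HT) (let: And4 _ cl _ _ := HT in cl) (c ord0).
rewrite addnS -addSn; apply: (IH p.+1 _ _ _ _ (fun i j => ci i (lift ord0 j))
  (fun j => c (lift ord0 j)) cM cM' (fun j => U (lift ord0 j))).
move=> p' q' pp' pq' al ta; have E : q' = p' by lia.
rewrite E in ta; have pq : (p + p'.+1)%N = n by lia.
apply: (ddc_current_continuous pq (fun i => ci i ord0) (c ord0) (fun i => closed_positive_strongW (HTi i)) (closed_positive_strongW HT)
  (uniform_cvg_near (U ord0)) _ ta).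
by move=> be; apply: W.
Qed.

End Currents.

Theorem theorem4p2 (R : realType) (n k p : nat) :
  exists M : ('I_k -> 'rV[R]_n -> R) -> functional R n -> functional R n,
    [/\ (forall (psi : 'I_k -> 'rV[R]_n -> R) (Omega : functional R n),
           (forall j, smooth (psi j)) -> (forall j, convex (psi j)) ->
           closed_positive_strong p Omega ->
           eq_current (p + k) (p + k) (M psi Omega)
             (wedge_current (dd_sharp_wedge psi) Omega)),
        (forall (psi_ : nat -> 'I_k -> 'rV[R]_n -> R)
                (psi : 'I_k -> 'rV[R]_n -> R)
                (Omega_ : nat -> functional R n) (Omega : functional R n),
           (forall i j, convex (psi_ i j)) -> (forall j, convex (psi j)) ->
           (forall i, closed_positive_strong p (Omega_ i)) ->
           closed_positive_strong p Omega ->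
           (forall j, {uniform, (fun i => psi_ i j) @ \oo --> psi j}) ->
           weak_star_cvg p p Omega_ Omega ->
           weak_star_cvg (p + k) (p + k)
             (fun i => M (psi_ i) (Omega_ i)) (M psi Omega))
      & (forall (psi : 'I_k -> 'rV[R]_n -> R) (Omega : functional R n),
           (forall j, convex (psi j)) -> closed_positive_strong p Omega ->
           closed_positive_strong (p + k) (M psi Omega))].
Proof.
exists (@ddc_currents R n k); split; [exact: ddc_currents_smooth|exact: ddc_currents_continuous|exact: ddc_currents_closed].
Qed.
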